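(* Let $H:\mathbb{C}_+\to\overline{\mathbb{C}_+}$ be analytic. Then the following statements are equivalent: (a) $H$ is the infinitesimal generator of a continuous semigroup of elements in the class $\mathcal{G}$. (b) $H\in\mathcal{H}^{\infty}(\mathbb{C}_{\varepsilon})$ for all $\varepsilon>0$. (c) $H$ is a Dirichlet series.
   Context: For $\theta\in\mathbb{R}$, $\mathbb{C}_\theta=\{s\in\mathbb{C}:\operatorname{Re}(s)>\theta\}$, $\mathbb{C}_+=\mathbb{C}_0$, and $\overline{\mathbb{C}_+}$ is the closed right half-plane. $\mathcal{D}$ denotes the space of Dirichlet series $\sum_{n\ge1}a_nn^{-s}$ that converge in some half-plane $\mathbb{C}_\theta$; a holomorphic function on a half-plane is said to be a Dirichlet series (to belong to $\mathcal{D}$) if it coincides with such a convergent series on some half-plane. For $\varepsilon\ge0$, $\mathcal{H}^\infty(\mathbb{C}_\varepsilon)$ is the space of bounded analytic functions on $\mathbb{C}_\varepsilon$ that can be written as a Dirichlet series in some half-plane; $H\in\mathcal{H}^\infty(\mathbb{C}_\varepsilon)$ means that the restriction of $H$ to $\mathbb{C}_\varepsilon$ belongs to this space. Gordon-Hedenmalm class $\mathcal{G}$: an analytic $\Phi:\mathbb{C}_+\to\mathbb{C}_+$ belongs to $\mathcal{G}$ if there are $c_\Phi\in\mathbb{N}\cup\{0\}$ and $\varphi\in\mathcal{D}$ such that $\Phi(s)=c_\Phi s+\varphi(s)$ for $s\in\mathbb{C}_+$, and, in case $c_\Phi=0$, moreover $\Phi(\mathbb{C}_+)\subset\mathbb{C}_{1/2}$.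 A continuous semigroup is a family $\{\Phi_t\}_{t\ge0}$ of analytic functions $\Phi_t:\mathbb{C}_+\to\mathbb{C}_+$ with $\Phi_0(s)=s$, $\Phi_t\circ\Phi_u=\Phi_{t+u}$ for all $t,u\ge0$, and $\Phi_t\to\Phi_0$ uniformly on compact subsets of $\mathbb{C}_+$ as $t\to0^+$. Its infinitesimal generator is the holomorphic function $H(s)=\lim_{t\to0^+}\frac{\Phi_t(s)-s}{t}$, $s\in\mathbb{C}_+$ (the limit exists uniformly on compact sets, and $\frac{\partial}{\partial t}\Phi_t(s)=H(\Phi_t(s))$, $\Phi_0(s)=s$). *)

(* Defs.v *)
From Stdlib Require Import Reals List.
From Coquelicot Require Import Coquelicot.
Open Scope R_scope.

(** Functions on a half-plane are represented by total functions [C -> C]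
    whose values outside the half-plane are never used. *)

Definition half_plane (theta : R) (s : C) : Prop := theta < Re s.

Definition analytic_on (U : C -> Prop) (f : C -> C) : Prop :=
  forall s : C, U s -> @ex_derive C_AbsRing C_NormedModule f s.

Definition Cexp (z : C) : C :=
  (exp (Re z) * cos (Im z), exp (Re z) * sin (Im z)).

(** [n^{-s} = exp (- s * ln n)].  Coquelicot's series start at [0], hence the
    shift of the index; the coefficient [a 0] plays no role. *)
Definition dirichlet_term (a : nat -> C) (s : C) (n : nat) : C :=
  (a n * Cexp (- (s * RtoC (ln (INR n)))))%C.

Definition is_dirichlet_sum (a : nat -> C) (s l : C) : Prop :=
  @is_series C_AbsRing C_NormedModule (fun n => dirichlet_term a s (S n)) l.

(** [f] coincides with a convergent Dirichlet series on some half-plane.  For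
    [f] given on the half-plane of abscissa [sigma] one may always enlarge
    [theta] so that [sigma <= theta]; so values outside the domain do not
    matter. *)
Definition is_dirichlet_series (f : C -> C) : Prop :=
  exists (a : nat -> C) (theta : R),
    forall s : C, half_plane theta s -> is_dirichlet_sum a s (f s).

Definition bounded_on (U : C -> Prop) (f : C -> C) : Prop :=
  exists M : R, forall s : C, U s -> Cmod (f s) <= M.

Record Hinfty (eps : R) (f : C -> C) : Prop := {
  Hinfty_analytic : analytic_on (half_plane eps) f;
  Hinfty_bounded : bounded_on (half_plane eps) f;
  Hinfty_dirichlet : is_dirichlet_series f
}.

Record analytic_self_map (Phi : C -> C) : Prop := {
  self_map_analytic : analytic_on (half_plane 0) Phi;
  self_map_maps : forall s : C, half_plane 0 s -> half_plane 0 (Phi s)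
}.

Record gordon_hedenmalm (Phi : C -> C) : Prop := {
  GH_self_map : analytic_self_map Phi;
  GH_form :
    exists (c : nat) (phi : C -> C),
      is_dirichlet_series phi /\
      (forall s : C, half_plane 0 s -> Phi s = (RtoC (INR c) * s + phi s)%C) /\
      (c = 0%nat -> forall s : C, half_plane 0 s -> half_plane (1 / 2) (Phi s))
}.

Definition compact_set (K : C -> Prop) : Prop :=
  forall (I : Type) (U : I -> C -> Prop),
    (forall i : I, open (U i)) ->
    (forall z : C, K z -> exists i : I, U i z) ->
    exists l : list I, forall z : C, K z -> exists i : I, In i l /\ U i z.

(** [Phi t] is only meaningful for [0 <= t]. *)
Record continuous_semigroup (Phi : R -> C -> C) : Prop := {
  semigroup_self_map : forall t : R, 0 <= t -> analytic_self_map (Phi t);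
  semigroup_0 : forall s : C, half_plane 0 s -> Phi 0 s = s;
  semigroup_comp :
    forall t u : R, 0 <= t -> 0 <= u ->
    forall s : C, half_plane 0 s -> Phi t (Phi u s) = Phi (t + u) s;
  semigroup_continuous :
    forall K : C -> Prop, compact_set K ->
    (forall s : C, K s -> half_plane 0 s) ->
    forall eps : posreal,
      at_right 0 (fun t => forall s : C, K s -> Cmod (Phi t s - Phi 0 s) < eps)
}.

Definition is_generator (Phi : R -> C -> C) (H : C -> C) : Prop :=
  forall s : C, half_plane 0 s ->
    filterlim (fun t : R => ((Phi t s - s) / RtoC t)%C)
      (at_right 0) (locally (H s)).

(* Main.v *)
Require Import Defs.
From Stdlib Require Import Reals ZArith Lra Lia ClassicalEpsilon List.
From Coquelicot Require Import Coquelicot.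
Open Scope R_scope.

(** If [H] is a Dirichlet series with [Re H >= 0], Schwarz-Pick shows that [H]
    is bounded and Lipschitz on every [Re s >= eps]; the Euler scheme then
    converges to a flow, and each Euler map is [s] plus a uniform limit of
    Dirichlet polynomials.  Such uniform limits are Dirichlet series because
    the n-th coefficient of a Dirichlet polynomial is bounded by its sup norm.

    Conversely, the maps of a semigroup in the class G have characteristic [1],
    [Phi t s = s + phi_t s] with [Re phi_t >= 0].  Let [a_t] be the constant
    coefficient of [phi_t].  If [Re a_t = 0] for all [t], every [phi_t] is
    constant, and so is [H].  If [Re a_T > 0], the orbits of [Phi T] move to
    the right at linear speed, so that [h s = lim (Phi (n T) s - n a_T)] exists
    and [h s - s] is a Dirichlet series.  It satisfies Abel's equation
    [h (Phi t s) = h s + a_t]; differentiating at [t = 0] gives that [h' H] is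
    a constant [c], and [H = c / h'] is a Dirichlet series.  No analytic
    continuation of the individual series [phi_t] is needed. *)

(** * Goursat's lemma on rectangles *)

(** All complex analysis rests on one estimate, [Cmod d <= M / R0] for the derivative at the centre
    of a disc. The exponential turns circles around the centre into vertical segments, so Goursat's
    lemma on rectangles yields it without circular contours or power series; Schwarz-Pick,
    Weierstrass' theorem and the control of derivatives of Dirichlet series are drawn from it. The
    obstacle in the converse direction is that the half-plane of convergence of [phi_t] depends on
    [t] with no uniformity as [t] tends to 0: the quotients [phi_t / t] converge to [H], but need
    not be Dirichlet series on a common half-plane. Hence [h] is built from the iterates of one map,
    whose displacements all live on one half-plane. For the other times Abel's equation is tested
    far along an orbit of that map, which eventually enters any right half-plane. *)

Definition diff2 (p : R -> R -> R) (x y A B : R) : Prop :=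
  forall eps : R, 0 < eps -> exists delta : R, 0 < delta /\
    forall x' y' : R, Rabs (x' - x) < delta -> Rabs (y' - y) < delta ->
      Rabs (p x' y' - p x y - A * (x' - x) - B * (y' - y))
        <= eps * (Rabs (x' - x) + Rabs (y' - y)).

(** Total differentiability with equal cross derivatives [p_y = q_x = B]: the pointwise condition
    for [p dx + q dy] to be closed, without continuity of the partial derivatives. *)
Definition closed_form_at (p q : R -> R -> R) (x y : R) : Prop :=
  exists A B D : R, diff2 p x y A B /\ diff2 q x y B D.

(** The integral of [p dx + q dy] along the boundary of the rectangle, counterclockwise. *)
Definition rect_integral (p q : R -> R -> R) (a b c d : R) : R :=
  RInt (fun x => p x c) a b + RInt (fun y => q b y) c d
  - RInt (fun x => p x d) a b - RInt (fun y => q a y) c d.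

Lemma continuous_of_linear_bound (f : R -> R) (x K delta : R) :
  0 < delta ->
  (forall x', Rabs (x' - x) < delta -> Rabs (f x' - f x) <= K * Rabs (x' - x)) ->
  continuous f x.
Proof.
intros Hd H.
apply continuity_pt_filterlim.
intros eps Heps.
assert (HK : 0 < Rabs K + 1) by (pose proof (Rabs_pos K); lra).
exists (Rmin delta (eps / (Rabs K + 1))); split.
{ apply Rmin_glb_lt; auto. apply Rdiv_lt_0_compat; lra. }
intros x' [_ Hx']. simpl in *. unfold R_dist in *.
assert (H1 : Rabs (x' - x) < delta) by (eapply Rlt_le_trans; [apply Hx'|apply Rmin_l]).
assert (H2 : Rabs (x' - x) < eps / (Rabs K + 1)) by (eapply Rlt_le_trans; [apply Hx'|apply Rmin_r]).
specialize (H x' H1).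
apply Rle_lt_trans with (1 := H).
apply Rle_lt_trans with ((Rabs K + 1) * Rabs (x' - x)).
{ apply Rmult_le_compat_r. apply Rabs_pos. pose proof (Rle_abs K); lra. }
replace eps with ((Rabs K + 1) * (eps / (Rabs K + 1))) by (field; lra).
apply Rmult_lt_compat_l; lra.
Qed.

Lemma diff2_continuous_fst (p : R -> R -> R) (x y A B : R) :
  diff2 p x y A B -> continuous (fun x' => p x' y) x.
Proof.
intros H. destruct (H 1 Rlt_0_1) as [d [Hd Hx]].
apply (continuous_of_linear_bound _ _ (Rabs A + 1) d Hd).
intros x' H1.
specialize (Hx x' y H1). rewrite Rminus_eq_0, Rabs_R0 in Hx. specialize (Hx Hd).
rewrite Rmult_0_r, Rminus_0_r, Rplus_0_r in Hx.
replace (p x' y - p x y) with ((p x' y - p x y - A * (x' - x)) + A * (x' - x)) by ring.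
eapply Rle_trans. apply Rabs_triang. rewrite Rabs_mult. lra.
Qed.

Lemma diff2_continuous_snd (p : R -> R -> R) (x y A B : R) :
  diff2 p x y A B -> continuous (fun y' => p x y') y.
Proof.
intros H. destruct (H 1 Rlt_0_1) as [d [Hd Hx]].
apply (continuous_of_linear_bound _ _ (Rabs B + 1) d Hd).
intros y' H1.
specialize (Hx x y'). rewrite Rminus_eq_0, Rabs_R0 in Hx. specialize (Hx Hd H1).
rewrite Rmult_0_r, Rminus_0_r, Rplus_0_l in Hx.
replace (p x y' - p x y) with ((p x y' - p x y - B * (y' - y)) + B * (y' - y)) by ring.
eapply Rle_trans. apply Rabs_triang. rewrite Rabs_mult. lra.
Qed.

(** The intervals [[x n, x n + V n]] are nested, and the limit of their left endpoints lies in all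
    of them. *)
Lemma nested_limit (x : nat -> R) (V : nat -> R) :
  (forall n, x n <= x (S n)) -> (forall n, x (S n) + V (S n) <= x n + V n) ->
  (forall n, 0 <= V n) ->
  exists l, forall n, x n <= l <= x n + V n.
Proof.
intros Hinc Hdec Hpos.
assert (D : forall n k, x n <= x (n + k)%nat /\ x (n + k)%nat + V (n + k)%nat <= x n + V n).
{ intros n k. induction k as [|k IH].
  - rewrite Nat.add_0_r. lra.
  - rewrite Nat.add_succ_r. specialize (Hinc (n + k)%nat). specialize (Hdec (n + k)%nat). lra. }
assert (Hbd : forall n, x n <= x 0%nat + V 0%nat).
{ intros n. destruct (D 0%nat n) as [_ H]. simpl in H. specialize (Hpos n). lra. }
destruct (ex_finite_lim_seq_incr x (x 0%nat + V 0%nat) Hinc Hbd) as [l Hl].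
exists l. intros n. split.
- assert (Rbar_le (Finite (x n)) (Finite l)); [|assumption].
  apply (is_lim_seq_le_loc (fun _ => x n) x); [|apply is_lim_seq_const|exact Hl].
  exists n. intros m Hm. replace m with (n + (m - n))%nat by lia. apply D.
- assert (Rbar_le (Finite l) (Finite (x n + V n))); [|assumption].
  apply (is_lim_seq_le_loc x (fun _ => x n + V n)); [|exact Hl|apply is_lim_seq_const].
  exists n. intros m Hm. replace m with (n + (m - n))%nat by lia.
  destruct (D n (m - n)%nat) as [_ H]. specialize (Hpos (n + (m - n))%nat). lra.
Qed.

Lemma exists_small_power (r eps : R) : 0 <= r -> 0 < eps -> exists n : nat, r / 2 ^ n < eps.
Proof.
intros Hr He. destruct (pow_lt_1_zero (/ 2)) with (y := eps / (r + 1)) as [N HN].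
- rewrite Rabs_pos_eq; lra.
- apply Rdiv_lt_0_compat; lra.
- exists N. specialize (HN N (le_n N)). rewrite Rabs_pos_eq in HN by (apply pow_le; lra).
  unfold Rdiv. rewrite <- pow_inv.
  apply Rle_lt_trans with ((r + 1) * (/ 2) ^ N).
  + apply Rmult_le_compat_r; [apply pow_le; lra|lra].
  + replace eps with ((r + 1) * (eps / (r + 1))) by (field; lra).
    apply Rmult_lt_compat_l; lra.
Qed.

Section Goursat.

Variables (p q : R -> R -> R) (a b c d : R).
Hypothesis Hab : a < b.
Hypothesis Hcd : c < d.
Hypothesis Hclosed : forall x y, a <= x <= b -> c <= y <= d -> closed_form_at p q x y.

Lemma ex_RInt_horizontal (f : R -> R -> R) (Hf : f = p \/ f = q) x1 x2 y :
  a <= x1 <= b -> a <= x2 <= b -> c <= y <= d -> ex_RInt (fun x => f x y) x1 x2.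
Proof.
intros H1 H2 Hy. apply (@ex_RInt_continuous R_CompleteNormedModule).
intros z Hz.
assert (a <= z <= b).
{ revert Hz. apply Rmin_case; apply Rmax_case; intros; lra. }
destruct (Hclosed z y) as [A [B [D [Hp Hq]]]]; auto.
destruct Hf as [-> | ->]; eapply diff2_continuous_fst; eassumption.
Qed.

Lemma ex_RInt_vertical (f : R -> R -> R) (Hf : f = p \/ f = q) x y1 y2 :
  a <= x <= b -> c <= y1 <= d -> c <= y2 <= d -> ex_RInt (fun y => f x y) y1 y2.
Proof.
intros Hx H1 H2. apply (@ex_RInt_continuous R_CompleteNormedModule).
intros z Hz.
assert (c <= z <= d).
{ revert Hz. apply Rmin_case; apply Rmax_case; intros; lra. }
destruct (Hclosed x z) as [A [B [D [Hp Hq]]]]; auto.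
destruct Hf as [-> | ->]; eapply diff2_continuous_snd; eassumption.
Qed.

(** The edges interior to the subdivision are run through twice, in opposite directions. *)
Lemma rect_integral_quarters x y w k :
  0 < w -> 0 < k -> a <= x -> x + 2 * w <= b -> c <= y -> y + 2 * k <= d ->
  rect_integral p q x (x + 2 * w) y (y + 2 * k) =
    rect_integral p q x (x + w) y (y + k)
    + rect_integral p q (x + w) (x + w + w) y (y + k)
    + rect_integral p q x (x + w) (y + k) (y + k + k)
    + rect_integral p q (x + w) (x + w + w) (y + k) (y + k + k).
Proof.
intros Hw Hk H1 H2 H3 H4. unfold rect_integral.
replace (x + 2 * w) with (x + w + w) by ring.
replace (y + 2 * k) with (y + k + k) by ring.
assert (HX : forall y', c <= y' <= d ->
  RInt (fun x => p x y') x (x + w + w) =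
  RInt (fun x => p x y') x (x + w) + RInt (fun x => p x y') (x + w) (x + w + w)).
{ intros y' Hy'. symmetry. apply (@RInt_Chasles R_CompleteNormedModule);
  apply ex_RInt_horizontal; auto; lra. }
assert (HY : forall x', a <= x' <= b ->
  RInt (fun y => q x' y) y (y + k + k) =
  RInt (fun y => q x' y) y (y + k) + RInt (fun y => q x' y) (y + k) (y + k + k)).
{ intros x' Hx'. symmetry. apply (@RInt_Chasles R_CompleteNormedModule);
  apply ex_RInt_vertical; auto; lra. }
rewrite (HX y), (HX (y + k + k)), (HY x), (HY (x + w + w)) by lra.
ring.
Qed.

(** The affine part of a closed form integrates to zero around the rectangle, so only the remainder
    counts: at most [eps / 2 * (w + k)] along a boundary of length [2 * (w + k)]. *)
Lemma rect_integral_small u v eps :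
  0 < eps -> a <= u <= b -> c <= v <= d ->
  exists delta, 0 < delta /\
    forall x y w k, 0 < w < delta -> 0 < k < delta -> a <= x -> x + w <= b ->
      c <= y -> y + k <= d -> x <= u <= x + w -> y <= v <= y + k ->
      Rabs (rect_integral p q x (x + w) y (y + k)) <= eps * ((w + k) * (w + k)).
Proof.
intros Heps Hu Hv.
destruct (Hclosed u v Hu Hv) as [A [B [D [Hp Hq]]]].
destruct (Hp (eps / 2)) as [d1 [Hd1 Hp']]; [lra|].
destruct (Hq (eps / 2)) as [d2 [Hd2 Hq']]; [lra|].
exists (Rmin d1 d2). split. { apply Rmin_glb_lt; auto. }
intros x y w k Hw Hk Hx1 Hx2 Hy1 Hy2 Hux Hvy.
pose proof (Rmin_l d1 d2). pose proof (Rmin_r d1 d2).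
(* On opposite sides the affine parts differ by [- B * k] and [B * w]. Both are removed here; the
   corrections to the integral, [B * k * w] and [- B * w * k], cancel since the same [B] occurs in
   [p] and [q]. *)
set (P := fun t => p t y - p t (y + k) + B * k).
set (Q := fun t => q (x + w) t - q x t - B * w).
assert (EP : ex_RInt P x (x + w)).
{ apply (@ex_RInt_plus R_NormedModule); [|apply ex_RInt_const].
  apply (@ex_RInt_minus R_NormedModule); apply ex_RInt_horizontal; auto; lra. }
assert (EQ : ex_RInt Q y (y + k)).
{ apply (@ex_RInt_minus R_NormedModule); [|apply ex_RInt_const].
  apply (@ex_RInt_minus R_NormedModule); apply ex_RInt_vertical; auto; lra. }
assert (E : rect_integral p q x (x + w) y (y + k) = RInt P x (x + w) + RInt Q y (y + k)).
{ unfold P, Q, rect_integral.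
  rewrite (@RInt_plus R_CompleteNormedModule (fun t => p t y - p t (y + k)) (fun t => B * k)).
  2:{ apply (@ex_RInt_minus R_NormedModule); apply ex_RInt_horizontal; auto; lra. }
  2:{ apply ex_RInt_const. }
  rewrite (@RInt_minus R_CompleteNormedModule (fun t => p t y) (fun t => p t (y + k)))
    by (apply ex_RInt_horizontal; auto; lra).
  rewrite (@RInt_minus R_CompleteNormedModule (fun t => q (x + w) t - q x t) (fun t => B * w)).
  2:{ apply (@ex_RInt_minus R_NormedModule); apply ex_RInt_vertical; auto; lra. }
  2:{ apply ex_RInt_const. }
  rewrite (@RInt_minus R_CompleteNormedModule (fun t => q (x + w) t) (fun t => q x t))
    by (apply ex_RInt_vertical; auto; lra).
  rewrite !(@RInt_const R_CompleteNormedModule).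
  unfold minus, plus, opp, scal, mult; simpl. unfold mult; simpl. ring. }
assert (Babs : forall s t, x <= s <= x + w -> y <= t <= y + k ->
  Rabs (p s t - p u v - A * (s - u) - B * (t - v)) <= eps / 2 * (w + k) /\
  Rabs (q s t - q u v - B * (s - u) - D * (t - v)) <= eps / 2 * (w + k)).
{ intros s t Hs Ht.
  assert (Rabs (s - u) <= w) by (apply Rabs_le; lra).
  assert (Rabs (t - v) <= k) by (apply Rabs_le; lra).
  split.
  - eapply Rle_trans. apply Hp'; lra. apply Rmult_le_compat_l; lra.
  - eapply Rle_trans. apply Hq'; lra. apply Rmult_le_compat_l; lra. }
assert (BP : Rabs (RInt P x (x + w)) <= (x + w - x) * (eps * (w + k))).
{ apply (abs_RInt_le_const P); auto; [lra|].
  intros t Ht. unfold P.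
  destruct (Babs t y) as [H1 _]; [lra|lra|].
  destruct (Babs t (y + k)) as [H2 _]; [lra|lra|].
  apply Rabs_le_between in H1. apply Rabs_le_between in H2.
  apply Rabs_le. lra. }
assert (BQ : Rabs (RInt Q y (y + k)) <= (y + k - y) * (eps * (w + k))).
{ apply (abs_RInt_le_const Q); auto; [lra|].
  intros t Ht. unfold Q.
  destruct (Babs x t) as [_ H1]; [lra|lra|].
  destruct (Babs (x + w) t) as [_ H2]; [lra|lra|].
  apply Rabs_le_between in H1. apply Rabs_le_between in H2.
  apply Rabs_le. lra. }
rewrite E. eapply Rle_trans. apply Rabs_triang. nra.
Qed.

Let W (n : nat) := (b - a) / 2 ^ n.
Let K (n : nat) := (d - c) / 2 ^ n.

Lemma W_half n : W n = 2 * W (S n).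
Proof. unfold W. simpl. field. apply pow_nonzero. lra. Qed.

Lemma K_half n : K n = 2 * K (S n).
Proof. unfold K. simpl. field. apply pow_nonzero. lra. Qed.

Lemma W_pos n : 0 < W n.
Proof. apply Rdiv_lt_0_compat. lra. apply pow_lt. lra. Qed.

Lemma K_pos n : 0 < K n.
Proof. apply Rdiv_lt_0_compat. lra. apply pow_lt. lra. Qed.

Let bad (eps : R) (n : nat) (z : R * R) : Prop :=
  a <= fst z /\ fst z + W n <= b /\ c <= snd z /\ snd z + K n <= d /\
  eps * ((W n + K n) * (W n + K n)) <
    Rabs (rect_integral p q (fst z) (fst z + W n) (snd z) (snd z + K n)).

(** The threshold is quadratic in the side lengths, so it drops by a factor 4 at each halving; if
    all four quarters respected it, the whole rectangle would too. *)
Lemma bad_quarter eps n z : bad eps n z ->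
  exists z', bad eps (S n) z' /\
    fst z <= fst z' <= fst z + W (S n) /\ snd z <= snd z' <= snd z + K (S n).
Proof.
destruct z as [x y]. unfold bad; simpl. rewrite W_half, K_half.
pose proof (W_pos (S n)) as HW. pose proof (K_pos (S n)) as HK.
set (w := W (S n)) in *. set (k := K (S n)) in *.
intros [H1 [H2 [H3 [H4 H5]]]].
rewrite rect_integral_quarters in H5 by auto.
apply NNPP. intros Hno.
assert (G : forall x' y', (x' = x \/ x' = x + w) -> (y' = y \/ y' = y + k) ->
  Rabs (rect_integral p q x' (x' + w) y' (y' + k)) <= eps * ((w + k) * (w + k))).
{ intros x' y' Hx Hy. apply Rnot_lt_le. intros Hlt. apply Hno.
  exists (x', y'). simpl. repeat split; try (destruct Hx; destruct Hy; lra). }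
pose proof (G x y (or_introl eq_refl) (or_introl eq_refl)) as G1.
pose proof (G (x + w) y (or_intror eq_refl) (or_introl eq_refl)) as G2.
pose proof (G x (y + k) (or_introl eq_refl) (or_intror eq_refl)) as G3.
pose proof (G (x + w) (y + k) (or_intror eq_refl) (or_intror eq_refl)) as G4.
revert H5. apply Rle_not_lt.
eapply Rle_trans. apply Rabs_triang.
eapply Rle_trans. apply Rplus_le_compat_r. apply Rabs_triang.
eapply Rle_trans. apply Rplus_le_compat_r. apply Rplus_le_compat_r. apply Rabs_triang.
lra.
Qed.

Let next (eps : R) (n : nat) (z : R * R) : R * R :=
  epsilon (inhabits z) (fun z' => bad eps (S n) z' /\
    fst z <= fst z' <= fst z + W (S n) /\ snd z <= snd z' <= snd z + K (S n)).

Fixpoint corner (eps : R) (n : nat) : R * R :=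
  match n with
  | O => (a, c)
  | S m => next eps m (corner eps m)
  end.

(** Otherwise bisection gives nested bad rectangles shrinking to a point [(u, v)], against
    [rect_integral_small] at that point. *)
Lemma rect_integral_bound eps : 0 < eps ->
  Rabs (rect_integral p q a b c d) <= eps * ((b - a + (d - c)) * (b - a + (d - c))).
Proof.
intros Heps. apply Rnot_lt_le. intros Hlt.
assert (B0 : bad eps 0 (corner eps 0)).
{ unfold bad, W, K; simpl. rewrite !Rdiv_1_r. 
  replace (a + (b - a)) with b by ring. replace (c + (d - c)) with d by ring.
  repeat split; try lra. }
assert (Hstep : forall n, bad eps n (corner eps n) ->
  bad eps (S n) (corner eps (S n)) /\
  fst (corner eps n) <= fst (corner eps (S n)) <= fst (corner eps n) + W (S n) /\
  snd (corner eps n) <= snd (corner eps (S n)) <= snd (corner eps n) + K (S n)).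
{ intros n Hn. simpl. unfold next. apply epsilon_spec. apply bad_quarter, Hn. }
assert (HB : forall n, bad eps n (corner eps n)).
{ induction n as [|n IH]; [exact B0|]. apply Hstep, IH. }
destruct (nested_limit (fun n => fst (corner eps n)) W) as [u Hu].
{ intros n. apply (Hstep n (HB n)). }
{ intros n. destruct (Hstep n (HB n)) as [_ [H _]]. rewrite (W_half n). lra. }
{ intros n. left. apply W_pos. }
destruct (nested_limit (fun n => snd (corner eps n)) K) as [v Hv].
{ intros n. apply (Hstep n (HB n)). }
{ intros n. destruct (Hstep n (HB n)) as [_ [_ H]]. rewrite (K_half n). lra. }
{ intros n. left. apply K_pos. }
destruct (HB 0%nat) as [H1 [H2 [H3 [H4 _]]]].
pose proof (Hu 0%nat) as Hu0. pose proof (Hv 0%nat) as Hv0.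
destruct (rect_integral_small u v eps Heps) as [delta [Hdelta HS]]; [lra|lra|].
destruct (exists_small_power (b - a + (d - c)) delta) as [n Hn]; [lra|lra|].
assert (Hpow : 0 < 2 ^ n) by (apply pow_lt; lra).
assert (W n < delta).
{ eapply Rle_lt_trans; [|exact Hn]. unfold W, Rdiv. apply Rmult_le_compat_r; [|lra].
  left; now apply Rinv_0_lt_compat. }
assert (K n < delta).
{ eapply Rle_lt_trans; [|exact Hn]. unfold K, Rdiv. apply Rmult_le_compat_r; [|lra].
  left; now apply Rinv_0_lt_compat. }
destruct (HB n) as [N1 [N2 [N3 [N4 N5]]]].
pose proof (W_pos n). pose proof (K_pos n).
apply (Rlt_not_le _ _ N5). apply HS; try lra; auto; apply Hu || apply Hv.
Qed.

Theorem goursat_rectangle : rect_integral p q a b c d = 0.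
Proof.
apply NNPP. intros Hne.
assert (H0 : 0 < Rabs (rect_integral p q a b c d)) by now apply Rabs_pos_lt.
set (S := (b - a + (d - c)) * (b - a + (d - c))).
assert (HS : 0 < S) by (unfold S; nra).
(* This choice of [eps] makes the bound equal to half of the left-hand side. *)
assert (H : Rabs (rect_integral p q a b c d) <= Rabs (rect_integral p q a b c d) / (2 * S) * S).
{ apply rect_integral_bound. apply Rdiv_lt_0_compat; lra. }
replace (Rabs (rect_integral p q a b c d) / (2 * S) * S)
  with (Rabs (rect_integral p q a b c d) / 2) in H by (field; lra).
lra.
Qed.

End Goursat.

(** * Complex derivatives *)

Definition cderiv (f : C -> C) (s d : C) : Prop :=
  forall eps : R, 0 < eps -> exists delta : R, 0 < delta /\
    forall z : C, Cmod (z - s) < delta ->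
      Cmod (f z - f s - d * (z - s)) <= eps * Cmod (z - s).

Definition cdiff (f : C -> C) (s : C) : Prop := exists d, cderiv f s d.

Lemma cderiv_is_derive (f : C -> C) (s d : C) :
  @is_derive C_AbsRing C_NormedModule f s d <-> cderiv f s d.
Proof.
split.
- intros [_ H] eps Heps.
  destruct (H s (fun P HP => HP) (mkposreal eps Heps)) as [delta Hd].
  exists delta. split; [apply cond_pos|].
  intros z Hz. specialize (Hd z Hz).
  change (Cmod (f z - f s - (z - s) * d) <= eps * Cmod (z - s)) in Hd.
  now replace (d * (z - s))%C with ((z - s) * d)%C by ring.
- intros H. split; [apply is_linear_scal_l|].
  intros x Hx.
  (* [is_derive] quantifies over all limits [x] of the filter; separation leaves only [s]. *)
  assert (E : s = x).
  { apply (@is_filter_lim_locally_unique C_AbsRing (AbsRing_NormedModule C_AbsRing)). exact Hx. }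
  subst x. intros eps. destruct (H eps (cond_pos eps)) as [delta [Hd1 Hd2]].
  exists (mkposreal delta Hd1). intros z Hz. specialize (Hd2 z Hz).
  change (Cmod (f z - f s - (z - s) * d) <= eps * Cmod (z - s)).
  now replace ((z - s) * d)%C with (d * (z - s))%C by ring.
Qed.

Lemma analytic_on_cdiff (U : C -> Prop) (f : C -> C) :
  analytic_on U f <-> forall s, U s -> cdiff f s.
Proof.
split; intros H s Hs; destruct (H s Hs) as [d Hd]; exists d; now apply cderiv_is_derive.
Qed.

Lemma Cmod_triangle_rev (x y : C) : Cmod x - Cmod y <= Cmod (x - y).
Proof.
replace x with ((x - y) + y)%C at 1 by ring.
pose proof (Cmod_triangle (x - y) y). lra.
Qed.

Lemma Cmod_triangle_minus (x y : C) : Cmod (x - y) <= Cmod x + Cmod y.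
Proof. rewrite <- (Cmod_opp y). apply Cmod_triangle. Qed.

Lemma Cmod_minus_sym (x y : C) : Cmod (x - y) = Cmod (y - x).
Proof. rewrite <- Cmod_opp. f_equal. ring. Qed.

Lemma Cmod_minus_triangle (x y z : C) : Cmod (x - z) <= Cmod (x - y) + Cmod (y - z).
Proof. replace (x - z)%C with ((x - y) + (y - z))%C by ring. apply Cmod_triangle. Qed.

Lemma Cmod_minus_self (x : C) : Cmod (x - x) = 0.
Proof. replace (x - x)%C with (RtoC 0) by ring. apply Cmod_0. Qed.

Lemma re_minus (x y : C) : Re (x - y) = Re x - Re y.
Proof. reflexivity. Qed.

Lemma re_le_Cmod' (c : C) : Re c <= Cmod c.
Proof. eapply Rle_trans; [apply Rle_abs|apply re_le_Cmod]. Qed.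

Lemma im_le_Cmod (c : C) : Rabs (Im c) <= Cmod c.
Proof. eapply Rle_trans; [|apply Rmax_Cmod]. apply Rmax_r. Qed.

Lemma Cmod_le_re_im (c : C) : Cmod c <= Rabs (Re c) + Rabs (Im c).
Proof.
replace c with (RtoC (Re c) + Ci * RtoC (Im c))%C at 1.
2:{ destruct c; apply injective_projections; simpl; ring. }
eapply Rle_trans. apply Cmod_triangle. rewrite Cmod_mult, !Cmod_R, Cmod_Ci. lra.
Qed.

(** * Rules of complex differentiation *)

Lemma cderiv_const (c s : C) : cderiv (fun _ => c) s 0.
Proof.
intros eps He. exists 1. split; [lra|]. intros z _.
replace (c - c - 0 * (z - s))%C with (RtoC 0) by ring. rewrite Cmod_0.
apply Rmult_le_pos; [lra|apply Cmod_ge_0].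
Qed.

Lemma cderiv_id (s : C) : cderiv (fun z => z) s 1.
Proof.
intros eps He. exists 1. split; [lra|]. intros z _.
replace (z - s - 1 * (z - s))%C with (RtoC 0) by ring. rewrite Cmod_0.
apply Rmult_le_pos; [lra|apply Cmod_ge_0].
Qed.

Lemma cderiv_plus (f g : C -> C) (s df dg : C) :
  cderiv f s df -> cderiv g s dg -> cderiv (fun z => f z + g z)%C s (df + dg)%C.
Proof.
intros Hf Hg eps He.
destruct (Hf (eps / 2)) as [d1 [Hd1 H1]]; [lra|].
destruct (Hg (eps / 2)) as [d2 [Hd2 H2]]; [lra|].
exists (Rmin d1 d2). split; [now apply Rmin_glb_lt|]. intros z Hz.
pose proof (Rmin_l d1 d2). pose proof (Rmin_r d1 d2).
specialize (H1 z). specialize (H2 z).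
replace (f z + g z - (f s + g s) - (df + dg) * (z - s))%C with
  ((f z - f s - df * (z - s)) + (g z - g s - dg * (z - s)))%C by ring.
eapply Rle_trans; [apply Cmod_triangle|].
assert (Cmod (f z - f s - df * (z - s)) <= eps / 2 * Cmod (z - s)) by (apply H1; lra).
assert (Cmod (g z - g s - dg * (z - s)) <= eps / 2 * Cmod (z - s)) by (apply H2; lra).
lra.
Qed.

Lemma cderiv_continuous (f : C -> C) (s d : C) : cderiv f s d ->
  forall eps, 0 < eps -> exists delta, 0 < delta /\
    forall z, Cmod (z - s) < delta -> Cmod (f z - f s) < eps.
Proof.
intros H eps He. destruct (H 1 Rlt_0_1) as [d1 [Hd1 H1]].
pose proof (Cmod_ge_0 d) as Hd.
exists (Rmin d1 (eps / (Cmod d + 2))). split.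
{ apply Rmin_glb_lt; auto. apply Rdiv_lt_0_compat; lra. }
intros z Hz.
assert (Hz1 : Cmod (z - s) < d1) by (eapply Rlt_le_trans; [exact Hz|apply Rmin_l]).
assert (Hz2 : Cmod (z - s) < eps / (Cmod d + 2)) by (eapply Rlt_le_trans; [exact Hz|apply Rmin_r]).
specialize (H1 z Hz1).
replace (f z - f s)%C with ((f z - f s - d * (z - s)) + d * (z - s))%C by ring.
eapply Rle_lt_trans; [apply Cmod_triangle|]. rewrite Cmod_mult.
apply Rmult_lt_compat_l with (r := Cmod d + 2) in Hz2; [|lra].
replace ((Cmod d + 2) * (eps / (Cmod d + 2))) with eps in Hz2 by (field; lra).
pose proof (Cmod_ge_0 (z - s)). lra.
Qed.

Lemma cderiv_comp (f g : C -> C) (s df dg : C) :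
  cderiv f (g s) df -> cderiv g s dg -> cderiv (fun z => f (g z)) s (df * dg)%C.
Proof.
intros Hf Hg eps He.
pose proof (Cmod_ge_0 df) as Pf. pose proof (Cmod_ge_0 dg) as Pg.
set (e1 := eps / (2 * (Cmod dg + 1))).
assert (He1 : 0 < e1) by (apply Rdiv_lt_0_compat; lra).
set (e2 := Rmin 1 (eps / (2 * (Cmod df + 1)))).
assert (He2 : 0 < e2) by (apply Rmin_glb_lt; [lra|apply Rdiv_lt_0_compat; lra]).
destruct (Hf e1 He1) as [d1 [Hd1 H1]].
destruct (cderiv_continuous g s dg Hg d1 Hd1) as [d2 [Hd2 H2]].
destruct (Hg e2 He2) as [d3 [Hd3 H3]].
exists (Rmin d2 d3). split; [now apply Rmin_glb_lt|]. intros z Hz.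
pose proof (Rmin_l d2 d3). pose proof (Rmin_r d2 d3).
specialize (H2 z ltac:(lra)). specialize (H3 z ltac:(lra)). specialize (H1 (g z) H2).
pose proof (Cmod_ge_0 (z - s)) as Pz.
replace (f (g z) - f (g s) - df * dg * (z - s))%C with
  ((f (g z) - f (g s) - df * (g z - g s)) + df * (g z - g s - dg * (z - s)))%C by ring.
eapply Rle_trans; [apply Cmod_triangle|]. rewrite Cmod_mult.
assert (Hgz : Cmod (g z - g s) <= (Cmod dg + 1) * Cmod (z - s)).
{ replace (g z - g s)%C with ((g z - g s - dg * (z - s)) + dg * (z - s))%C by ring.
  eapply Rle_trans; [apply Cmod_triangle|]. rewrite Cmod_mult.
  assert (e2 <= 1) by apply Rmin_l. nra. }
assert (A1 : e1 * Cmod (g z - g s) <= eps / 2 * Cmod (z - s)).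
{ apply Rle_trans with (e1 * ((Cmod dg + 1) * Cmod (z - s))).
  - apply Rmult_le_compat_l; lra.
  - right. unfold e1. field. lra. }
assert (A2 : Cmod df * Cmod (g z - g s - dg * (z - s)) <= eps / 2 * Cmod (z - s)).
{ apply Rle_trans with ((Cmod df + 1) * (eps / (2 * (Cmod df + 1)) * Cmod (z - s))).
  - apply Rmult_le_compat; try lra; [apply Cmod_ge_0|].
    eapply Rle_trans; [exact H3|]. apply Rmult_le_compat_r; [lra|apply Rmin_r].
  - right. field. lra. }
lra.
Qed.

Lemma cderiv_scal (c : C) (f : C -> C) (s d : C) :
  cderiv f s d -> cderiv (fun z => c * f z)%C s (c * d)%C.
Proof.
intros H. apply (cderiv_comp (fun z => c * z)%C f s c d); [|exact H].
intros eps He. exists 1. split; [lra|]. intros z _.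
replace (c * z - c * f s - c * (z - f s))%C with (RtoC 0) by ring. rewrite Cmod_0.
apply Rmult_le_pos; [lra|apply Cmod_ge_0].
Qed.

Lemma cderiv_eq (f : C -> C) (s d d' : C) : cderiv f s d -> d = d' -> cderiv f s d'.
Proof. now intros H <-. Qed.

Lemma cderiv_ext (f g : C -> C) (s d : C) :
  (forall z, f z = g z) -> cderiv f s d -> cderiv g s d.
Proof.
intros E H eps He. destruct (H eps He) as [r [Hr H1]]. exists r. split; auto.
intros z Hz. rewrite <- !E. auto.
Qed.

Lemma cderiv_minus (f g : C -> C) (s df dg : C) :
  cderiv f s df -> cderiv g s dg -> cderiv (fun z => f z - g z)%C s (df - dg)%C.
Proof.
intros Hf Hg.
apply cderiv_eq with (df + (- (1)) * dg)%C; [|ring].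
apply cderiv_ext with (fun z => f z + (- (1)) * g z)%C; [intros; ring|].
apply cderiv_plus; [exact Hf|]. now apply cderiv_scal.
Qed.

Lemma cderiv_square (s : C) : cderiv (fun z => z * z)%C s (2 * s)%C.
Proof.
intros eps He. exists eps. split; [lra|]. intros z Hz.
replace (z * z - s * s - 2 * s * (z - s))%C with ((z - s) * (z - s))%C by ring.
rewrite Cmod_mult. apply Rmult_le_compat_r; [apply Cmod_ge_0|lra].
Qed.

(* Polarization: [4 f g = (f + g)^2 - (f - g)^2]. *)
Lemma cderiv_mult (f g : C -> C) (s df dg : C) :
  cderiv f s df -> cderiv g s dg ->
  cderiv (fun z => f z * g z)%C s (df * g s + f s * dg)%C.
Proof.
intros Hf Hg.
pose proof (cderiv_comp (fun z => z * z)%C (fun z => f z + g z)%C _ _ _ (cderiv_square (f s + g s)) (cderiv_plus _ _ _ _ _ Hf Hg)) as H1.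
pose proof (cderiv_comp (fun z => z * z)%C (fun z => f z - g z)%C _ _ _ (cderiv_square (f s - g s)) (cderiv_minus _ _ _ _ _ Hf Hg)) as H2.
pose proof (cderiv_scal (/ RtoC 4)%C _ _ _ (cderiv_minus _ _ _ _ _ H1 H2)) as H3.
eapply cderiv_eq; [eapply cderiv_ext; [|exact H3]|].
- intros z. cbv beta. field.
- field.
Qed.

Lemma cderiv_inv (s : C) : s <> 0%C -> cderiv Cinv s (- / (s * s))%C.
Proof.
intros Hs. assert (Hm : 0 < Cmod s) by now apply Cmod_gt_0.
intros eps He.
set (m := Cmod s) in *.
exists (Rmin (m / 2) (eps * (m * m * m) / 2)). split.
{ apply Rmin_glb_lt; [lra|]. apply Rdiv_lt_0_compat; [|lra].
  repeat apply Rmult_lt_0_compat; lra. }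
intros z Hz.
assert (Hz1 : Cmod (z - s) < m / 2) by (eapply Rlt_le_trans; [exact Hz|apply Rmin_l]).
assert (Hz2 : Cmod (z - s) < eps * (m * m * m) / 2) by (eapply Rlt_le_trans; [exact Hz|apply Rmin_r]).
assert (Hzm : m / 2 <= Cmod z).
{ pose proof (Cmod_triangle_rev s z) as T. rewrite Cmod_minus_sym in T. fold m in T. lra. }
assert (Hz0 : z <> 0%C) by (apply Cmod_gt_0; lra).
replace (/ z - / s - - / (s * s) * (z - s))%C with ((z - s) * (z - s) * / (z * (s * s)))%C.
2:{ field. auto. }
assert (N : (z * (s * s))%C <> 0%C) by (repeat apply Cmult_neq_0; auto).
rewrite !Cmod_mult, Cmod_inv, !Cmod_mult by exact N. fold m.
rewrite (Rmult_comm eps), Rmult_assoc. apply Rmult_le_compat_l; [apply Cmod_ge_0|].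
assert (P : m / 2 * (m * m) <= Cmod z * (m * m)) by (apply Rmult_le_compat_r; [nra|lra]).
assert (P0 : 0 < m / 2 * (m * m)) by (repeat apply Rmult_lt_0_compat; lra).
apply Rmult_le_reg_r with (Cmod z * (m * m)); [lra|].
rewrite Rmult_assoc, Rinv_l, Rmult_1_r by lra.
apply Rle_trans with (eps * (m / 2 * (m * m))); [nra|].
apply Rmult_le_compat_l; lra.
Qed.

(** * The complex exponential *)

Lemma Cexp_plus (z w : C) : Cexp (z + w) = (Cexp z * Cexp w)%C.
Proof.
unfold Cexp. rewrite re_plus, im_plus, exp_plus, cos_plus, sin_plus.
apply injective_projections; simpl; ring.
Qed.

Lemma Cexp_0 : Cexp 0 = 1%C.
Proof.
unfold Cexp; simpl. rewrite exp_0, cos_0, sin_0.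
apply injective_projections; simpl; ring.
Qed.

Lemma Cmod_Cexp (z : C) : Cmod (Cexp z) = exp (Re z).
Proof.
unfold Cmod, Cexp; simpl fst; simpl snd.
replace ((exp (Re z) * cos (Im z)) ^ 2 + (exp (Re z) * sin (Im z)) ^ 2)
  with (exp (Re z) * exp (Re z)).
- apply sqrt_square. left. apply exp_pos.
- pose proof (sin2_cos2 (Im z)) as H. unfold Rsqr in H.
  transitivity (exp (Re z) * exp (Re z) * (sin (Im z) * sin (Im z) + cos (Im z) * cos (Im z))).
  + rewrite H. ring.
  + ring.
Qed.

Lemma Cexp_opp_l (z : C) : (Cexp (- z) * Cexp z)%C = 1%C.
Proof. rewrite <- Cexp_plus. replace (- z + z)%C with (RtoC 0) by ring. apply Cexp_0. Qed.

Lemma is_derive_taylor1 (f : R -> R) (x l : R) : is_derive f x l ->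
  forall eps, 0 < eps -> exists delta, 0 < delta /\
    forall h, Rabs h < delta -> Rabs (f (x + h) - f x - l * h) <= eps * Rabs h.
Proof.
intros H eps He. apply is_derive_Reals in H. destruct (H eps He) as [d Hd].
exists d. split; [apply cond_pos|]. intros h Hh.
destruct (Req_dec h 0) as [-> | Hh0].
- rewrite Rplus_0_r. replace (f x - f x - l * 0) with 0 by ring. rewrite Rabs_R0. lra.
- specialize (Hd h Hh0 Hh).
  replace (f (x + h) - f x - l * h) with (((f (x + h) - f x) / h - l) * h) by (field; auto).
  rewrite Rabs_mult. apply Rmult_le_compat_r; [apply Rabs_pos|lra].
Qed.

Lemma cderiv_Cexp_0 : cderiv Cexp 0 1.
Proof.
intros eps He.
assert (De : is_derive exp 0 1) by (auto_derive; auto; rewrite exp_0; ring).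
assert (Dc : is_derive cos 0 0) by (auto_derive; auto; rewrite sin_0; ring).
assert (Ds : is_derive sin 0 1) by (auto_derive; auto; rewrite cos_0; ring).
destruct (is_derive_taylor1 _ _ _ De (Rmin 1 (eps / 8))) as [d1 [Hd1 H1]].
{ apply Rmin_glb_lt; lra. }
destruct (is_derive_taylor1 _ _ _ Dc (eps / 16)) as [d2 [Hd2 H2]]; [lra|].
destruct (is_derive_taylor1 _ _ _ Ds (Rmin 1 (eps / 8))) as [d3 [Hd3 H3]].
{ apply Rmin_glb_lt; lra. }
pose proof (Rmin_l 1 (eps / 8)). pose proof (Rmin_r 1 (eps / 8)).
(* The caps [1 / 4] and [eps / 16] give [|exp x| <= 2] and [|exp x - 1| <= eps / 8], which control
   the mixed products of [exp x] with [cos y] and [sin y]. *)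
set (d4 := Rmin (Rmin d1 d2) (Rmin d3 (Rmin (1 / 4) (eps / 16)))).
exists d4. split.
{ unfold d4. repeat apply Rmin_glb_lt; lra. }
intros z. replace (z - 0)%C with z by ring. intros Hz.
assert (L1 : d4 <= d1) by (unfold d4; eapply Rle_trans; [apply Rmin_l|apply Rmin_l]).
assert (L2 : d4 <= d2) by (unfold d4; eapply Rle_trans; [apply Rmin_l|apply Rmin_r]).
assert (L3 : d4 <= d3) by (unfold d4; eapply Rle_trans; [apply Rmin_r|apply Rmin_l]).
assert (L4 : d4 <= 1 / 4) by (unfold d4; eapply Rle_trans; [apply Rmin_r|]; eapply Rle_trans; [apply Rmin_r|apply Rmin_l]).
assert (L5 : d4 <= eps / 16) by (unfold d4; eapply Rle_trans; [apply Rmin_r|]; eapply Rle_trans; [apply Rmin_r|apply Rmin_r]).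
rewrite Cexp_0.
destruct z as [x y].
pose proof (re_le_Cmod (x, y)) as Rx. pose proof (im_le_Cmod (x, y)) as Ry. simpl in Rx, Ry.
set (r := Cmod (x, y)) in *.
specialize (H1 x ltac:(lra)). specialize (H2 y ltac:(lra)). specialize (H3 y ltac:(lra)).
rewrite !Rplus_0_l in H1, H2, H3. rewrite exp_0 in H1. rewrite cos_0 in H2. rewrite sin_0 in H3.
set (e := exp x) in *. set (c := cos y) in *. set (si := sin y) in *.
assert (B1 : Rabs (e - 1 - x) <= eps / 8 * r).
{ replace (e - 1 - x) with (e - 1 - 1 * x) by ring. eapply Rle_trans; [exact H1|].
  apply Rmult_le_compat; try lra; try apply Rabs_pos. apply Rmin_glb; lra. }
assert (B1' : Rabs (e - 1 - x) <= r).
{ replace (e - 1 - x) with (e - 1 - 1 * x) by ring. eapply Rle_trans; [exact H1|].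
  pose proof (Rabs_pos x). nra. }
assert (B2 : Rabs (c - 1) <= eps / 16 * r).
{ replace (c - 1) with (c - 1 - 0 * y) by ring. eapply Rle_trans; [exact H2|].
  apply Rmult_le_compat_l; lra. }
assert (B3 : Rabs (si - y) <= eps / 8 * r).
{ replace (si - y) with (si - 0 - 1 * y) by ring. eapply Rle_trans; [exact H3|].
  apply Rmult_le_compat; try lra; try apply Rabs_pos. apply Rmin_glb; lra. }
assert (Be : Rabs e <= 2).
{ replace e with ((e - 1 - x) + (1 + x)) by ring. eapply Rle_trans; [apply Rabs_triang|].
  pose proof (Rabs_triang 1 x) as T. rewrite Rabs_R1 in T. lra. }
assert (Be1 : Rabs (e - 1) <= eps / 8).
{ replace (e - 1) with ((e - 1 - x) + x) by ring. eapply Rle_trans; [apply Rabs_triang|]. lra. }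
eapply Rle_trans; [apply Cmod_le_re_im|].
replace (Re (Cexp (x, y) - 1 - 1 * (x, y))) with ((e - 1 - x) + e * (c - 1)).
2:{ unfold e, c. simpl. ring. }
replace (Im (Cexp (x, y) - 1 - 1 * (x, y))) with (e * (si - y) + (e - 1) * y).
2:{ unfold e, si. simpl. ring. }
pose proof (Rabs_triang (e - 1 - x) (e * (c - 1))) as T1.
pose proof (Rabs_triang (e * (si - y)) ((e - 1) * y)) as T2.
rewrite !Rabs_mult in T1. rewrite !Rabs_mult in T2.
assert (P1 : Rabs e * Rabs (c - 1) <= 2 * (eps / 16 * r))
  by (apply Rmult_le_compat; auto using Rabs_pos).
assert (P2 : Rabs e * Rabs (si - y) <= 2 * (eps / 8 * r))
  by (apply Rmult_le_compat; auto using Rabs_pos).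
assert (P3 : Rabs (e - 1) * Rabs y <= eps / 8 * r)
  by (apply Rmult_le_compat; auto using Rabs_pos).
pose proof (Rabs_pos x). nra.
Qed.

Lemma cderiv_Cexp (w : C) : cderiv Cexp w (Cexp w).
Proof.
apply cderiv_ext with (fun z => Cexp w * Cexp (z - w))%C.
{ intros z. rewrite <- Cexp_plus. f_equal. ring. }
apply cderiv_eq with (Cexp w * (1 * 1))%C; [|ring].
apply cderiv_scal. apply (cderiv_comp Cexp (fun z => z - w)%C).
- replace (w - w)%C with (RtoC 0) by ring. apply cderiv_Cexp_0.
- apply cderiv_eq with (1 - 0)%C; [|ring]. apply cderiv_minus; [apply cderiv_id|apply cderiv_const].
Qed.

Lemma is_derive_line (f : C -> C) (a v d : C) (t : R) :
  cderiv f (a + RtoC t * v)%C d -> is_derive (fun u : R => Re (f (a + RtoC u * v)%C)) t (Re (d * v)).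
Proof.
intros H. apply is_derive_Reals. intros eps He.
pose proof (Cmod_ge_0 v) as Pv.
destruct (H (eps / (2 * (Cmod v + 1)))) as [r [Hr H1]].
{ apply Rdiv_lt_0_compat; lra. }
assert (Hr' : 0 < r / (Cmod v + 1)) by (apply Rdiv_lt_0_compat; lra).
exists (mkposreal _ Hr'). intros h Hh0 Hh. simpl in Hh.
specialize (H1 (a + RtoC (t + h) * v)%C).
assert (E : (a + RtoC (t + h) * v - (a + RtoC t * v))%C = (RtoC h * v)%C).
{ rewrite RtoC_plus. ring. }
rewrite E, Cmod_mult, Cmod_R in H1.
assert (Ph : 0 < Rabs h) by now apply Rabs_pos_lt.
assert (H2 : Rabs h * Cmod v < r).
{ apply Rle_lt_trans with (Rabs h * (Cmod v + 1)); [apply Rmult_le_compat_l; lra|].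
  replace r with (r / (Cmod v + 1) * (Cmod v + 1)) by (field; lra).
  apply Rmult_lt_compat_r; lra. }
specialize (H1 H2).
set (z1 := f (a + RtoC (t + h) * v)%C) in *. set (z0 := f (a + RtoC t * v)%C) in *.
replace ((Re z1 - Re z0) / h - Re (d * v)) with (Re (z1 - z0 - d * (RtoC h * v))%C / h).
2:{ destruct z1, z0, d, v; simpl. field. exact Hh0. }
unfold Rdiv. rewrite Rabs_mult, Rabs_inv.
apply Rle_lt_trans with (Cmod (z1 - z0 - d * (RtoC h * v)) * / Rabs h).
{ apply Rmult_le_compat_r; [left; now apply Rinv_0_lt_compat|apply re_le_Cmod]. }
apply Rle_lt_trans with (eps / (2 * (Cmod v + 1)) * (Rabs h * Cmod v) * / Rabs h).
{ apply Rmult_le_compat_r; [left; now apply Rinv_0_lt_compat|exact H1]. }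
replace (eps / (2 * (Cmod v + 1)) * (Rabs h * Cmod v) * / Rabs h)
  with (eps * (Cmod v / (2 * (Cmod v + 1)))) by (field; lra).
rewrite <- (Rmult_1_r eps) at 2. apply Rmult_lt_compat_l; [lra|].
apply Rmult_lt_reg_r with (2 * (Cmod v + 1)); [lra|].
unfold Rdiv. rewrite Rmult_assoc, Rinv_l by lra. lra.
Qed.

(** Turns an estimate of a modulus into one of a real part, where the real mean value theorem and
    real integrals apply. *)
Lemma exists_rotation (z : C) : exists u : C, Cmod u = 1 /\ (u * z)%C = RtoC (Cmod z).
Proof.
destruct (Ceq_dec z 0) as [-> | Hz].
- exists 1%C. split; [apply Cmod_1|]. rewrite Cmod_0. ring.
- assert (Hm : 0 < Cmod z) by now apply Cmod_gt_0.
  assert (N : RtoC (Cmod z) <> 0%C) by (intros E; apply RtoC_inj in E; lra).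
  exists (Cconj z / RtoC (Cmod z))%C. split.
  + rewrite Cmod_div, Cmod_conj, Cmod_R, Rabs_pos_eq by (auto; lra). field. lra.
  + transitivity (z * Cconj z / RtoC (Cmod z))%C; [field; exact N|].
    rewrite <- Cmod2_conj. simpl. rewrite Rmult_1_r, RtoC_mult. field. exact N.
Qed.

(** The equality form of the mean value theorem is real; rotating [f b - f a] onto the positive axis
    reduces to the real part. *)
Lemma segment_mean_value (f : C -> C) (a b : C) (K : R) :
  (forall t, 0 <= t <= 1 -> exists d, cderiv f (a + RtoC t * (b - a))%C d /\ Cmod d <= K) ->
  Cmod (f b - f a) <= K * Cmod (b - a).
Proof.
intros H. destruct (exists_rotation (f b - f a)) as [u [Hu1 Hu2]].
set (g := fun t : R => Re (u * f (a + RtoC t * (b - a)))%C).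
set (D := fun t : R => epsilon (inhabits (RtoC 0)) (fun d => cderiv f (a + RtoC t * (b - a))%C d /\ Cmod d <= K)).
assert (HD : forall t, 0 <= t <= 1 -> cderiv f (a + RtoC t * (b - a))%C (D t) /\ Cmod (D t) <= K).
{ intros t Ht. unfold D. apply epsilon_spec. apply H, Ht. }
assert (Hg : forall t, 0 <= t <= 1 -> is_derive g t (Re (u * D t * (b - a)))).
{ intros t Ht. apply (is_derive_line (fun z => u * f z)%C). apply cderiv_scal. now apply HD. }
destruct (MVT_gen g 0 1 (fun t => Re (u * D t * (b - a)))%C) as [c [Hc1 Hc2]].
- rewrite Rmin_left, Rmax_right by lra. intros t Ht. apply Hg. lra.
- rewrite Rmin_left, Rmax_right by lra. intros t Ht.
  apply continuity_pt_filterlim. apply (ex_derive_continuous g). eexists. apply Hg. lra.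
- rewrite Rmin_left, Rmax_right in Hc1 by lra.
  assert (E : g 1 - g 0 = Cmod (f b - f a)).
  { unfold g. rewrite <- re_minus.
    replace (a + RtoC 1 * (b - a))%C with b by ring.
    replace (a + RtoC 0 * (b - a))%C with a by ring.
    replace (u * f b - u * f a)%C with (u * (f b - f a))%C by ring.
    rewrite Hu2. reflexivity. }
  rewrite <- E, Hc2, Rminus_0_r, Rmult_1_r.
  eapply Rle_trans; [apply re_le_Cmod'|].
  rewrite !Cmod_mult, Hu1, Rmult_1_l. apply Rmult_le_compat_r; [apply Cmod_ge_0|].
  now apply HD.
Qed.

(** * Cauchy estimate and uniform limits *)

(** The Cauchy-Riemann equations, with total differentiability of both parts. *)
Lemma cderiv_diff2 (k : C -> C) (x y : R) (d : C) : cderiv k (x, y) d ->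
  diff2 (fun x y => Re (k (x, y))) x y (Re d) (- Im d) /\
  diff2 (fun x y => Im (k (x, y))) x y (Im d) (Re d).
Proof.
intros H.
assert (G : forall eps, 0 < eps -> exists delta, 0 < delta /\
  forall x' y', Rabs (x' - x) < delta -> Rabs (y' - y) < delta ->
   Cmod (k (x', y') - k (x, y) - d * ((x', y') - (x, y)))
    <= eps * (Rabs (x' - x) + Rabs (y' - y))).
{ intros eps He. destruct (H eps He) as [r [Hr H1]].
  exists (r / 2). split; [lra|]. intros x' y' Hx Hy.
  assert (L : Cmod ((x', y') - (x, y)) <= Rabs (x' - x) + Rabs (y' - y)) by apply (Cmod_le_re_im ((x', y') - (x, y))).
  eapply Rle_trans; [apply H1; lra|]. apply Rmult_le_compat_l; lra. }
split; intros eps He; destruct (G eps He) as [r [Hr H1]]; exists r; (split; [exact Hr|]);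
  intros x' y' Hx Hy; (eapply Rle_trans; [|apply (H1 x' y' Hx Hy)]).
- eapply Rle_trans; [|apply re_le_Cmod]. right. f_equal. simpl. unfold Re, Im. ring.
- eapply Rle_trans; [|apply im_le_Cmod]. right. f_equal. simpl. unfold Re, Im. ring.
Qed.

(** [Im k dx + Re k dy] is closed by Cauchy-Riemann, and periodicity cancels the two horizontal
    sides of the rectangle. *)
Lemma vertical_mean_constant (k : C -> C) (X a b : R) :
  (forall z, Re z < X -> cdiff k z) ->
  (forall z, k (z + RtoC (2 * PI) * Ci)%C = k z) ->
  a < b < X ->
  ex_RInt (fun y => Re (k (a, y))) 0 (2 * PI) /\
  ex_RInt (fun y => Re (k (b, y))) 0 (2 * PI) /\
  RInt (fun y => Re (k (a, y))) 0 (2 * PI) = RInt (fun y => Re (k (b, y))) 0 (2 * PI).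
Proof.
intros Hk Hper Hab.
assert (HPI : 0 < 2 * PI) by (pose proof PI_RGT_0; lra).
assert (Hcl : forall x y, a <= x <= b -> 0 <= y <= 2 * PI ->
  closed_form_at (fun x y => Im (k (x, y))) (fun x y => Re (k (x, y))) x y).
{ intros x y Hx Hy. destruct (Hk (x, y)) as [d Hd]; [simpl; lra|].
  destruct (cderiv_diff2 k x y d Hd) as [H1 H2].
  exists (Im d), (Re d), (- Im d). auto. }
assert (H := goursat_rectangle _ _ _ _ _ _ (proj1 Hab) HPI Hcl).
unfold rect_integral in H.
assert (E : RInt (fun x => Im (k (x, 2 * PI))) a b = RInt (fun x => Im (k (x, 0))) a b).
{ apply RInt_ext. intros x _. f_equal. rewrite <- (Hper (x, 0)). f_equal.
  apply injective_projections; simpl; ring. }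
rewrite E in H. split; [|split].
- apply (ex_RInt_vertical (fun x y => Im (k (x, y))) (fun x y => Re (k (x, y))) a b 0 (2 * PI) Hcl (fun x y => Re (k (x, y)))); auto; lra.
- apply (ex_RInt_vertical (fun x y => Im (k (x, y))) (fun x y => Re (k (x, y))) a b 0 (2 * PI) Hcl (fun x y => Re (k (x, y)))); auto; lra.
- lra.
Qed.

Lemma Cexp_2PI (z : C) : Cexp (z + RtoC (2 * PI) * Ci) = Cexp z.
Proof.
unfold Cexp.
replace (Re (z + RtoC (2 * PI) * Ci)) with (Re z) by (destruct z; simpl; ring).
replace (Im (z + RtoC (2 * PI) * Ci)) with (Im z + 2 * PI) by (destruct z; simpl; ring).
rewrite cos_plus, sin_plus, cos_2PI, sin_2PI. apply injective_projections; simpl; ring.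
Qed.

(* The mean of [(f(z0 + e^w) - f z0) e^{-w}] over a vertical period does not
   depend on [Re w]; as [Re w] tends to [-oo] it tends to [f'(z0)]. *)
Lemma cauchy_estimate_lt (f : C -> C) (z0 d : C) (R0 M r : R) :
  0 < r < R0 ->
  (forall z, Cmod (z - z0) < R0 -> cdiff f z) ->
  (forall z, Cmod (z - z0) < R0 -> Cmod (f z - f z0) <= M) ->
  cderiv f z0 d -> Cmod d <= M / r.
Proof.
intros Hr Hf HM Hd.
destruct (exists_rotation d) as [u [Hu1 Hu2]].
(* With [z = z0 + e^w], the circle of radius [e^a] becomes a vertical segment of abscissa [a]. The
   rotation [u] makes the limiting value [u * d] equal to the real number [Cmod d]. *)
set (k := fun w => (u * ((f (z0 + Cexp w) - f z0) * Cexp (- w)))%C).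
assert (Hin : forall w, Re w < ln R0 -> Cmod (z0 + Cexp w - z0) < R0).
{ intros w Hw. replace (z0 + Cexp w - z0)%C with (Cexp w) by ring.
  rewrite Cmod_Cexp. rewrite <- (exp_ln R0) by lra. now apply exp_increasing. }
assert (Hk : forall w, Re w < ln R0 -> cdiff k w).
{ intros w Hw. destruct (Hf _ (Hin w Hw)) as [e He].
  eexists. unfold k. apply cderiv_scal.
  apply (cderiv_mult (fun w => f (z0 + Cexp w) - f z0)%C (fun w => Cexp (- w))).
  - apply cderiv_minus; [|apply cderiv_const].
    apply (cderiv_comp f (fun w => z0 + Cexp w)%C); [exact He|].
    apply cderiv_plus; [apply cderiv_const|apply cderiv_Cexp].
  - apply (cderiv_comp Cexp (fun w => - w)%C); [apply cderiv_Cexp|].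
    apply cderiv_ext with (fun w => - (1) * w)%C; [intros; ring|].
    apply cderiv_scal, cderiv_id. }
assert (Hper : forall w, k (w + RtoC (2 * PI) * Ci)%C = k w).
{ intros w. unfold k. rewrite Cexp_2PI.
  replace (- w)%C with (- (w + RtoC (2 * PI) * Ci) + RtoC (2 * PI) * Ci)%C by ring.
  now rewrite Cexp_2PI. }
assert (HPI : 0 < 2 * PI) by (pose proof PI_RGT_0; lra).
apply le_epsilon. intros eps He.
destruct (Hd eps He) as [delta [Hdelta Hder]].
(* On [Re w = b] the integrand is at most [M / r]; the abscissa [a] lies so far left that
   [e^a < delta], where the linear approximation of [f] at [z0] holds. *)
set (b := ln r). set (a := Rmin (b - 1) (ln delta - 1)).
assert (Hb : b < ln R0) by (apply ln_increasing; lra).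
assert (Ha : a < b) by (unfold a; pose proof (Rmin_l (b - 1) (ln delta - 1)); lra).
assert (Had : exp a < delta).
{ rewrite <- (exp_ln delta) by lra. apply exp_increasing.
  unfold a; pose proof (Rmin_r (b - 1) (ln delta - 1)); lra. }
destruct (vertical_mean_constant k (ln R0) a b Hk Hper (conj Ha Hb)) as [Ea [Eb Eab]].
assert (Lb : RInt (fun y => Re (k (b, y))) 0 (2 * PI) <= RInt (fun _ => M / r) 0 (2 * PI)).
{ apply RInt_le; auto; [lra|apply ex_RInt_const|].
  intros y _. eapply Rle_trans; [apply re_le_Cmod'|].
  unfold k. rewrite !Cmod_mult, Hu1, Rmult_1_l, Cmod_Cexp.
  rewrite re_opp, exp_Ropp. simpl Re. unfold b at 2. rewrite exp_ln by lra.
  apply Rmult_le_compat_r; [left; apply Rinv_0_lt_compat; lra|].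
  apply HM, Hin. exact Hb. }
assert (La : RInt (fun _ => Cmod d - eps) 0 (2 * PI) <= RInt (fun y => Re (k (a, y))) 0 (2 * PI)).
{ apply RInt_le; auto; [lra|apply ex_RInt_const|].
  intros y _. set (w := (a, y) : C).
  assert (Ew : Cmod (z0 + Cexp w - z0) = exp a).
  { replace (z0 + Cexp w - z0)%C with (Cexp w) by ring. apply Cmod_Cexp. }
  specialize (Hder (z0 + Cexp w)%C). rewrite Ew in Hder. specialize (Hder Had).
  assert (E : k w = (RtoC (Cmod d) + u * ((f (z0 + Cexp w) - f z0 - d * (z0 + Cexp w - z0)) * Cexp (- w)))%C).
  { unfold k. rewrite <- Hu2.
    transitivity (u * ((f (z0 + Cexp w) - f z0) * Cexp (- w)) + u * d * (1 - Cexp (- w) * Cexp w))%C; [|ring].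
    rewrite Cexp_opp_l. ring. }
  rewrite E, re_plus. simpl Re at 1.
  set (q := (u * _)%C).
  assert (Hq : Cmod q <= eps).
  { unfold q. rewrite !Cmod_mult, Hu1, Rmult_1_l, Cmod_Cexp, re_opp, exp_Ropp. simpl Re.
    apply Rle_trans with (eps * exp a * / exp a).
    - apply Rmult_le_compat_r; [left; apply Rinv_0_lt_compat, exp_pos|exact Hder].
    - right. field. apply Rgt_not_eq, exp_pos. }
  pose proof (re_le_Cmod q) as Rq. apply Rabs_le_between in Rq.
  unfold Re in *. lra. }
rewrite Eab in La. rewrite RInt_const in La. rewrite RInt_const in Lb.
unfold scal in *; simpl in La, Lb. unfold mult in *; simpl in La, Lb.
assert (2 * PI * (Cmod d - eps) <= 2 * PI * (M / r)) by lra.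
apply Rmult_le_reg_l in H; lra.
Qed.

(** The limit [r -> R0] of the preceding estimate: a violation leaves room for an [r] strictly
    between [M / Cmod d] and [R0], to which that estimate applies. *)
Lemma cauchy_estimate (f : C -> C) (z0 d : C) (R0 M : R) :
  0 < R0 ->
  (forall z, Cmod (z - z0) < R0 -> cdiff f z) ->
  (forall z, Cmod (z - z0) < R0 -> Cmod (f z - f z0) <= M) ->
  cderiv f z0 d -> Cmod d <= M / R0.
Proof.
intros HR Hf HM Hd.
assert (M0 : 0 <= M).
{ rewrite <- (Cmod_minus_self (f z0)). apply HM. now rewrite Cmod_minus_self. }
apply Rnot_lt_le. intros Hlt.
assert (Hd0 : 0 < Cmod d) by (eapply Rle_lt_trans; [|exact Hlt]; apply Rdiv_le_0_compat; lra).
assert (H1 : M / Cmod d < R0).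
{ apply Rmult_lt_reg_r with (Cmod d); [lra|].
  replace (M / Cmod d * Cmod d) with (M / R0 * R0) by (field; lra).
  rewrite (Rmult_comm R0). now apply Rmult_lt_compat_r. }
assert (H0 : 0 <= M / Cmod d) by (apply Rdiv_le_0_compat; lra).
set (r := (M / Cmod d + R0) / 2).
assert (Hr : 0 < r < R0) by (unfold r; lra).
pose proof (cauchy_estimate_lt f z0 d R0 M r Hr Hf HM Hd) as H2.
assert (H3 : Cmod d * r <= M).
{ replace M with (M / r * r) by (field; lra). apply Rmult_le_compat_r; lra. }
assert (H4 : Cmod d * (M / Cmod d) < Cmod d * r) by (apply Rmult_lt_compat_l; [lra|unfold r; lra]).
replace (Cmod d * (M / Cmod d)) with M in H4 by (field; lra).
lra.
Qed.

(** * Complex sequences and Weierstrass' theorem *)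

Definition climit (u : nat -> C) (l : C) : Prop :=
  forall eps, 0 < eps -> exists N, forall n, (N <= n)%nat -> Cmod (u n - l) <= eps.

Lemma real_cauchy_limit (u : nat -> R) :
  (forall eps, 0 < eps -> exists N, forall n m, (N <= n)%nat -> (N <= m)%nat -> Rabs (u n - u m) <= eps) ->
  exists l, forall eps, 0 < eps -> exists N, forall n, (N <= n)%nat -> Rabs (u n - l) <= eps.
Proof.
intros H. destruct (Rcomplete.R_complete u) as [l Hl].
- intros eps He. destruct (H (eps / 2)) as [N HN]; [lra|]. exists N. intros n m Hn Hm.
  unfold Rdist. specialize (HN n m Hn Hm). lra.
- exists l. intros eps He. destruct (Hl eps He) as [N HN]. exists N. intros n Hn.
  left. now apply HN.
Qed.

Lemma climit_of_cauchy (u : nat -> C) :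
  (forall eps, 0 < eps -> exists N, forall n m, (N <= n)%nat -> (N <= m)%nat -> Cmod (u n - u m) <= eps) ->
  exists l, climit u l.
Proof.
intros H.
destruct (real_cauchy_limit (fun n => Re (u n))) as [x Hx].
{ intros eps He. destruct (H eps He) as [N HN]. exists N. intros n m Hn Hm.
  rewrite <- re_minus. eapply Rle_trans; [apply re_le_Cmod|auto]. }
destruct (real_cauchy_limit (fun n => Im (u n))) as [y Hy].
{ intros eps He. destruct (H eps He) as [N HN]. exists N. intros n m Hn Hm.
  eapply Rle_trans; [apply (im_le_Cmod (u n - u m))|auto]. }
exists (x, y). intros eps He.
destruct (Hx (eps / 2)) as [N1 H1]; [lra|]. destruct (Hy (eps / 2)) as [N2 H2]; [lra|].
exists (max N1 N2). intros n Hn.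
eapply Rle_trans; [apply Cmod_le_re_im|].
specialize (H1 n ltac:(lia)). specialize (H2 n ltac:(lia)). 
change (Rabs (Re (u n) - x) + Rabs (Im (u n) - y) <= eps). lra.
Qed.

(** The Cauchy estimate makes the derivatives uniformly Cauchy on the half disc; the mean value
    inequality for [fn m - fn n] transfers this to difference quotients, uniformly in [m], and then
    [m] tends to infinity. *)
Lemma uniform_limit_cdiff (fn : nat -> C -> C) (f : C -> C) (s : C) (r : R) :
  0 < r ->
  (forall n z, Cmod (z - s) < r -> cdiff (fn n) z) ->
  (forall eps, 0 < eps -> exists N, forall n z, (N <= n)%nat -> Cmod (z - s) < r -> Cmod (fn n z - f z) <= eps) ->
  cdiff f s.
Proof.
intros Hr Hdiff Hlim.
set (D := fun n z => epsilon (inhabits (RtoC 0)) (cderiv (fn n) z)).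
assert (HD : forall n z, Cmod (z - s) < r -> cderiv (fn n) z (D n z)).
{ intros n z Hz. unfold D. apply epsilon_spec. apply Hdiff, Hz. }
assert (HC : forall eps, 0 < eps -> exists N, forall n m z, (N <= n)%nat -> (N <= m)%nat ->
  Cmod (z - s) < r / 2 -> Cmod (D n z - D m z) <= eps).
{ intros eps He.
  (* Then [fn n - fn m] is at most [eps * r / 4] and its increments at most [eps * r / 2], which
     divided by the radius [r / 2] gives [eps]. *)
  destruct (Hlim (eps * r / 8)) as [N HN].
  { apply Rdiv_lt_0_compat; [nra|lra]. }
  exists N. intros n m z Hn Hm Hz.
  assert (Hb : forall w, Cmod (w - z) < r / 2 -> Cmod (fn n w - fn m w) <= eps * r / 4 /\ Cmod (w - s) < r).
  { intros w Hw. assert (Hws : Cmod (w - s) < r).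
    { pose proof (Cmod_minus_triangle w z s). lra. }
    split; [|exact Hws].
    pose proof (Cmod_minus_triangle (fn n w) (f w) (fn m w)) as T.
    rewrite (Cmod_minus_sym (f w)) in T.
    pose proof (HN n w Hn Hws). pose proof (HN m w Hm Hws). lra. }
  apply Rle_trans with ((eps * r / 2) / (r / 2)); [|right; field; lra].
  apply (cauchy_estimate (fun w => fn n w - fn m w)%C z).
  - lra.
  - intros w Hw. exists (D n w - D m w)%C. apply cderiv_minus; apply HD; now apply Hb.
  - intros w Hw. destruct (Hb w Hw) as [B1 _]. destruct (Hb z) as [B2 _].
    { rewrite Cmod_minus_self; lra. }
    eapply Rle_trans; [apply Cmod_triangle|]. rewrite Cmod_opp. lra.
  - apply cderiv_minus; apply HD; lra. }
destruct (climit_of_cauchy (fun n => D n s)) as [d Hd].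
{ intros eps He. destruct (HC eps He) as [N HN]. exists N. intros n m Hn Hm. apply HN; auto.
  rewrite Cmod_minus_self; lra. }
exists d. intros eps He.
destruct (HC (eps / 4)) as [N1 HN1]; [lra|].
destruct (Hd (eps / 4)) as [N2 HN2]; [lra|].
set (n := max N1 N2).
destruct (HD n s) with (eps := eps / 4) as [r1 [Hr1 H1]]; [rewrite Cmod_minus_self; lra|lra|].
exists (Rmin (r / 2) r1). split; [apply Rmin_glb_lt; lra|].
pose proof (Rmin_l (r / 2) r1). pose proof (Rmin_r (r / 2) r1).
intros z Hz.
specialize (H1 z ltac:(lra)). specialize (HN2 n ltac:(unfold n; lia)).
assert (Hsm : forall m, (N1 <= m)%nat -> Cmod ((fn m z - fn m s) - (fn n z - fn n s)) <= eps / 4 * Cmod (z - s)).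
{ intros m Hm.
  replace (fn m z - fn m s - (fn n z - fn n s))%C with ((fn m z - fn n z) - (fn m s - fn n s))%C by ring.
  apply (segment_mean_value (fun w => fn m w - fn n w)%C s z).
  intros t Ht.
  assert (Hin : Cmod (s + RtoC t * (z - s) - s) < r / 2).
  { replace (s + RtoC t * (z - s) - s)%C with (RtoC t * (z - s))%C by ring.
    rewrite Cmod_mult, Cmod_R, Rabs_pos_eq by lra. pose proof (Cmod_ge_0 (z - s)). nra. }
  exists (D m (s + RtoC t * (z - s)) - D n (s + RtoC t * (z - s)))%C. split.
  - apply cderiv_minus; apply HD; lra.
  - apply HN1; auto. unfold n; lia. }
assert (Hfs : Cmod ((f z - f s) - (fn n z - fn n s)) <= eps / 4 * Cmod (z - s)).
{ apply le_epsilon. intros e2 He2.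
  destruct (Hlim (e2 / 2)) as [N3 HN3]; [lra|].
  set (m := max N1 N3).
  pose proof (Hsm m ltac:(unfold m; lia)) as Hm.
  pose proof (HN3 m z ltac:(unfold m; lia) ltac:(lra)) as M1.
  pose proof (HN3 m s ltac:(unfold m; lia) ltac:(rewrite Cmod_minus_self; lra)) as M2.
  replace (f z - f s - (fn n z - fn n s))%C with
   ((fn m z - fn m s - (fn n z - fn n s)) + ((fn m s - f s) - (fn m z - f z)))%C by ring.
  eapply Rle_trans; [apply Cmod_triangle|].
  pose proof (Cmod_triangle_minus (fn m s - f s) (fn m z - f z)). lra. }
replace (f z - f s - d * (z - s))%C with
  ((f z - f s - (fn n z - fn n s)) + (fn n z - fn n s - D n s * (z - s)) + (D n s - d) * (z - s))%C by ring.
eapply Rle_trans; [apply Cmod_triangle|].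
eapply Rle_trans; [apply Rplus_le_compat_r, Cmod_triangle|].
rewrite Cmod_mult.
assert (Cmod (D n s - d) * Cmod (z - s) <= eps / 4 * Cmod (z - s)).
{ apply Rmult_le_compat_r; [apply Cmod_ge_0|exact HN2]. }
pose proof (Cmod_ge_0 (z - s)). nra.
Qed.

(** * Schwarz-Pick in the right half-plane *)

(** Inversion takes a disc with 0 on its boundary to a half-plane; this is why the map [M] of
    [schwarz_pick] lands in the right half-plane. *)
Lemma Re_Cinv_gt (v : C) : Cmod (1 - v) < 1 -> v <> 0%C /\ 1 / 2 < Re (/ v).
Proof.
intros H. destruct v as [x y].
assert (H2 : (1 - x) * (1 - x) + y * y < 1).
{ pose proof (Cmod2_alt (1 - (x, y))%C) as E. simpl in E.
  assert (Cmod (1 - (x, y)) * Cmod (1 - (x, y)) < 1).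
  { pose proof (Cmod_ge_0 (1 - (x, y))). nra. }
  simpl in H0. nra. }
assert (P : 0 < x * x + y * y) by nra.
split.
- intros E. injection E as -> ->. lra.
- simpl. apply Rmult_lt_reg_r with (x * (x * 1) + y * (y * 1)); [lra|].
  replace (x / (x * (x * 1) + y * (y * 1)) * (x * (x * 1) + y * (y * 1))) with x by (field; lra).
  lra.
Qed.

(** Keeps the Cayley quotient [(a - b) / (a + Cconj b)], centred at [b], in the closed unit disc,
    with a nonzero denominator. *)
Lemma Cmod_cayley_le (a b : C) : 0 <= Re a -> 0 < Re b ->
  Cmod (a - b) <= Cmod (a + Cconj b) /\ 0 < Cmod (a + Cconj b).
Proof.
intros Ha Hb. split.
- apply Rsqr_incr_0_var; [|apply Cmod_ge_0].
  pose proof (Cmod2_alt (a - b)) as E1. pose proof (Cmod2_alt (a + Cconj b)) as E2.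
  unfold Rsqr. destruct a, b; simpl in *. nra.
- eapply Rlt_le_trans; [|apply re_le_Cmod'].
  rewrite re_plus, re_conj. lra.
Qed.

Section HalfPlane.

Variable f : C -> C.
Hypothesis Hf : forall s, 0 < Re s -> cdiff f s.
Hypothesis Hpos : forall s, 0 < Re s -> 0 <= Re (f s).

(* The Cauchy estimate in the unit disc, after Cayley transforms sending the
   centre to [s] in the source and [f s] to the centre in the target. *)
Lemma schwarz_pick (s d : C) : 0 < Re s -> cderiv f s d -> Cmod d * Re s <= Re (f s).
Proof.
(* Adding [e] to [f] makes its real part strictly positive, so that the Cayley transform centred at
   [f s + e] is defined. *)
intros Hs Hd. apply le_epsilon. intros e He.
set (A := Re (f s) + e).
assert (HA : 0 < A) by (unfold A; specialize (Hpos s Hs); lra).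
set (gs := (f s + RtoC e)%C).
assert (Egs : Re gs = A) by reflexivity.
(* [M] maps the unit disc to the right half-plane with [M 0 = s]. With [g = f (M z) + e], the
   function [w] is [(g - gs) / (g + Cconj gs)], rewritten with a single inverse by
   [gs + Cconj gs = 2 A]. *)
set (M := fun z : C => (- Cconj s + RtoC (2 * Re s) * / (1 - z))%C).
set (w := fun z : C => (1 - RtoC (2 * A) * / (f (M z) + (RtoC e + Cconj gs)))%C).
assert (Hin : forall z, Cmod (z - 0) < 1 -> (1 - z)%C <> RtoC 0 /\ 0 < Re (M z)).
{ intros z Hz. destruct (Re_Cinv_gt (1 - z)) as [H1 H2].
  { replace (1 - (1 - z))%C with (z - 0)%C by ring. exact Hz. }
  split; [exact H1|]. unfold M. rewrite re_plus, re_opp, re_conj, re_scal_l. nra. }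
assert (M0 : M 0 = s).
{ unfold M. replace (1 - 0)%C with (RtoC 1) by ring.
  rewrite <- RtoC_inv, Rinv_1 by lra. destruct s; apply injective_projections; simpl; ring. }
assert (Ec : (gs + Cconj gs)%C = RtoC (2 * A)).
{ rewrite <- Egs. destruct gs; apply injective_projections; simpl; ring. }
assert (HM : forall z, Cmod (z - 0) < 1 -> cderiv M z (RtoC (2 * Re s) * (- / ((1 - z) * (1 - z)) * - (1)))%C).
{ intros z Hz. apply cderiv_eq with (0 + RtoC (2 * Re s) * (- / ((1 - z) * (1 - z)) * (0 - 1)))%C; [|ring].
  apply cderiv_plus; [apply cderiv_const|]. apply cderiv_scal.
  apply (cderiv_comp Cinv (fun z => 1 - z)%C).
  - apply cderiv_inv, Hin, Hz.
  - apply cderiv_minus; [apply cderiv_const|apply cderiv_id]. }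
assert (HG : forall z, Cmod (z - 0) < 1 ->
  Cmod ((f (M z) + RtoC e) - gs) <= Cmod ((f (M z) + RtoC e) + Cconj gs) /\
  0 < Cmod ((f (M z) + RtoC e) + Cconj gs)).
{ intros z Hz. apply Cmod_cayley_le; [|lra].
  rewrite re_plus. destruct (Hin z Hz) as [_ H]. specialize (Hpos _ H). simpl. unfold Re in *. lra. }
assert (HN : forall z, Cmod (z - 0) < 1 -> (f (M z) + (RtoC e + Cconj gs))%C <> 0%C).
{ intros z Hz. rewrite Cplus_assoc. apply Cmod_gt_0. now apply HG. }
assert (Hw : forall z e', Cmod (z - 0) < 1 -> cderiv f (M z) e' ->
  cderiv w z (RtoC (2 * A) * / ((f (M z) + (RtoC e + Cconj gs)) * (f (M z) + (RtoC e + Cconj gs)))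
     * (e' * (RtoC (2 * Re s) * / ((1 - z) * (1 - z)))))%C).
{ intros z e' Hz He'. unfold w.
  eapply cderiv_eq.
  - apply cderiv_minus; [apply cderiv_const|]. apply cderiv_scal.
    apply (cderiv_comp Cinv (fun z => f (M z) + (RtoC e + Cconj gs))%C).
    + apply cderiv_inv, HN, Hz.
    + apply cderiv_plus; [|apply cderiv_const].
      apply (cderiv_comp f M); [exact He'|]. apply HM, Hz.
  - ring. }
assert (Dz : Cmod (0 - 0) < 1) by (rewrite Cmod_minus_self; lra).
assert (W0 : w 0 = 0%C).
{ unfold w. rewrite M0, Cplus_assoc. fold gs. rewrite Ec, Cinv_r; [ring|].
  intros E. apply RtoC_inj in E. lra. }
assert (Hd' : cderiv f (M 0) d) by now rewrite M0.
assert (Dw : forall z, Cmod (z - 0) < 1 -> cdiff w z).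
{ intros z Hz. destruct (Hf _ (proj2 (Hin z Hz))) as [e' He'].
  eexists. apply (Hw z e' Hz He'). }
assert (B : forall z, Cmod (z - 0) < 1 -> Cmod (w z - w 0) <= 1).
{ intros z Hz. rewrite W0.
  replace (w z - 0)%C with ((f (M z) + RtoC e - gs) / (f (M z) + RtoC e + Cconj gs))%C.
  2:{ unfold w. rewrite <- Ec, Cplus_assoc. field. rewrite <- Cplus_assoc. now apply HN. }
  destruct (HG z Hz) as [G1 G2].
  rewrite Cmod_div by (apply Cmod_gt_0; exact G2).
  apply Rmult_le_reg_r with (Cmod (f (M z) + RtoC e + Cconj gs)); [exact G2|].
  unfold Rdiv. rewrite Rmult_assoc, Rinv_l by lra. lra. }
assert (CE := cauchy_estimate w 0 _ 1 1 Rlt_0_1 Dw B (Hw 0 d Dz Hd')).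
rewrite M0, Cplus_assoc in CE. fold gs in CE. rewrite Ec in CE.
replace (RtoC (2 * A) * / (RtoC (2 * A) * RtoC (2 * A)) * (d * (RtoC (2 * Re s) * / ((1 - 0) * (1 - 0)))))%C
  with (d * RtoC (Re s / A))%C in CE.
2:{ rewrite RtoC_div by lra. rewrite !RtoC_mult. field.
    intros E; apply RtoC_inj in E; lra. }
rewrite Cmod_mult, Cmod_R, Rabs_pos_eq in CE by (apply Rdiv_le_0_compat; lra).
apply Rmult_le_reg_r with (/ A); [now apply Rinv_0_lt_compat|].
fold A. rewrite Rinv_r by lra. unfold Rdiv in CE. lra.
Qed.

(** * Harnack inequalities along horizontal lines *)

Lemma is_derive_re_horizontal (x y : R) (d : C) : cderiv f (x, y) d ->
  is_derive (fun u => Re (f (u, y))) x (Re d).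
Proof.
intros H.
replace (Re d) with (Re (d * RtoC 1)) by (f_equal; ring).
apply (is_derive_ext (fun u => Re (f ((0, y) + RtoC u * RtoC 1)%C))).
{ intros u. do 2 f_equal. apply injective_projections; simpl; ring. }
apply is_derive_line. replace ((0, y) + RtoC x * RtoC 1)%C with ((x, y) : C); [exact H|].
apply injective_projections; simpl; ring.
Qed.

Lemma deriv_re_bound (x y : R) (d : C) : 0 < x -> cderiv f (x, y) d ->
  - Re (f (x, y)) <= Re d * x <= Re (f (x, y)).
Proof.
intros Hx Hd. pose proof (schwarz_pick (x, y) d Hx Hd) as H. simpl Re in H at 1.
pose proof (re_le_Cmod d) as H1. apply Rabs_le_between in H1.
change (Re (x, y)) with x in H. nra.
Qed.

(** With [u = Re f], Schwarz-Pick says that the derivative [x u' + u] of [x u] is nonnegative. *)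
Lemma re_mult_abscissa_increasing (x1 x2 y : R) : 0 < x1 <= x2 ->
  Re (f (x1, y)) * x1 <= Re (f (x2, y)) * x2.
Proof.
intros Hx.
set (D := fun t : R => epsilon (inhabits (RtoC 0)) (cderiv f (t, y))).
assert (HD : forall t, 0 < t -> cderiv f (t, y) (D t)).
{ intros t Ht. unfold D. apply epsilon_spec. apply Hf, Ht. }
assert (Hg : forall t, 0 < t -> is_derive (fun t => Re (f (t, y)) * t) t (Re (D t) * t + Re (f (t, y)))).
{ intros t Ht. rewrite <- (Rmult_1_r (Re (f (t, y)))).
  apply (is_derive_mult (fun t => Re (f (t, y))) (fun t => t)).
  - apply is_derive_re_horizontal, HD, Ht.
  - apply @is_derive_id.
  - exact Rmult_comm. }
destruct (MVT_gen (fun t => Re (f (t, y)) * t) x1 x2 (fun t => Re (D t) * t + Re (f (t, y)))) as [c [Hc1 Hc2]].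
- rewrite Rmin_left, Rmax_right by lra. intros t Ht. apply Hg. lra.
- rewrite Rmin_left, Rmax_right by lra. intros t Ht. apply continuity_pt_filterlim.
  apply (ex_derive_continuous (fun t => Re (f (t, y)) * t)). eexists. apply Hg. lra.
- rewrite Rmin_left, Rmax_right in Hc1 by lra.
  assert (Hc : 0 < c) by lra.
  destruct (deriv_re_bound c y _ Hc (HD c Hc)) as [B _]. nra.
Qed.

(** The other half of Schwarz-Pick: the numerator [x u' - u] of the derivative of [u / x] is at most
    0. *)
Lemma re_div_abscissa_decreasing (x1 x2 y : R) : 0 < x1 <= x2 ->
  Re (f (x2, y)) / x2 <= Re (f (x1, y)) / x1.
Proof.
intros Hx.
set (D := fun t : R => epsilon (inhabits (RtoC 0)) (cderiv f (t, y))).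
assert (HD : forall t, 0 < t -> cderiv f (t, y) (D t)).
{ intros t Ht. unfold D. apply epsilon_spec. apply Hf, Ht. }
assert (Hg : forall t, 0 < t -> is_derive (fun t => Re (f (t, y)) / t) t ((Re (D t) * t - Re (f (t, y))) / t ^ 2)).
{ intros t Ht.
  replace ((Re (D t) * t - Re (f (t, y))) / t ^ 2) with ((Re (D t) * t - Re (f (t, y)) * 1) / t ^ 2) by (field; lra).
  apply (is_derive_div (fun t => Re (f (t, y))) (fun t => t)).
  - apply is_derive_re_horizontal, HD, Ht.
  - apply @is_derive_id.
  - lra. }
destruct (MVT_gen (fun t => Re (f (t, y)) / t) x1 x2 (fun t => (Re (D t) * t - Re (f (t, y))) / t ^ 2)) as [c [Hc1 Hc2]].
- rewrite Rmin_left, Rmax_right by lra. intros t Ht. apply Hg. lra.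
- rewrite Rmin_left, Rmax_right by lra. intros t Ht. apply continuity_pt_filterlim.
  apply (ex_derive_continuous (fun t => Re (f (t, y)) / t)). eexists. apply Hg. lra.
- rewrite Rmin_left, Rmax_right in Hc1 by lra.
  assert (Hc : 0 < c) by lra.
  destruct (deriv_re_bound c y _ Hc (HD c Hc)) as [_ B].
  assert (Hq : (Re (D c) * c - Re (f (c, y))) / c ^ 2 <= 0).
  { apply Rmult_le_reg_r with (c ^ 2); [apply pow_lt; lra|].
    unfold Rdiv. rewrite Rmult_assoc, Rinv_l, Rmult_0_l by (apply pow_nonzero; lra). lra. }
  nra.
Qed.

(** [x * Re f] is nonnegative and increasing, so decay at infinity forces [Re f = 0]; Schwarz-Pick
    then kills the derivative. *)
Lemma constant_of_decay :
  (forall y eps, 0 < eps -> exists X, forall x, X <= x -> Re (f (x, y)) * x <= eps) ->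
  forall s s', 0 < Re s -> 0 < Re s' -> f s = f s'.
Proof.
intros Hdec.
assert (Z : forall s, 0 < Re s -> Re (f s) = 0).
{ intros [x y] Hx. simpl in Hx. apply Rle_antisym; [|now apply Hpos].
  apply Rmult_le_reg_r with x; [exact Hx|]. rewrite Rmult_0_l.
  apply le_epsilon. intros e He. destruct (Hdec y e He) as [X HX].
  rewrite Rplus_0_l. apply Rle_trans with (Re (f (Rmax x X, y)) * Rmax x X).
  - apply re_mult_abscissa_increasing. split; [exact Hx|apply Rmax_l].
  - apply HX, Rmax_r. }
intros s s' Hs Hs'.
assert (H : Cmod (f s' - f s) <= 0 * Cmod (s' - s)).
{ apply segment_mean_value. intros t Ht.
  assert (P : 0 < Re (s + RtoC t * (s' - s))).
  { rewrite re_plus, re_scal_l, re_minus. nra. }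
  destruct (Hf _ P) as [d Hd]. exists d. split; [exact Hd|].
  pose proof (schwarz_pick _ _ P Hd) as SP. rewrite (Z _ P) in SP. nra. }
rewrite Rmult_0_l in H.
symmetry. apply Ceq_minus, Cmod_eq_0. pose proof (Cmod_ge_0 (f s' - f s)). lra.
Qed.

(** Monotonicity of [x * Re f] carries the bound on [Re f] from abscissa [Y] back to [eps], at the
    cost of the factor [Y / eps]. Schwarz-Pick turns it into a Lipschitz constant, and a horizontal
    path of length at most [Y] recovers a bound on [f] itself. *)
Lemma bounded_of_bounded_right (X M eps : R) : 0 < eps ->
  (forall s, X <= Re s -> Cmod (f s) <= M) ->
  exists M' L, (forall s, eps <= Re s -> Cmod (f s) <= M') /\
    (forall s s', eps <= Re s -> eps <= Re s' -> Cmod (f s - f s') <= L * Cmod (s - s')).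
Proof.
intros He HM.
set (Y := Rmax X eps).
assert (HY1 : X <= Y) by apply Rmax_l. assert (HY2 : eps <= Y) by apply Rmax_r.
assert (HM0 : 0 <= M).
{ eapply Rle_trans; [apply Cmod_ge_0|]. apply (HM (Y, 0)). exact HY1. }
set (B := M * Y / eps).
assert (HMB : M <= B).
{ unfold B. apply Rmult_le_reg_r with eps; [exact He|].
  replace (M * Y / eps * eps) with (M * Y) by (field; lra). nra. }
assert (HB : forall s, eps <= Re s -> Re (f s) <= B).
{ intros [x y] Hx. simpl in Hx. destruct (Rle_dec Y x) as [Hl|Hl].
  - eapply Rle_trans; [apply re_le_Cmod'|]. eapply Rle_trans; [|exact HMB]. apply HM. simpl. lra.
  - assert (E1 : Re (f (x, y)) * x <= Re (f (Y, y)) * Y) by (apply re_mult_abscissa_increasing; lra).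
    assert (E2 : Re (f (Y, y)) <= M).
    { eapply Rle_trans; [apply re_le_Cmod'|]. apply HM. exact HY1. }
    assert (P : 0 <= Re (f (x, y))) by (apply Hpos; simpl; lra).
    unfold B. apply Rmult_le_reg_r with eps; [exact He|].
    replace (M * Y / eps * eps) with (M * Y) by (field; lra). nra. }
assert (HL : forall s s', eps <= Re s -> eps <= Re s' -> Cmod (f s - f s') <= B / eps * Cmod (s - s')).
{ intros s s' Hs Hs'. apply segment_mean_value. intros t Ht.
  assert (P : eps <= Re (s' + RtoC t * (s - s'))).
  { rewrite re_plus, re_scal_l, re_minus. nra. }
  destruct (Hf (s' + RtoC t * (s - s'))%C) as [d Hd]; [lra|]. exists d. split; [exact Hd|].
  assert (P0 : 0 < Re (s' + RtoC t * (s - s'))) by lra.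
  pose proof (schwarz_pick _ _ P0 Hd) as SP. specialize (HB _ P).
  pose proof (Cmod_ge_0 d).
  apply Rmult_le_reg_r with eps; [exact He|].
  replace (B / eps * eps) with B by (field; lra). nra. }
exists (B / eps * Y + M), (B / eps). split; [|exact HL].
intros [x y] Hx. simpl in Hx.
assert (HBe : 0 <= B / eps) by (apply Rdiv_le_0_compat; lra).
destruct (Rle_dec Y x) as [Hl|Hl].
- specialize (HM (x, y)). simpl in HM. assert (0 <= B / eps * Y) by (apply Rmult_le_pos; lra).
  assert (Cmod (f (x, y)) <= M) by (apply HM; lra). lra.
- replace (f (x, y)) with ((f (x, y) - f (Y, y)) + f (Y, y))%C by ring.
  eapply Rle_trans; [apply Cmod_triangle|]. apply Rplus_le_compat; [|now apply HM].
  eapply Rle_trans; [apply HL; simpl; lra|]. apply Rmult_le_compat_l; [exact HBe|].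
  eapply Rle_trans; [apply Cmod_le_re_im|]. simpl.
  replace (y + - y) with 0 by ring. rewrite Rabs_R0, Rabs_left1; lra.
Qed.

End HalfPlane.

(** * Dirichlet polynomials *)

Fixpoint csum (u : nat -> C) (N : nat) : C :=
  match N with
  | O => RtoC 0
  | S n => (csum u n + u n)%C
  end.

Lemma sum_n_csum (u : nat -> C) (N : nat) :
  @sum_n C_AbelianMonoid u N = csum u (S N).
Proof.
induction N as [|N IH].
- rewrite sum_O. simpl. ring.
- rewrite sum_Sn, IH. reflexivity.
Qed.

(** The uniform structure of [C] is that of a product, with square balls; a square of half side
    [e / 2] fits in the disc of radius [e]. *)
Lemma locally_C_iff (l : C) (P : C -> Prop) :
  @locally C_UniformSpace l P <-> exists eps, 0 < eps /\ forall z, Cmod (z - l) < eps -> P z.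
Proof.
split.
- intros [e He]. exists e. split; [apply cond_pos|]. intros z Hz. apply He.
  apply C_NormedModule_mixin_compat1. exact Hz.
- intros [e [He H]].
  assert (H2 : 0 < e / 2) by lra.
  exists (mkposreal _ H2). intros z [Hz1 Hz2]. apply H.
  eapply Rle_lt_trans; [apply Cmod_le_re_im|].
  change (Rabs (Re z - Re l) < e / 2) in Hz1. change (Rabs (Im z - Im l) < e / 2) in Hz2.
  change (Rabs (Re z - Re l) + Rabs (Im z - Im l) < e). lra.
Qed.

Lemma is_series_climit (u : nat -> C) (l : C) :
  @is_series C_AbsRing C_NormedModule u l <-> climit (csum u) l.
Proof.
split.
- intros H eps He.
  assert (Hl : @locally C_UniformSpace l (fun z => Cmod (z - l) < eps)).
  { apply locally_C_iff. exists eps. auto. }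
  destruct (H _ Hl) as [N HN]. exists (S N). intros n Hn. destruct n as [|n]; [lia|].
  left. rewrite <- sum_n_csum. apply HN. lia.
- intros H P HP. apply locally_C_iff in HP. destruct HP as [e [He HP]].
  destruct (H (e / 2)) as [N HN]; [lra|]. exists N. intros n Hn. apply HP.
  eapply Rle_lt_trans; [|apply (Rlt_eps2_eps e He)].
  change (sum_n u n) with (@sum_n C_AbelianMonoid u n). rewrite sum_n_csum. apply HN. lia.
Qed.

Lemma csum_ext (u v : nat -> C) N : (forall n, (n < N)%nat -> u n = v n) -> csum u N = csum v N.
Proof.
induction N as [|N IH]; intros H; [reflexivity|]. simpl. rewrite IH, H; auto.
Qed.

Lemma csum_plus (u v : nat -> C) N : csum (fun n => u n + v n)%C N = (csum u N + csum v N)%C.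
Proof. induction N as [|N IH]; simpl; [ring|]. rewrite IH. ring. Qed.

(** Comparison with a telescoping sum, in place of convergence tests. *)
Lemma csum_shift_le (u : nat -> C) (V : nat -> R) N M :
  (N <= M)%nat ->
  (forall n, (N <= n < M)%nat -> Cmod (u n) <= V n - V (S n)) ->
  Cmod (csum u M - csum u N) <= V N - V M.
Proof.
intros HNM. induction M as [|M IH]; intros H.
- replace N with O by lia. rewrite Cmod_minus_self. lra.
- destruct (Nat.eq_dec N (S M)) as [->|E].
  + rewrite Cmod_minus_self. lra.
  + simpl. replace (csum u M + u M - csum u N)%C with ((csum u M - csum u N) + u M)%C by ring.
    eapply Rle_trans; [apply Cmod_triangle|].
    assert (Cmod (csum u M - csum u N) <= V N - V M) by (apply IH; [lia|intros; apply H; lia]).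
    specialize (H M ltac:(lia)). lra.
Qed.

(* Indices are shifted by one: [npow n s] stands for [(n + 1)^{-s}]. *)
Definition logn (n : nat) : R := ln (INR (S n)).
Definition npow (n : nat) (s : C) : C := Cexp (- (s * RtoC (logn n))).

Lemma logn_pos n : 0 <= logn n.
Proof.
unfold logn. rewrite <- ln_1. apply ln_le; [lra|]. rewrite S_INR. pose proof (pos_INR n). lra.
Qed.

Lemma logn_0 : logn 0 = 0.
Proof. unfold logn. simpl. apply ln_1. Qed.

Lemma logn_le n m : (n <= m)%nat -> logn n <= logn m.
Proof.
intros H. apply ln_le; [apply lt_0_INR; lia|]. apply le_INR. lia.
Qed.

Lemma logn_inj n m : logn n = logn m -> n = m.
Proof.
intros H. apply ln_inv in H; try (apply lt_0_INR; lia). apply INR_eq in H. lia.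
Qed.

Lemma exp_logn n : exp (logn n) = INR n + 1.
Proof. unfold logn. rewrite exp_ln; [apply S_INR|apply lt_0_INR; lia]. Qed.

Lemma Cmod_npow n s : Cmod (npow n s) = exp (- Re s * logn n).
Proof. unfold npow. rewrite Cmod_Cexp, re_opp, re_scal_r. f_equal. ring. Qed.

Lemma npow_0 s : npow 0 s = 1%C.
Proof.
unfold npow. rewrite logn_0. replace (- (s * 0))%C with (RtoC 0) by ring. apply Cexp_0.
Qed.

Lemma npow_plus n s h : npow n (s + h) = (npow n s * npow n h)%C.
Proof. unfold npow. rewrite <- Cexp_plus. f_equal. ring. Qed.

(** With the shift by one, the index of the product is [(n + 1) (m + 1) - 1]. *)
Lemma npow_mult n m s : (npow n s * npow m s)%C = npow (n * m + n + m) s.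
Proof.
unfold npow. rewrite <- Cexp_plus. f_equal.
replace (logn (n * m + n + m)) with (logn n + logn m).
- rewrite RtoC_plus. ring.
- unfold logn. rewrite <- ln_mult by (apply lt_0_INR; lia). f_equal.
  rewrite <- mult_INR. f_equal. lia.
Qed.

Lemma Cmod_npow_le n s : 0 <= Re s -> Cmod (npow n s) <= 1.
Proof.
intros H. rewrite Cmod_npow, <- exp_0. pose proof (logn_pos n).
assert (E : - Re s * logn n <= 0) by nra.
destruct E as [E|E]; [left; now apply exp_increasing|rewrite E; lra].
Qed.

Lemma exp_le (x y : R) : x <= y -> exp x <= exp y.
Proof. intros [H| ->]; [left; now apply exp_increasing|lra]. Qed.

(** This is [1 / (n + 1)^2 <= 1 / n - 1 / (n + 1)], in the form that [csum_shift_le] can sum. *)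
Lemma exp_logn_square n : (1 <= n)%nat -> exp (- 2 * logn n) <= / INR n - / INR (S n).
Proof.
intros Hn.
replace (- 2 * logn n) with (- logn n + - logn n) by ring.
rewrite exp_plus, exp_Ropp, exp_logn, S_INR.
assert (P : 1 <= INR n) by (apply (le_INR 1); lia).
replace (/ INR n - / (INR n + 1)) with (/ INR n * / (INR n + 1)) by (field; lra).
apply Rmult_le_compat_r; [left; apply Rinv_0_lt_compat; lra|].
apply Rinv_le_contravar; lra.
Qed.

(** A list of index-coefficient pairs in which an index may repeat, so that addition is
    concatenation; [coef] collects the repetitions. *)
Definition dpoly (l : list (nat * C)) (s : C) : C :=
  fold_right (fun p acc => (snd p * npow (fst p) s + acc)%C) (RtoC 0) l.

Lemma dpoly_app l1 l2 s : dpoly (l1 ++ l2) s = (dpoly l1 s + dpoly l2 s)%C.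
Proof. induction l1 as [|p l1 IH]; simpl; [ring|]. rewrite IH. ring. Qed.

Lemma dpoly_mult_term n c l s :
  dpoly (map (fun q => ((n * fst q + n + fst q)%nat, (c * snd q)%C)) l) s = (c * npow n s * dpoly l s)%C.
Proof.
induction l as [|q l IH]; simpl; [ring|]. rewrite IH.
rewrite <- npow_mult. ring.
Qed.

Lemma dpoly_mult l1 l2 : exists l, forall s, dpoly l s = (dpoly l1 s * dpoly l2 s)%C.
Proof.
induction l1 as [|[n c] l1 [l IH]].
- exists nil. intros s. simpl. ring.
- exists (map (fun q => ((n * fst q + n + fst q)%nat, (c * snd q)%C)) l2 ++ l). intros s.
  rewrite dpoly_app, dpoly_mult_term, IH. simpl. ring.
Qed.

Lemma dpoly_bounded l : exists M, 0 < M /\ forall s, 0 <= Re s -> Cmod (dpoly l s) <= M.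
Proof.
induction l as [|[n c] l [M [HM IH]]].
- exists 1. split; [lra|]. intros s _. simpl. rewrite Cmod_0. lra.
- exists (Cmod c + M). split; [pose proof (Cmod_ge_0 c); lra|]. intros s Hs. simpl.
  eapply Rle_trans; [apply Cmod_triangle|]. rewrite Cmod_mult.
  specialize (IH s Hs). pose proof (Cmod_npow_le n s Hs).
  assert (Cmod c * Cmod (npow n s) <= Cmod c * 1) by (apply Rmult_le_compat_l; [apply Cmod_ge_0|lra]).
  lra.
Qed.

Lemma cderiv_npow n s : cderiv (npow n) s (- RtoC (logn n) * npow n s)%C.
Proof.
unfold npow.
apply cderiv_eq with (Cexp (- (s * RtoC (logn n))) * (- RtoC (logn n) * 1))%C; [|ring].
apply (cderiv_comp Cexp (fun s => - (s * RtoC (logn n)))%C); [apply cderiv_Cexp|].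
apply cderiv_ext with (fun s => - RtoC (logn n) * s)%C; [intros; ring|].
apply cderiv_scal, cderiv_id.
Qed.

Lemma cderiv_dpoly l s :
  cderiv (dpoly l) s (dpoly (map (fun p => (fst p, - RtoC (logn (fst p)) * snd p)%C) l) s).
Proof.
induction l as [|[n c] l IH]; simpl.
- apply cderiv_const.
- apply (cderiv_plus (fun z => c * npow n z)%C (dpoly l)); [|exact IH].
  apply cderiv_eq with (c * (- RtoC (logn n) * npow n s))%C; [|ring].
  apply cderiv_scal, cderiv_npow.
Qed.

(** * Coefficients of Dirichlet polynomials *)

Definition coef (l : list (nat * C)) (n : nat) : C :=
  fold_right (fun p acc => if Nat.eq_dec (fst p) n then (snd p + acc)%C else acc) (RtoC 0) l.

Lemma dpoly_split l n s :
  dpoly l s = (coef l n * npow n s + dpoly (filter (fun p => negb (Nat.eqb (fst p) n)) l) s)%C.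
Proof.
induction l as [|[m c] l IH]; simpl; [ring|].
destruct (Nat.eq_dec m n) as [->|E].
- rewrite Nat.eqb_refl. simpl. rewrite IH. ring.
- apply Nat.eqb_neq in E. rewrite E. simpl. rewrite IH. ring.
Qed.

Lemma coef_app l1 l2 n : coef (l1 ++ l2) n = (coef l1 n + coef l2 n)%C.
Proof.
induction l1 as [|[m c] l1 IH]; simpl; [ring|].
destruct (Nat.eq_dec m n); rewrite IH; ring.
Qed.

Lemma coef_opp l n : coef (map (fun p => (fst p, - snd p)%C) l) n = (- coef l n)%C.
Proof.
induction l as [|[m c] l IH]; simpl; [ring|].
destruct (Nat.eq_dec m n); rewrite IH; ring.
Qed.

Lemma dpoly_opp l s : dpoly (map (fun p => (fst p, - snd p)%C) l) s = (- dpoly l s)%C.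
Proof.
induction l as [|[m c] l IH]; simpl; [ring|]. rewrite IH. ring.
Qed.

Lemma csum_single (c : C) m s N : (m < N)%nat ->
  csum (fun n => (if Nat.eq_dec m n then c else RtoC 0) * npow n s)%C N = (c * npow m s)%C.
Proof.
induction N as [|N IH]; intros H; [lia|]. simpl.
destruct (Nat.eq_dec m N) as [->|E].
- replace (csum _ N) with (RtoC 0); [ring|]. clear.
  assert (G : forall k, (k <= N)%nat ->
   csum (fun n => (if Nat.eq_dec N n then c else RtoC 0) * npow n s)%C k = RtoC 0).
  { induction k as [|k IH]; intros Hk; [reflexivity|]. simpl. rewrite IH by lia.
    destruct (Nat.eq_dec N k); [lia|]. ring. }
  symmetry. now apply G.
- rewrite IH by lia. ring.
Qed.

Lemma dpoly_csum l : exists N0, forall N s, (N0 <= N)%nat ->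
  dpoly l s = csum (fun n => coef l n * npow n s)%C N.
Proof.
induction l as [|[m c] l [N0 IH]].
- exists O. intros N s _. simpl. induction N as [|N IH]; simpl; [reflexivity|]. rewrite <- IH. ring.
- exists (max N0 (S m)). intros N s HN. simpl dpoly.
  rewrite (IH N s) by lia. rewrite <- (csum_single c m s N) by lia. rewrite <- csum_plus.
  apply csum_ext. intros n _. simpl. destruct (Nat.eq_dec m n); ring.
Qed.

Lemma Cexp_i_PI : Cexp (RtoC PI * Ci) = (- (1))%C.
Proof.
unfold Cexp. replace (Re (RtoC PI * Ci)) with 0 by (simpl; ring).
replace (Im (RtoC PI * Ci)) with PI by (simpl; ring).
rewrite exp_0, cos_PI, sin_PI. apply injective_projections; simpl; ring.
Qed.

(* Averaging [F s] and [(n+1)^{ih} F (s + ih)] fixes the coefficient of index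
   [n]; the shift [h] is chosen so that one other frequency is killed. *)
Lemma coefficient_bound_aux (k : nat) : forall l n c sigma M, length l = k ->
  (forall p, In p l -> fst p <> n) ->
  (forall y, Cmod (c * npow n (sigma, y) + dpoly l (sigma, y)) <= M) ->
  Cmod c * exp (- sigma * logn n) <= M.
Proof.
induction k as [|k IH]; intros l n c sigma M Hlen Hn HM.
- destruct l; [|discriminate]. specialize (HM 0). simpl in HM.
  rewrite Cplus_0_r, Cmod_mult, Cmod_npow in HM. exact HM.
- destruct l as [|[m e] l]; [discriminate|]. injection Hlen as Hlen.
  assert (Hmn : m <> n) by (apply (Hn (m, e)); left; reflexivity).
  assert (Hlog : logn m - logn n <> 0).
  { intros E. apply Hmn, logn_inj. lra. }
  (* Averaging multiplies the coefficient of index [j] by [g j]. This [h] turns the phase at [m]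
     into [e^{- i PI} = -1], so [g m = 0], while [g n = 1]; the number of other terms drops by
     one. *)
  set (h := PI / (logn m - logn n)).
  set (g := fun j => ((1 + Cexp (RtoC (logn n - logn j) * RtoC h * Ci)) / RtoC 2)%C).
  assert (Hterm : forall j c' s, (c' * npow j s + Cexp (RtoC (logn n) * RtoC h * Ci) * (c' * npow j (s + RtoC h * Ci)))%C
     = (RtoC 2 * ((c' * g j) * npow j s))%C).
  { intros j c' s. rewrite npow_plus. unfold g.
    replace (Cexp (RtoC (logn n - logn j) * RtoC h * Ci)) with
      (Cexp (RtoC (logn n) * RtoC h * Ci) * npow j (RtoC h * Ci))%C.
    - field.
    - unfold npow. rewrite <- Cexp_plus. f_equal. rewrite RtoC_minus. ring. }
  assert (Hgm : g m = 0%C).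
  { unfold g. replace (RtoC (logn n - logn m) * RtoC h * Ci)%C with (- (RtoC PI * Ci))%C.
    - assert (E : Cexp (- (RtoC PI * Ci)) = (- (1))%C).
      { pose proof (Cexp_opp_l (RtoC PI * Ci)) as E. rewrite Cexp_i_PI in E.
        transitivity (- (Cexp (- (RtoC PI * Ci)) * - (1)))%C; [ring|]. rewrite E. ring. }
      rewrite E. field.
    - rewrite <- RtoC_mult. replace ((logn n - logn m) * h) with (- PI) by (unfold h; field; exact Hlog).
      rewrite RtoC_opp. ring. }
  assert (Hgn : g n = 1%C).
  { unfold g. rewrite Rminus_eq_0. replace (0 * RtoC h * Ci)%C with (RtoC 0) by ring.
    rewrite Cexp_0. field. }
  assert (Hpoly : forall l s, (dpoly l s + Cexp (RtoC (logn n) * RtoC h * Ci) * dpoly l (s + RtoC h * Ci))%C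
     = (RtoC 2 * dpoly (map (fun p => (fst p, snd p * g (fst p))%C) l) s)%C).
  { clear -Hterm. intros l s. induction l as [|[j c'] l IH]; simpl; [ring|].
    transitivity ((c' * npow j s + Cexp (RtoC (logn n) * RtoC h * Ci) * (c' * npow j (s + RtoC h * Ci))) +
      (dpoly l s + Cexp (RtoC (logn n) * RtoC h * Ci) * dpoly l (s + RtoC h * Ci)))%C; [ring|].
    rewrite Hterm, IH. ring. }
  apply (IH (map (fun p => (fst p, snd p * g (fst p))%C) l)).
  + now rewrite length_map.
  + intros p Hp. apply in_map_iff in Hp. destruct Hp as [q [<- Hq]]. simpl. apply Hn. now right.
  + intros y.
    set (F := fun s => (c * npow n s + dpoly ((m, e) :: l) s)%C) in *.
    assert (E : (RtoC 2 * (c * npow n (sigma, y) + dpoly (map (fun p => (fst p, snd p * g (fst p))%C) l) (sigma, y)))%C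
      = (F (sigma, y) + Cexp (RtoC (logn n) * RtoC h * Ci) * F ((sigma, y) + RtoC h * Ci))%C).
    { unfold F. transitivity
        ((c * npow n (sigma, y) + Cexp (RtoC (logn n) * RtoC h * Ci) * (c * npow n ((sigma, y) + RtoC h * Ci))) +
         (dpoly ((m, e) :: l) (sigma, y) + Cexp (RtoC (logn n) * RtoC h * Ci) * dpoly ((m, e) :: l) ((sigma, y) + RtoC h * Ci)))%C.
      - rewrite Hterm, Hpoly, Hgn. simpl. rewrite Hgm. ring.
      - ring. }
    assert (E2 : ((sigma, y) + RtoC h * Ci)%C = (sigma, y + h)).
    { apply injective_projections; simpl; ring. }
    rewrite E2 in E.
    apply (f_equal Cmod) in E. rewrite Cmod_mult, Cmod_R, Rabs_pos_eq in E by lra.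
    pose proof (Cmod_triangle (F (sigma, y)) (Cexp (RtoC (logn n) * RtoC h * Ci) * F (sigma, y + h))) as T.
    rewrite Cmod_mult, Cmod_Cexp in T.
    replace (Re (RtoC (logn n) * RtoC h * Ci)) with 0 in T by (simpl; ring).
    rewrite exp_0 in T.
    pose proof (HM y). pose proof (HM (y + h)). unfold F in *. lra.
Qed.

Lemma coefficient_bound l n sigma M :
  (forall y, Cmod (dpoly l (sigma, y)) <= M) -> Cmod (coef l n) * exp (- sigma * logn n) <= M.
Proof.
intros H.
apply (coefficient_bound_aux _ (filter (fun p => negb (Nat.eqb (fst p) n)) l) n _ _ _ eq_refl).
- intros p Hp. apply filter_In in Hp. destruct Hp as [_ Hp].
  apply Bool.negb_true_iff, Nat.eqb_neq in Hp. exact Hp.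
- intros y. rewrite <- dpoly_split. apply H.
Qed.

(** * Uniform limits of Dirichlet polynomials *)

Lemma csum_tail_square (u : nat -> C) (K : R) (N M : nat) :
  0 <= K -> (1 <= N <= M)%nat ->
  (forall n, (1 <= n)%nat -> Cmod (u n) <= K * exp (- 2 * logn n)) ->
  Cmod (csum u M - csum u N) <= K / INR N.
Proof.
intros HK HNM Hu.
apply Rle_trans with (K * / INR N - K * / INR M).
- apply (csum_shift_le u (fun n => K * / INR n)); [lia|].
  intros n Hn. eapply Rle_trans; [apply Hu; lia|].
  rewrite <- Rmult_minus_distr_l. apply Rmult_le_compat_l; [exact HK|].
  apply exp_logn_square. lia.
- assert (0 <= K * / INR M).
  { apply Rmult_le_pos; [exact HK|]. left. apply Rinv_0_lt_compat, lt_0_INR. lia. }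
  unfold Rdiv. lra.
Qed.

Lemma climit_terms_bounded (u : nat -> C) (l : C) : climit (csum u) l ->
  exists K, 0 <= K /\ forall n, Cmod (u n) <= K.
Proof.
intros H. destruct (H 1 Rlt_0_1) as [N HN].
assert (G : exists K, 0 <= K /\ forall n, (n < N)%nat -> Cmod (u n) <= K).
{ clear HN. induction N as [|N [K [HK IH]]].
  - exists 0. split; [lra|]. intros n Hn. lia.
  - exists (Rmax K (Cmod (u N))). split; [eapply Rle_trans; [exact HK|apply Rmax_l]|].
    intros n Hn. destruct (Nat.eq_dec n N) as [->|E]; [apply Rmax_r|].
    eapply Rle_trans; [apply IH; lia|apply Rmax_l]. }
destruct G as [K [HK G]]. exists (K + 2). split; [lra|]. intros n.
destruct (Nat.lt_ge_cases n N) as [Hn|Hn].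
- specialize (G n Hn). lra.
- pose proof (HN n Hn) as H1. pose proof (HN (S n) ltac:(lia)) as H2. simpl in H2.
  replace (u n) with ((csum u n + u n - l) - (csum u n - l))%C by ring.
  eapply Rle_trans; [apply Cmod_triangle_minus|]. lra.
Qed.

Lemma dpoly_seq (b : nat -> C) (N : nat) (s : C) :
  dpoly (map (fun n => (n, b n)) (seq 0 N)) s = csum (fun n => b n * npow n s)%C N.
Proof.
induction N as [|N IH]; [reflexivity|].
rewrite seq_S, map_app, dpoly_app, IH. simpl. ring.
Qed.

(* By [coefficient_bound] this is, up to moving [theta], the same as being a
   Dirichlet series; unlike the latter it is visibly stable under uniform limits. *)
Definition dclosure (theta : R) (f : C -> C) : Prop :=
  forall eps, 0 < eps -> exists l, forall s, theta < Re s -> Cmod (f s - dpoly l s) <= eps.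

(** Convergence at one point of abscissa [sig] bounds the coefficients by [K (n+1)^sig]. Two units
    further right the series is dominated by [(n+1)^{-2}], hence converges uniformly, and every term
    after the constant one carries a factor comparable to [2^{- Re s}]. *)
Lemma dirichlet_series_tail (f : C -> C) : is_dirichlet_series f ->
  exists (theta K : R) (a : C), 0 <= theta /\ 0 <= K /\ dclosure theta f /\
    forall s, theta <= Re s -> Cmod (f s - a) <= K * exp (- Re s * ln 2).
Proof.
intros [a [th H]].
set (b := fun n => a (S n)).
assert (Hs : forall s, th < Re s -> climit (csum (fun n => b n * npow n s)%C) (f s)).
{ intros s Hs. apply is_series_climit. apply (H s Hs). }
(* Convergence is known only strictly to the right of [th]; the maximum with 0 also makes the
   resulting abscissa nonnegative. *)
set (sig := Rmax th 0 + 1).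
assert (Hsig : th < sig /\ 0 < sig).
{ unfold sig. pose proof (Rmax_l th 0). pose proof (Rmax_r th 0). lra. }
destruct (climit_terms_bounded _ _ (Hs (sig, 0) (proj1 Hsig))) as [K [HK HKb]].
assert (Hb : forall n, Cmod (b n) <= K * exp (sig * logn n)).
{ intros n. specialize (HKb n). rewrite Cmod_mult, Cmod_npow in HKb. simpl in HKb.
  apply Rmult_le_reg_r with (exp (- sig * logn n)); [apply exp_pos|].
  eapply Rle_trans; [exact HKb|]. rewrite Rmult_assoc, <- exp_plus.
  replace (sig * logn n + - sig * logn n) with 0 by ring. rewrite exp_0. lra. }
assert (T : forall s N M, sig + 2 <= Re s -> (1 <= N <= M)%nat ->
  Cmod (csum (fun n => b n * npow n s)%C M - csum (fun n => b n * npow n s)%C N)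
    <= K * exp (- (Re s - sig - 2) * ln 2) / INR N).
{ intros s N M Hre HNM. apply csum_tail_square; auto.
  { apply Rmult_le_pos; [exact HK|left; apply exp_pos]. }
  intros n Hn. rewrite Cmod_mult, Cmod_npow.
  apply Rle_trans with (K * exp (sig * logn n) * exp (- Re s * logn n)).
  { apply Rmult_le_compat_r; [left; apply exp_pos|apply Hb]. }
  rewrite !Rmult_assoc, <- !exp_plus. apply Rmult_le_compat_l; [exact HK|].
  apply exp_le. assert (E : ln 2 <= logn n).
  { apply (logn_le 1 n Hn). }
  nra. }
assert (TL : forall s N, sig + 2 <= Re s -> (1 <= N)%nat ->
  Cmod (f s - csum (fun n => b n * npow n s)%C N) <= K * exp (- (Re s - sig - 2) * ln 2) / INR N).
{ intros s N Hre HN. apply le_epsilon. intros e He.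
  destruct (Hs s ltac:(lra) e He) as [N1 HN1].
  specialize (HN1 (max N N1) ltac:(lia)). rewrite Cmod_minus_sym in HN1.
  specialize (T s N (max N N1) Hre ltac:(lia)).
  eapply Rle_trans; [apply (Cmod_minus_triangle _ (csum (fun n => b n * npow n s)%C (max N N1)))|].
  lra. }
exists (sig + 2), (K * exp ((sig + 2) * ln 2)), (b 0%nat).
split; [lra|]. split; [apply Rmult_le_pos; [exact HK|left; apply exp_pos]|]. split.
- intros eps He. destruct (archimed_cor1 (eps / (K + 1))) as [N [HN HN0]].
  { apply Rdiv_lt_0_compat; lra. }
  exists (map (fun n => (n, b n)) (seq 0 N)). intros s Hre. rewrite dpoly_seq.
  eapply Rle_trans; [apply TL; [lra|lia]|].
  assert (PN : 0 < / INR N) by (apply Rinv_0_lt_compat, lt_0_INR; lia).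
  assert (E : exp (- (Re s - sig - 2) * ln 2) <= 1).
  { rewrite <- exp_0. apply exp_le. pose proof ln_lt_2. nra. }
  pose proof (exp_pos (- (Re s - sig - 2) * ln 2)).
  apply Rle_trans with ((K + 1) * / INR N).
  + apply Rmult_le_compat_r; [lra|]. nra.
  + replace eps with ((K + 1) * (eps / (K + 1))) by (field; lra).
    apply Rmult_le_compat_l; lra.
(* With [N = 1] only the constant term is split off. The constant [exp ((sig + 2) * ln 2)] absorbs
   the shift in the exponent of [TL]. *)
- intros s Hre. specialize (TL s 1%nat Hre (le_n 1)). simpl in TL.
  rewrite npow_0 in TL. replace (f s - (0 + b 0%nat * 1))%C with (f s - b 0%nat)%C in TL by ring.
  eapply Rle_trans; [exact TL|]. right. rewrite Rdiv_1_r, Rmult_assoc, <- exp_plus.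
  do 2 f_equal. ring.
Qed.

Lemma exp_neg_ln2_le_1 (x : R) : 0 <= x -> exp (- x * ln 2) <= 1.
Proof. intros Hx. rewrite <- exp_0. apply exp_le. pose proof ln_lt_2. nra. Qed.

Lemma dirichlet_series_bounded_right (f : C -> C) : is_dirichlet_series f ->
  exists theta B, 0 <= theta /\ 0 <= B /\ forall s, theta <= Re s -> Cmod (f s) <= B.
Proof.
intros HD. destruct (dirichlet_series_tail f HD) as [th [K [a [Hth [HK [_ HT]]]]]].
exists th, (K + Cmod a). pose proof (Cmod_ge_0 a). split; [exact Hth|]. split; [lra|].
intros s Hs. replace (f s) with ((f s - a) + a)%C by ring.
eapply Rle_trans; [apply Cmod_triangle|]. apply Rplus_le_compat_r.
eapply Rle_trans; [apply HT, Hs|]. pose proof (exp_neg_ln2_le_1 (Re s) ltac:(lra)). nra.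
Qed.

(** [coefficient_bound] makes the coefficients of the approximating polynomials Cauchy, with a
    weighted error against their limits [b n] that is uniform in [n]. Two units further right these
    errors are summable, so the series with coefficients [b] sums to [f]. *)
Lemma dclosure_is_dirichlet_series (theta : R) (f : C -> C) :
  dclosure theta f -> is_dirichlet_series f.
Proof.
intros H.
set (e := fun k => / INR (S k)).
assert (He : forall k, 0 < e k) by (intros k; apply Rinv_0_lt_compat, lt_0_INR; lia).
assert (Hlim : forall eps, 0 < eps -> exists K, forall k, (K <= k)%nat -> e k < eps).
{ intros eps Heps. destruct (archimed_cor1 eps Heps) as [N [HN HN0]]. exists N. intros k Hk.
  eapply Rle_lt_trans; [|exact HN]. apply Rinv_le_contravar; [apply lt_0_INR; lia|].
  apply le_INR. lia. }
set (P := fun k => epsilon (inhabits (nil : list (nat * C)))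
  (fun l => forall s, theta < Re s -> Cmod (f s - dpoly l s) <= e k)).
assert (HP : forall k s, theta < Re s -> Cmod (f s - dpoly (P k) s) <= e k).
{ intros k. unfold P. apply epsilon_spec. apply H, He. }
(* The weight of [coefficient_bound] on the line [Re s = theta + 1], which lies inside the
   half-plane of approximation. *)
set (wt := fun n => exp (- (theta + 1) * logn n)).
assert (Hwt : forall n, 0 < wt n) by (intros; apply exp_pos).
assert (HC : forall k j n, Cmod (coef (P k) n - coef (P j) n) * wt n <= e k + e j).
{ intros k j n.
  replace (coef (P k) n - coef (P j) n)%C with
    (coef (P k ++ map (fun p => (fst p, - snd p)%C) (P j)) n).
  2:{ rewrite coef_app, coef_opp. reflexivity. }
  apply coefficient_bound. intros y. rewrite dpoly_app, dpoly_opp.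
  set (s := (theta + 1, y) : C).
  assert (Hs : theta < Re s) by (simpl; lra).
  change (Cmod (dpoly (P k) s - dpoly (P j) s) <= e k + e j).
  pose proof (HP k s Hs) as H1. rewrite Cmod_minus_sym in H1.
  pose proof (HP j s Hs) as H2.
  eapply Rle_trans; [apply (Cmod_minus_triangle _ (f s))|]. lra. }
assert (HL : forall n, exists b, climit (fun k => coef (P k) n) b).
{ intros n. apply climit_of_cauchy. intros eps Heps.
  destruct (Hlim (eps * wt n / 2)) as [K HK].
  { specialize (Hwt n). apply Rdiv_lt_0_compat; [nra|lra]. }
  exists K. intros k j Hk Hj. pose proof (HK k Hk). pose proof (HK j Hj).
  apply Rmult_le_reg_r with (wt n); [apply Hwt|].
  eapply Rle_trans; [apply HC|]. lra. }
set (b := fun n => epsilon (inhabits (RtoC 0)) (climit (fun k => coef (P k) n))).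
assert (Hb : forall n, climit (fun k => coef (P k) n) (b n)).
{ intros n. unfold b. apply epsilon_spec. apply HL. }
assert (HB : forall k n, Cmod (b n - coef (P k) n) * wt n <= e k).
{ intros k n. apply le_epsilon. intros eps Heps.
  destruct (Hlim (eps / 2)) as [K HK]; [lra|].
  destruct (Hb n (eps / (2 * wt n))) as [J HJ].
  { specialize (Hwt n). apply Rdiv_lt_0_compat; lra. }
  set (j := max K J).
  specialize (HJ j ltac:(unfold j; lia)). specialize (HK j ltac:(unfold j; lia)).
  apply Rmult_le_compat_r with (r := wt n) in HJ; [|left; apply Hwt].
  replace (eps / (2 * wt n) * wt n) with (eps / 2) in HJ by (field; apply Rgt_not_eq, Hwt).
  specialize (HC j k n).
  apply Rle_trans with ((Cmod (coef (P j) n - b n) + Cmod (coef (P j) n - coef (P k) n)) * wt n).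
  - apply Rmult_le_compat_r; [left; apply Hwt|]. rewrite (Cmod_minus_sym _ (b n)).
    apply Cmod_minus_triangle.
  - lra. }
(* [b n] belongs to [(n + 1)^{-s}], hence the predecessor. Beyond the weight at [theta + 1], the
   abscissa [theta + 3] leaves a factor [(n+1)^{-2}]. *)
exists (fun m => b (Nat.pred m)), (theta + 3). intros s Hs. unfold half_plane in Hs.
apply is_series_climit. unfold dirichlet_term. simpl Nat.pred.
change (climit (csum (fun n => b n * npow n s)%C) (f s)).
intros eps Heps.
destruct (Hlim (eps / 3)) as [k Hk]; [lra|]. specialize (Hk k (le_n k)).
destruct (dpoly_csum (P k)) as [N0 HN0].
exists (max 1 N0). intros N HN.
specialize (HP k s ltac:(lra)). rewrite Cmod_minus_sym, (HN0 N s) in HP by lia.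
set (v := fun n => ((b n - coef (P k) n) * npow n s)%C).
assert (Hv : forall n, Cmod (v n) <= e k * exp (- 2 * logn n)).
{ intros n. unfold v. rewrite Cmod_mult, Cmod_npow.
  specialize (HB k n). unfold wt in HB.
  replace (- Re s * logn n) with (- (theta + 1) * logn n + - (Re s - theta - 1) * logn n) by ring.
  rewrite exp_plus, <- Rmult_assoc.
  apply Rmult_le_compat; auto.
  - apply Rmult_le_pos; [apply Cmod_ge_0|left; apply exp_pos].
  - left; apply exp_pos.
  - apply exp_le. pose proof (logn_pos n). nra. }
(* One [e k] for the term of index 0, where the telescoping bound does not start, and one for all
   the others. *)
assert (Hsum : Cmod (csum v N) <= 2 * e k).
{ replace (csum v N) with ((csum v N - csum v 1) + v 0%nat)%C by (simpl; ring).
  eapply Rle_trans; [apply Cmod_triangle|].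
  pose proof (csum_tail_square v (e k) 1 N (Rlt_le _ _ (He k)) ltac:(lia) (fun n _ => Hv n)) as T.
  simpl in T. rewrite Rdiv_1_r in T. specialize (Hv 0%nat).
  rewrite logn_0, Rmult_0_r, exp_0 in Hv. simpl csum. lra. }
replace (csum (fun n => b n * npow n s)%C N) with
  (csum v N + csum (fun n => coef (P k) n * npow n s)%C N)%C.
2:{ rewrite <- csum_plus. apply csum_ext. intros n _. unfold v. ring. }
replace (csum v N + csum (fun n => coef (P k) n * npow n s)%C N - f s)%C with
  (csum v N + (csum (fun n => coef (P k) n * npow n s)%C N - f s))%C by ring.
eapply Rle_trans; [apply Cmod_triangle|]. lra.
Qed.

(** * Closure properties of [dclosure] *)

Lemma dclosure_mono theta theta' f : theta <= theta' -> dclosure theta f -> dclosure theta' f.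
Proof.
intros Ht H eps He. destruct (H eps He) as [l Hl]. exists l. intros s Hs. apply Hl. lra.
Qed.

Lemma dclosure_limit theta f :
  (forall eps, 0 < eps -> exists g, dclosure theta g /\ forall s, theta < Re s -> Cmod (f s - g s) <= eps) ->
  dclosure theta f.
Proof.
intros H eps He. destruct (H (eps / 2)) as [g [Hg Hfg]]; [lra|].
destruct (Hg (eps / 2)) as [l Hl]; [lra|]. exists l. intros s Hs.
specialize (Hl s Hs). specialize (Hfg s Hs).
eapply Rle_trans; [apply (Cmod_minus_triangle _ (g s))|]. lra.
Qed.

Lemma dclosure_ext theta f g : (forall s, theta < Re s -> f s = g s) -> dclosure theta f -> dclosure theta g.
Proof.
intros E H eps He. destruct (H eps He) as [l Hl]. exists l. intros s Hs. rewrite <- E; auto.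
Qed.

Lemma dclosure_dpoly theta l : dclosure theta (dpoly l).
Proof. intros eps He. exists l. intros s Hs. rewrite Cmod_minus_self. lra. Qed.

Lemma dclosure_const theta c : dclosure theta (fun _ => c).
Proof.
apply dclosure_ext with (dpoly ((0%nat, c) :: nil)); [|apply dclosure_dpoly].
intros s _. simpl. rewrite npow_0. ring.
Qed.

Lemma dclosure_npow theta n : dclosure theta (npow n).
Proof.
apply dclosure_ext with (dpoly ((n, RtoC 1) :: nil)); [|apply dclosure_dpoly].
intros s _. simpl. ring.
Qed.

Lemma dclosure_plus theta f g : dclosure theta f -> dclosure theta g ->
  dclosure theta (fun s => f s + g s)%C.
Proof.
intros Hf Hg eps He. destruct (Hf (eps / 2)) as [l1 H1]; [lra|].
destruct (Hg (eps / 2)) as [l2 H2]; [lra|]. exists (l1 ++ l2). intros s Hs.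
rewrite dpoly_app. replace (f s + g s - (dpoly l1 s + dpoly l2 s))%C with
  ((f s - dpoly l1 s) + (g s - dpoly l2 s))%C by ring.
eapply Rle_trans; [apply Cmod_triangle|]. specialize (H1 s Hs). specialize (H2 s Hs). lra.
Qed.

Lemma dclosure_bounded theta f : 0 <= theta -> dclosure theta f ->
  exists M, 0 < M /\ forall s, theta < Re s -> Cmod (f s) <= M.
Proof.
intros Ht Hf. destruct (Hf 1 Rlt_0_1) as [l Hl]. destruct (dpoly_bounded l) as [M [HM HMb]].
exists (M + 1). split; [lra|]. intros s Hs. specialize (Hl s Hs). specialize (HMb s ltac:(lra)).
replace (f s) with ((f s - dpoly l s) + dpoly l s)%C by ring.
eapply Rle_trans; [apply Cmod_triangle|]. lra.
Qed.

Lemma dclosure_mult theta f g : 0 <= theta -> dclosure theta f -> dclosure theta g ->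
  dclosure theta (fun s => f s * g s)%C.
Proof.
intros Ht Hf Hg eps He.
destruct (dclosure_bounded _ _ Ht Hg) as [M [HM HMb]].
destruct (Hf (eps / (2 * M))) as [l1 H1]; [apply Rdiv_lt_0_compat; lra|].
destruct (dpoly_bounded l1) as [M1 [HM1 HM1b]].
destruct (Hg (eps / (2 * M1))) as [l2 H2]; [apply Rdiv_lt_0_compat; lra|].
destruct (dpoly_mult l1 l2) as [l Hl]. exists l. intros s Hs. rewrite Hl.
replace (f s * g s - dpoly l1 s * dpoly l2 s)%C with
  ((f s - dpoly l1 s) * g s + dpoly l1 s * (g s - dpoly l2 s))%C by ring.
eapply Rle_trans; [apply Cmod_triangle|]. rewrite !Cmod_mult.
specialize (H1 s Hs). specialize (H2 s Hs). specialize (HMb s Hs). specialize (HM1b s ltac:(lra)).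
apply Rle_trans with (eps / (2 * M) * M + M1 * (eps / (2 * M1))).
- apply Rplus_le_compat; apply Rmult_le_compat; auto using Cmod_ge_0.
- right. field. lra.
Qed.

Lemma dclosure_pow theta f n : 0 <= theta -> dclosure theta f -> dclosure theta (fun s => f s ^ n)%C.
Proof.
intros Ht Hf. induction n as [|n IH].
- apply (dclosure_const theta (RtoC 1)).
- apply (dclosure_mult theta f (fun s => f s ^ n)%C); auto.
Qed.

Lemma Cexp_taylor1 (z : C) : Cmod (Cexp z - 1) <= exp (Cmod z) * Cmod z.
Proof.
replace z with (z - 0)%C at 3 by ring. rewrite <- Cexp_0 at 1.
apply segment_mean_value. intros t Ht. exists (Cexp (0 + RtoC t * (z - 0))).
split; [apply cderiv_Cexp|]. rewrite Cmod_Cexp. apply exp_le.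
eapply Rle_trans; [apply re_le_Cmod'|].
replace (0 + RtoC t * (z - 0))%C with (RtoC t * z)%C by ring.
rewrite Cmod_mult, Cmod_R, Rabs_pos_eq by lra. pose proof (Cmod_ge_0 z). nra.
Qed.

Lemma Cexp_taylor2 (z : C) : Cmod (Cexp z - (1 + z)) <= exp (Cmod z) * Cmod z * Cmod z.
Proof.
replace (Cexp z - (1 + z))%C with ((Cexp z - z) - (Cexp 0 - 0))%C by (rewrite Cexp_0; ring).
replace z with (z - 0)%C at 5 by ring.
apply (segment_mean_value (fun w => Cexp w - w)%C). intros t Ht.
exists (Cexp (0 + RtoC t * (z - 0)) - 1)%C. split.
- apply cderiv_minus; [apply cderiv_Cexp|apply cderiv_id].
- replace (0 + RtoC t * (z - 0))%C with (RtoC t * z)%C by ring.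
  assert (L : Cmod (RtoC t * z) <= Cmod z).
  { rewrite Cmod_mult, Cmod_R, Rabs_pos_eq by lra. pose proof (Cmod_ge_0 z). nra. }
  eapply Rle_trans; [apply Cexp_taylor1|].
  apply Rmult_le_compat; auto using Cmod_ge_0; [left; apply exp_pos|now apply exp_le].
Qed.

Lemma Cpow_minus_le (a b : C) (r : R) (n : nat) : Cmod a <= r -> Cmod b <= r ->
  Cmod (a ^ S n - b ^ S n) <= INR (S n) * r ^ n * Cmod (a - b).
Proof.
intros Ha Hb. assert (Hr : 0 <= r) by (eapply Rle_trans; [apply Cmod_ge_0|exact Ha]).
induction n as [|n IH].
- simpl. replace (a * 1 - b * 1)%C with (a - b)%C by ring. lra.
- replace (a ^ S (S n) - b ^ S (S n))%C with (a * (a ^ S n - b ^ S n) + (a - b) * b ^ S n)%C by (rewrite !(Cpow_S _ (S n)); ring).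
  eapply Rle_trans; [apply Cmod_triangle|]. rewrite !Cmod_mult, Cmod_pow.
  rewrite (S_INR (S n)).
  assert (E1 : Cmod a * Cmod (a ^ S n - b ^ S n) <= r * (INR (S n) * r ^ n * Cmod (a - b))).
  { apply Rmult_le_compat; auto using Cmod_ge_0. }
  assert (E2 : Cmod (a - b) * Cmod b ^ S n <= Cmod (a - b) * r ^ S n).
  { apply Rmult_le_compat_l; [apply Cmod_ge_0|]. apply pow_incr. split; [apply Cmod_ge_0|exact Hb]. }
  simpl pow in *. lra.
Qed.

Lemma Cexp_pow (z : C) (n : nat) : Cexp (RtoC (INR n) * z) = (Cexp z ^ n)%C.
Proof.
induction n as [|n IH].
- simpl. replace (0 * z)%C with (RtoC 0) by ring. apply Cexp_0.
- rewrite S_INR, RtoC_plus, Cpow_S, <- IH, <- Cexp_plus. f_equal. ring.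
Qed.

(** For [w = z / (n + 1)] the difference of [e^w] and [1 + w] is quadratic in [w], and taking powers
    costs one factor [n + 1]. The bound is uniform in [Cmod z <= rho], so exponentials of bounded
    functions are uniform limits of polynomials in them. *)
Lemma Cexp_euler_limit (z : C) (rho : R) (n : nat) : Cmod z <= rho ->
  Cmod (Cexp z - (1 + z * RtoC (/ INR (S n))) ^ S n) <= exp (2 * rho) * rho * rho / INR (S n).
Proof.
intros Hz.
assert (HN : 1 <= INR (S n)) by (apply (le_INR 1); lia).
set (N := INR (S n)) in *.
assert (Hr : 0 <= rho) by (eapply Rle_trans; [apply Cmod_ge_0|exact Hz]).
set (w := (z * RtoC (/ N))%C).
assert (Hw : Cmod w <= rho / N).
{ unfold w. rewrite Cmod_mult, Cmod_R, Rabs_pos_eq by (left; apply Rinv_0_lt_compat; lra).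
  apply Rmult_le_compat_r; [left; apply Rinv_0_lt_compat; lra|exact Hz]. }
assert (E : Cexp z = (Cexp w ^ S n)%C).
{ rewrite <- Cexp_pow. f_equal. fold N. unfold w. rewrite RtoC_inv by lra. field.
  intros E. apply RtoC_inj in E. lra. }
rewrite E.
assert (B1 : Cmod (Cexp w) <= exp (rho / N)).
{ rewrite Cmod_Cexp. apply exp_le. eapply Rle_trans; [apply re_le_Cmod'|exact Hw]. }
assert (B2 : Cmod (1 + w) <= exp (rho / N)).
{ eapply Rle_trans; [apply Cmod_triangle|]. rewrite Cmod_1.
  pose proof (exp_ineq1_le (rho / N)). lra. }
eapply Rle_trans; [apply (Cpow_minus_le _ _ _ _ B1 B2)|]. fold N.
assert (Hq : 0 <= rho / N) by (apply Rdiv_le_0_compat; lra).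
assert (Hq1 : rho / N <= rho).
{ apply Rmult_le_reg_r with N; [lra|]. replace (rho / N * N) with rho by (field; lra). nra. }
assert (B3 : exp (rho / N) ^ n <= exp rho).
{ rewrite <- Rpower_pow by apply exp_pos. unfold Rpower. rewrite ln_exp. apply exp_le.
  apply Rle_trans with (N * (rho / N)); [|right; field; lra].
  apply Rmult_le_compat_r; [exact Hq|]. unfold N. rewrite S_INR. lra. }
assert (B4 : Cmod (Cexp w - (1 + w)) <= exp rho * (rho / N) * (rho / N)).
{ eapply Rle_trans; [apply Cexp_taylor2|].
  apply Rmult_le_compat; auto using Cmod_ge_0.
  - apply Rmult_le_pos; [left; apply exp_pos|apply Cmod_ge_0].
  - apply Rmult_le_compat; auto using Cmod_ge_0; [left; apply exp_pos|apply exp_le; lra]. }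
apply Rle_trans with (N * exp rho * (exp rho * (rho / N) * (rho / N))).
- apply Rmult_le_compat; auto using Cmod_ge_0.
  + apply Rmult_le_pos; [lra|apply pow_le; left; apply exp_pos].
  + apply Rmult_le_compat_l; lra.
- right. replace (2 * rho) with (rho + rho) by ring. rewrite exp_plus. field. lra.
Qed.

Lemma dclosure_Cexp theta f : 0 <= theta -> dclosure theta f -> dclosure theta (fun s => Cexp (f s)).
Proof.
intros Ht Hf. destruct (dclosure_bounded _ _ Ht Hf) as [rho [Hrho Hb]].
apply dclosure_limit. intros eps He.
set (K := exp (2 * rho) * rho * rho).
assert (HK : 0 < K) by (unfold K; repeat apply Rmult_lt_0_compat; auto; apply exp_pos).
destruct (archimed_cor1 (eps / K)) as [N [HN HN0]]; [apply Rdiv_lt_0_compat; lra|].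
destruct N as [|n]; [lia|].
exists (fun s => (1 + f s * RtoC (/ INR (S n))) ^ S n)%C. split.
- apply (dclosure_pow theta (fun s => 1 + f s * RtoC (/ INR (S n)))%C); auto.
  apply dclosure_plus; [apply dclosure_const|].
  apply dclosure_mult; auto. apply dclosure_const.
- intros s Hs. eapply Rle_trans; [apply Cexp_euler_limit, Hb, Hs|]. fold K.
  replace eps with (K * (eps / K)) by (field; lra). apply Rmult_le_compat_l; lra.
Qed.

(** After approximating [f], each term splits as [(n+1)^{-(s+u)} = (n+1)^{-s} e^{- u ln (n+1)}]: a
    Dirichlet monomial times the exponential of a function in the closure. *)
Lemma dclosure_comp theta theta' f u : 0 <= theta' -> dclosure theta f -> dclosure theta' u ->
  (forall s, theta' < Re s -> theta < Re (s + u s)) ->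
  dclosure theta' (fun s => f (s + u s)%C).
Proof.
intros Ht Hf Hu Hre. apply dclosure_limit. intros eps He.
destruct (Hf eps He) as [l Hl]. exists (fun s => dpoly l (s + u s)%C). split.
2:{ intros s Hs. apply Hl, Hre, Hs. }
clear Hl. induction l as [|[n c] l IH].
- apply (dclosure_const theta' (RtoC 0)).
- apply (dclosure_plus theta' (fun s => c * npow n (s + u s))%C (fun s => dpoly l (s + u s)%C)); [|exact IH].
  apply dclosure_mult; [exact Ht|apply dclosure_const|].
  apply dclosure_ext with (fun s => npow n s * npow n (u s))%C.
  { intros s _. now rewrite npow_plus. }
  apply dclosure_mult; [exact Ht|apply dclosure_npow|].
  apply (dclosure_Cexp theta' (fun s => - (u s * RtoC (logn n)))%C); [exact Ht|].
  apply dclosure_ext with (fun s => u s * RtoC (- logn n))%C.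
  { intros s _. rewrite RtoC_opp. ring. }
  apply dclosure_mult; [exact Ht|exact Hu|apply dclosure_const].
Qed.

(** The geometric series in [- u] converges uniformly because its ratio is at most [1 / 2]. *)
Lemma dclosure_inv theta u : 0 <= theta -> dclosure theta u ->
  (forall s, theta < Re s -> Cmod (u s) <= 1 / 2) ->
  dclosure theta (fun s => / (1 + u s))%C.
Proof.
intros Ht Hu Hb. apply dclosure_limit. intros eps He.
destruct (exists_small_power 1 eps) as [n Hn]; [lra|exact He|].
set (S := fun N s => csum (fun k => (- u s) ^ k)%C N).
exists (S (Datatypes.S n)). split.
- generalize (Datatypes.S n). intros N. induction N as [|N IH].
  + apply (dclosure_const theta (RtoC 0)).
  + apply (dclosure_plus theta (S N) (fun s => (- u s) ^ N)%C); [exact IH|].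
    apply dclosure_pow; [exact Ht|].
    apply dclosure_ext with (fun s => RtoC (- (1)) * u s)%C.
    { intros s _. rewrite RtoC_opp. ring. }
    apply dclosure_mult; [exact Ht|apply dclosure_const|exact Hu].
- intros s Hs. specialize (Hb s Hs).
  assert (G : forall N, (S N s * (1 + u s))%C = (1 - (- u s) ^ N)%C).
  { unfold S. induction N as [|N IH]; simpl; [ring|]. rewrite Cmult_plus_distr_r, IH. ring. }
  assert (Hm : 1 / 2 <= Cmod (1 + u s)).
  { pose proof (Cmod_triangle_rev 1 (- u s)) as T. rewrite Cmod_1, Cmod_opp in T.
    replace (1 - - u s)%C with (1 + u s)%C in T by ring. lra. }
  assert (N0 : (1 + u s)%C <> RtoC 0) by (apply Cmod_gt_0; lra).
  replace (/ (1 + u s) - S (Datatypes.S n) s)%C with ((- u s) ^ (Datatypes.S n) / (1 + u s))%C.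
  2:{ replace ((- u s) ^ (Datatypes.S n))%C with (1 - S (Datatypes.S n) s * (1 + u s))%C by (rewrite G; ring).
      field. exact N0. }
  rewrite Cmod_div, Cmod_pow, Cmod_opp by exact N0.
  assert (Hpow : Cmod (u s) ^ Datatypes.S n <= (1 / 2) ^ Datatypes.S n).
  { apply pow_incr. split; [apply Cmod_ge_0|exact Hb]. }
  assert (E : (1 / 2) ^ Datatypes.S n = 1 / 2 * (1 / 2 ^ n)).
  { simpl. unfold Rdiv. rewrite !Rmult_1_l, pow_inv. reflexivity. }
  rewrite E in Hpow.
  apply Rmult_le_reg_r with (Cmod (1 + u s)); [lra|].
  unfold Rdiv at 1. rewrite Rmult_assoc, Rinv_l, Rmult_1_r by lra. nra.
Qed.

(** The Cauchy estimate on unit discs, applied to [f] minus its approximation, costs one unit of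
    abscissa. *)
Lemma dclosure_cderiv theta f f' : dclosure theta f ->
  (forall s, theta < Re s -> cderiv f s (f' s)) -> dclosure (theta + 1) f'.
Proof.
intros Hf Hd eps He. destruct (Hf (eps / 2)) as [l Hl]; [lra|].
exists (map (fun p => (fst p, - RtoC (logn (fst p)) * snd p)%C) l). intros s Hs.
replace eps with (eps / 1) by field.
assert (Hin : forall z, Cmod (z - s) < 1 -> theta < Re z).
{ intros z Hz. pose proof (re_le_Cmod (z - s)) as H. rewrite re_minus in H.
  apply Rabs_le_between in H. lra. }
apply (cauchy_estimate (fun z => f z - dpoly l z)%C s _ 1).
- lra.
- intros z Hz. eexists. apply cderiv_minus; [apply Hd, Hin, Hz|apply cderiv_dpoly].
- intros z Hz. pose proof (Hl z (Hin z Hz)). pose proof (Hl s ltac:(lra)).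
  eapply Rle_trans; [apply Cmod_triangle_minus|]. lra.
- apply cderiv_minus; [apply Hd; lra|apply cderiv_dpoly].
Qed.

(** Dirichlet polynomials are entire, so Weierstrass' theorem applies: membership in the closure
    already carries analyticity. *)
Lemma dclosure_cdiff theta f s : dclosure theta f -> theta < Re s -> cdiff f s.
Proof.
intros Hf Hs.
assert (He : forall n, 0 < / INR (S n)) by (intros n; apply Rinv_0_lt_compat, lt_0_INR; lia).
set (P := fun n => epsilon (inhabits (nil : list (nat * C)))
  (fun l => forall s, theta < Re s -> Cmod (f s - dpoly l s) <= / INR (S n))).
assert (HP : forall n s, theta < Re s -> Cmod (f s - dpoly (P n) s) <= / INR (S n)).
{ intros n. unfold P. apply epsilon_spec. apply Hf, He. }
apply (uniform_limit_cdiff (fun n => dpoly (P n)) f s (Re s - theta)).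
- lra.
- intros n z _. eexists. apply cderiv_dpoly.
- intros eps Heps. destruct (archimed_cor1 eps Heps) as [N [HN HN0]]. exists N.
  intros n z Hn Hz. rewrite Cmod_minus_sym.
  eapply Rle_trans; [apply HP|].
  + pose proof (re_le_Cmod (z - s)) as H. rewrite re_minus in H.
    apply Rabs_le_between in H. lra.
  + left. eapply Rle_lt_trans; [|exact HN]. apply Rinv_le_contravar; [apply lt_0_INR; lia|].
    apply le_INR. lia.
Qed.

(** * The flow of a Dirichlet series *)

Lemma climit_dist_le (u : nat -> C) (l a : C) (B : R) :
  climit u l -> (forall n, Cmod (u n - a) <= B) -> Cmod (l - a) <= B.
Proof.
intros H HB. apply le_epsilon. intros e He. destruct (H e He) as [N HN].
specialize (HN N (le_n N)). rewrite Cmod_minus_sym in HN. specialize (HB N).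
eapply Rle_trans; [apply (Cmod_minus_triangle _ (u N))|]. lra.
Qed.

Lemma climit_re_ge (u : nat -> C) (l : C) (x : R) :
  climit u l -> (forall n, x <= Re (u n)) -> x <= Re l.
Proof.
intros H HB. apply le_epsilon. intros e He. destruct (H e He) as [N HN].
specialize (HN N (le_n N)). specialize (HB N).
pose proof (re_le_Cmod (u N - l)) as R1. rewrite re_minus in R1.
apply Rabs_le_between in R1. lra.
Qed.

(** The rate is given for every limit, so that it applies to the one picked later by [epsilon]. *)
Lemma geometric_limit (u : nat -> C) (D q : R) : 0 <= q < 1 ->
  (forall n, Cmod (u (S n) - u n) <= D * q ^ n) ->
  (exists l, climit u l) /\ forall l, climit u l -> forall n, Cmod (u n - l) <= D / (1 - q) * q ^ n.
Proof.
intros Hq H. set (E := D / (1 - q)).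
assert (HD : 0 <= D).
{ specialize (H 0%nat). simpl in H. rewrite Rmult_1_r in H.
  eapply Rle_trans; [apply Cmod_ge_0|exact H]. }
assert (HE : 0 <= E) by (apply Rdiv_le_0_compat; lra).
assert (G0 : forall n m, Cmod (u (n + m)%nat - u n) <= E * q ^ n - E * q ^ (n + m)).
{ intros n m. induction m as [|m IH].
  - rewrite Nat.add_0_r, Cmod_minus_self. lra.
  - rewrite Nat.add_succ_r. eapply Rle_trans; [apply (Cmod_minus_triangle _ (u (n + m)%nat))|].
    specialize (H (n + m)%nat).
    replace (D * q ^ (n + m)) with (E * q ^ (n + m) - E * q ^ S (n + m)) in H.
    + lra.
    + unfold E. simpl. field. lra. }
assert (G : forall n m, (n <= m)%nat -> Cmod (u m - u n) <= E * q ^ n).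
{ intros n m Hnm. replace m with (n + (m - n))%nat by lia.
  eapply Rle_trans; [apply G0|].
  assert (0 <= E * q ^ (n + (m - n))) by (apply Rmult_le_pos; [exact HE|apply pow_le; lra]).
  lra. }
split.
- apply climit_of_cauchy. intros eps He.
  destruct (pow_lt_1_zero q ltac:(rewrite Rabs_pos_eq; lra) (eps / (2 * (E + 1)))) as [N HN].
  { apply Rdiv_lt_0_compat; lra. }
  specialize (HN N (le_n N)). rewrite Rabs_pos_eq in HN by (apply pow_le; lra).
  assert (HEN : E * q ^ N <= eps / 2).
  { apply Rle_trans with ((E + 1) * (eps / (2 * (E + 1)))); [|right; field; lra].
    apply Rmult_le_compat; try lra. apply pow_le; lra. }
  exists N. intros n m Hn Hm.
  pose proof (G N n Hn). pose proof (G N m Hm) as G2. rewrite Cmod_minus_sym in G2.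
  eapply Rle_trans; [apply (Cmod_minus_triangle _ (u N))|]. lra.
- intros l Hl n. rewrite Cmod_minus_sym.
  assert (Hl' : climit (fun m => u (n + m)%nat) l).
  { intros e He. destruct (Hl e He) as [N HN]. exists N. intros m Hm. apply HN. lia. }
  apply (climit_dist_le _ _ _ _ Hl'). intros m. apply G. lia.
Qed.

Lemma dyadic_limit (u : nat -> C) (D : R) :
  (forall n, Cmod (u (S n) - u n) <= D / 2 ^ n) ->
  (exists l, climit u l) /\ forall l, climit u l -> forall n, Cmod (u n - l) <= 2 * D / 2 ^ n.
Proof.
intros H. destruct (geometric_limit u D (/ 2)) as [H1 H2]; [lra| |].
- intros n. rewrite pow_inv. apply H.
- split; [exact H1|]. intros l Hl n. specialize (H2 l Hl n). rewrite pow_inv in H2.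
  eapply Rle_trans; [exact H2|]. right. field. apply pow_nonzero. lra.
Qed.

Definition nat_floor (x : R) : nat := Z.to_nat (Int_part x).

Lemma nat_floor_spec (x : R) : 0 <= x -> INR (nat_floor x) <= x < INR (nat_floor x) + 1.
Proof.
intros Hx. destruct (base_Int_part x) as [H1 H2].
assert (Hz : (0 <= Int_part x)%Z).
{ assert (IZR (-1) < IZR (Int_part x)) by lra. apply lt_IZR in H. lia. }
unfold nat_floor. rewrite INR_IZR_INZ, Z2Nat.id by exact Hz. lra.
Qed.

Lemma nat_floor_0 : nat_floor 0 = 0%nat.
Proof.
destruct (nat_floor_spec 0 (Rle_refl 0)) as [H _].
destruct (nat_floor 0) as [|n]; [reflexivity|]. rewrite S_INR in H. pose proof (pos_INR n). lra.
Qed.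

Lemma nat_floor_plus (x y : R) : 0 <= x -> 0 <= y ->
  nat_floor (x + y) = (nat_floor x + nat_floor y)%nat \/
  nat_floor (x + y) = S (nat_floor x + nat_floor y).
Proof.
intros Hx Hy. pose proof (nat_floor_spec x Hx). pose proof (nat_floor_spec y Hy).
pose proof (nat_floor_spec (x + y) ltac:(lra)).
set (a := nat_floor x) in *. set (b := nat_floor y) in *. set (c := nat_floor (x + y)) in *.
assert (H2 : INR (a + b) < INR (c + 1)) by (rewrite !plus_INR; simpl; lra).
assert (H3 : INR c < INR (a + b + 2)) by (rewrite !plus_INR; simpl; lra).
apply INR_lt in H2. apply INR_lt in H3. lia.
Qed.

Section Flow.

Variable H : C -> C.
Hypothesis Hdiff : forall s, 0 < Re s -> cdiff H s.
Hypothesis Hpos : forall s, 0 < Re s -> 0 <= Re (H s).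

Definition lipschitz_bounded (eps M L : R) : Prop :=
  0 < eps /\ 0 <= M /\ 0 <= L /\
  (forall s, eps <= Re s -> Cmod (H s) <= M) /\
  (forall s s', eps <= Re s -> eps <= Re s' -> Cmod (H s - H s') <= L * Cmod (s - s')).

Hypothesis Hlip : forall eps, 0 < eps -> exists M L, lipschitz_bounded eps M L.

Fixpoint euler (h : R) (k : nat) (s : C) : C :=
  match k with
  | O => s
  | S j => (euler h j s + RtoC h * H (euler h j s))%C
  end.

Lemma euler_add h j k s : euler h (j + k) s = euler h j (euler h k s).
Proof. induction j as [|j IH]; simpl; [reflexivity|]. now rewrite IH. Qed.

(** As [Re H >= 0], the scheme never moves left; constants valid on [Re s >= eps] therefore hold at
    every iterate. *)
Lemma euler_re h k s : 0 <= h -> 0 < Re s -> Re s <= Re (euler h k s).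
Proof.
intros Hh Hs. induction k as [|k IH]; simpl euler; [lra|].
rewrite re_plus, re_scal_l. assert (0 <= Re (H (euler h k s))) by (apply Hpos; lra). nra.
Qed.

Lemma euler_cdiff h k s : 0 <= h -> 0 < Re s -> cdiff (euler h k) s.
Proof.
intros Hh Hs. induction k as [|k [d IH]].
- exists (RtoC 1). apply cderiv_id.
- destruct (Hdiff (euler h k s)) as [e He].
  { pose proof (euler_re h k s Hh Hs). lra. }
  eexists. simpl. apply cderiv_plus; [exact IH|]. apply cderiv_scal.
  apply (cderiv_comp H (euler h k)); [exact He|exact IH].
Qed.

Lemma euler_dclosure theta h k : 0 <= theta -> 0 <= h -> dclosure theta H ->
  dclosure theta (fun s => euler h k s - s)%C.
Proof.
intros Ht Hh HH. induction k as [|k IH].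
- apply dclosure_ext with (fun _ => RtoC 0); [intros s _; simpl; ring|apply dclosure_const].
- apply dclosure_ext with (fun s => (euler h k s - s) + RtoC h * H (s + (euler h k s - s)))%C.
  { intros s _. simpl. replace (s + (euler h k s - s))%C with (euler h k s) by ring. ring. }
  apply dclosure_plus; [exact IH|]. apply dclosure_mult; [exact Ht|apply dclosure_const|].
  apply (dclosure_comp theta theta H (fun s => euler h k s - s)%C); auto.
  intros s Hs. replace (s + (euler h k s - s))%C with (euler h k s) by ring.
  pose proof (euler_re h k s Hh ltac:(lra)). lra.
Qed.

Section Estimates.

Variables eps M L : R.
Hypothesis Hest : lipschitz_bounded eps M L.

Let Heps : 0 < eps := proj1 Hest.
Let HM : 0 <= M := proj1 (proj2 Hest).
Let HL : 0 <= L := proj1 (proj2 (proj2 Hest)).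
Let HMb := proj1 (proj2 (proj2 (proj2 Hest))).
Let HLb := proj2 (proj2 (proj2 (proj2 Hest))).

Lemma euler_in h k s : 0 <= h -> eps <= Re s -> eps <= Re (euler h k s).
Proof. intros Hh Hs. pose proof (euler_re h k s Hh ltac:(lra)). lra. Qed.

Lemma euler_dist h k s : 0 <= h -> eps <= Re s -> Cmod (euler h k s - s) <= INR k * h * M.
Proof.
intros Hh Hs. induction k as [|k IH].
- simpl euler. rewrite Cmod_minus_self. simpl. lra.
- simpl euler. rewrite S_INR.
  replace (euler h k s + RtoC h * H (euler h k s) - s)%C with
    ((euler h k s - s) + RtoC h * H (euler h k s))%C by ring.
  eapply Rle_trans; [apply Cmod_triangle|]. rewrite Cmod_mult, Cmod_R, Rabs_pos_eq by exact Hh.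
  assert (h * Cmod (H (euler h k s)) <= h * M).
  { apply Rmult_le_compat_l; [exact Hh|]. apply HMb, euler_in; auto. }
  lra.
Qed.

Lemma euler_step_lipschitz h a b : 0 <= h -> eps <= Re a -> eps <= Re b ->
  Cmod ((a + RtoC h * H a) - (b + RtoC h * H b)) <= exp (L * h) * Cmod (a - b).
Proof.
intros Hh Ha Hb.
replace (a + RtoC h * H a - (b + RtoC h * H b))%C with ((a - b) + RtoC h * (H a - H b))%C by ring.
eapply Rle_trans; [apply Cmod_triangle|]. rewrite Cmod_mult, Cmod_R, Rabs_pos_eq by exact Hh.
pose proof (HLb a b Ha Hb). pose proof (exp_ineq1_le (L * h)).
assert (h * Cmod (H a - H b) <= h * (L * Cmod (a - b))) by (apply Rmult_le_compat_l; auto).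
pose proof (Cmod_ge_0 (a - b)). nra.
Qed.

Lemma euler_lipschitz h k a b : 0 <= h -> eps <= Re a -> eps <= Re b ->
  Cmod (euler h k a - euler h k b) <= exp (L * (INR k * h)) * Cmod (a - b).
Proof.
intros Hh Ha Hb. induction k as [|k IH].
- simpl. rewrite Rmult_0_l, Rmult_0_r, exp_0. lra.
- simpl euler. eapply Rle_trans; [apply euler_step_lipschitz; auto using euler_in|].
  rewrite S_INR. replace (L * ((INR k + 1) * h)) with (L * h + L * (INR k * h)) by ring.
  rewrite exp_plus, Rmult_assoc. apply Rmult_le_compat_l; [left; apply exp_pos|exact IH].
Qed.

(** At each step, freezing [H] at the starting point costs at most [L] times the distance travelled;
    in the limit of small [h] this identifies the generator. *)
Lemma euler_generator h k s : 0 <= h -> eps <= Re s ->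
  Cmod (euler h k s - s - RtoC (INR k * h) * H s) <= L * M * ((INR k * h) * (INR k * h)).
Proof.
intros Hh Hs. induction k as [|k IH].
- simpl. replace (s - s - RtoC (0 * h) * H s)%C with (RtoC 0).
  + rewrite Cmod_0. lra.
  + rewrite RtoC_mult. ring.
- simpl euler. rewrite S_INR.
  replace (euler h k s + RtoC h * H (euler h k s) - s - RtoC ((INR k + 1) * h) * H s)%C with
    ((euler h k s - s - RtoC (INR k * h) * H s) + RtoC h * (H (euler h k s) - H s))%C.
  2:{ rewrite !RtoC_mult, RtoC_plus. ring. }
  eapply Rle_trans; [apply Cmod_triangle|]. rewrite Cmod_mult, Cmod_R, Rabs_pos_eq by exact Hh.
  pose proof (HLb (euler h k s) s (euler_in h k s Hh Hs) Hs) as B1.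
  pose proof (euler_dist h k s Hh Hs) as B2.
  assert (B3 : h * Cmod (H (euler h k s) - H s) <= h * (L * (INR k * h * M))).
  { apply Rmult_le_compat_l; [exact Hh|]. eapply Rle_trans; [exact B1|].
    apply Rmult_le_compat_l; auto. }
  pose proof (pos_INR k) as Pk.
  assert (0 <= L * M * (h * h)) by (repeat apply Rmult_le_pos; auto).
  assert (0 <= L * M * (h * h) * INR k) by (apply Rmult_le_pos; auto).
  nra.
Qed.

(** Discrete Gronwall: replacing one step by two half steps makes a local error of at most
    [L * M * h^2], and each later step amplifies the accumulated error by at most [exp (L * h)]. *)
Lemma euler_halve h k s : 0 <= h -> eps <= Re s ->
  Cmod (euler (h / 2) (2 * k) s - euler h k s) <= INR k * exp (L * (INR k * h)) * (L * M * (h * h)).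
Proof.
intros Hh Hs. induction k as [|k IH].
- simpl. rewrite Cmod_minus_self. lra.
- replace (2 * S k)%nat with (S (S (2 * k))) by lia.
  set (a := euler (h / 2) (2 * k) s) in *. set (b := euler h k s) in *.
  assert (Ha : eps <= Re a) by (apply euler_in; lra).
  assert (Hb : eps <= Re b) by (apply euler_in; auto).
  change (euler (h / 2) (S (S (2 * k))) s) with
    (a + RtoC (h / 2) * H a + RtoC (h / 2) * H (a + RtoC (h / 2) * H a))%C.
  change (euler h (S k) s) with (b + RtoC h * H b)%C.
  set (a' := (a + RtoC (h / 2) * H a)%C).
  assert (Ha' : eps <= Re a').
  { unfold a'. rewrite re_plus, re_scal_l. assert (0 <= Re (H a)) by (apply Hpos; lra). nra. }
  assert (D1 : Cmod (a' - a) <= h * M).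
  { replace (a' - a)%C with (RtoC (h / 2) * H a)%C by (unfold a'; ring).
    rewrite Cmod_mult, Cmod_R, Rabs_pos_eq by lra. pose proof (HMb a Ha). pose proof (Cmod_ge_0 (H a)). nra. }
  assert (D2 : Cmod (a' + RtoC (h / 2) * H a' - (a + RtoC h * H a)) <= L * M * (h * h)).
  { replace (a' + RtoC (h / 2) * H a' - (a + RtoC h * H a))%C with (RtoC (h / 2) * (H a' - H a))%C.
    2:{ unfold a' at 2. replace (RtoC h) with (RtoC (h / 2) + RtoC (h / 2))%C.
        - ring.
        - rewrite <- RtoC_plus. f_equal. lra. }
    rewrite Cmod_mult, Cmod_R, Rabs_pos_eq by lra.
    pose proof (HLb a' a Ha' Ha) as B.
    assert (B2 : L * Cmod (a' - a) <= L * (h * M)) by (apply Rmult_le_compat_l; auto).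
    pose proof (Cmod_ge_0 (H a' - H a)).
    assert (0 <= L * (h * M)) by (repeat apply Rmult_le_pos; auto). nra. }
  pose proof (euler_step_lipschitz h a b Hh Ha Hb) as D3.
  eapply Rle_trans; [apply (Cmod_minus_triangle _ (a + RtoC h * H a))|].
  rewrite S_INR.
  replace (L * ((INR k + 1) * h)) with (L * h + L * (INR k * h)) by ring.
  rewrite exp_plus.
  set (c := L * M * (h * h)) in *.
  assert (Hc : 0 <= c) by (unfold c; repeat apply Rmult_le_pos; auto).
  assert (D4 : exp (L * h) * Cmod (a - b) <= exp (L * h) * (INR k * exp (L * (INR k * h)) * c)).
  { apply Rmult_le_compat_l; [left; apply exp_pos|exact IH]. }
  pose proof (pos_INR k) as Pk.
  assert (E1 : 1 <= exp (L * h) * exp (L * (INR k * h))).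
  { rewrite <- exp_plus, <- exp_0. apply exp_le.
    assert (0 <= INR k * h) by (apply Rmult_le_pos; auto). nra. }
  nra.
Qed.

Lemma euler_one_more h k s : 0 <= h -> eps <= Re s -> Cmod (euler h (S k) s - euler h k s) <= h * M.
Proof.
intros Hh Hs. simpl euler.
replace (euler h k s + RtoC h * H (euler h k s) - euler h k s)%C with (RtoC h * H (euler h k s))%C by ring.
rewrite Cmod_mult, Cmod_R, Rabs_pos_eq by exact Hh.
apply Rmult_le_compat_l; [exact Hh|]. apply HMb, euler_in; auto.
Qed.

End Estimates.

(** On dyadic meshes consecutive approximations are compared by [euler_halve]; the floor adds at
    most one step. *)
Definition approx_flow (N : nat) (t : R) (s : C) : C :=
  euler (/ 2 ^ N) (nat_floor (t * 2 ^ N)) s.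

Lemma mesh_pos N : 0 < / 2 ^ N.
Proof. apply Rinv_0_lt_compat, pow_lt. lra. Qed.

Lemma mesh_floor N t : 0 <= t ->
  t - / 2 ^ N <= INR (nat_floor (t * 2 ^ N)) * / 2 ^ N <= t.
Proof.
intros Ht. assert (P : 0 < 2 ^ N) by (apply pow_lt; lra).
destruct (nat_floor_spec (t * 2 ^ N)) as [H1 H2]; [apply Rmult_le_pos; lra|].
pose proof (mesh_pos N).
assert (E : t = t * 2 ^ N * / 2 ^ N) by (field; lra).
split.
- rewrite E at 1. replace (t * 2 ^ N * / 2 ^ N - / 2 ^ N) with ((t * 2 ^ N - 1) * / 2 ^ N) by ring.
  apply Rmult_le_compat_r; lra.
- rewrite E at 2. apply Rmult_le_compat_r; lra.
Qed.

(** In units of the mesh: the accumulated halving error over time [t], then [M] for the step that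
    the floor may add. *)
Definition rate (M L t : R) : R := t * exp (L * t) * (L * M) + M.

Lemma approx_flow_cauchy eps M L t s : lipschitz_bounded eps M L -> 0 <= t -> eps <= Re s ->
  forall N, Cmod (approx_flow (S N) t s - approx_flow N t s) <= rate M L t / 2 ^ N.
Proof.
intros Hest Ht Hs N. unfold approx_flow.
destruct Hest as [He [HM [HL HR]]]. assert (Hest : lipschitz_bounded eps M L) by (repeat split; tauto).
set (h := / 2 ^ N). set (k := nat_floor (t * 2 ^ N)).
assert (Hh : 0 < h) by apply mesh_pos.
assert (E : / 2 ^ S N = h / 2).
{ unfold h. simpl. field. apply pow_nonzero. lra. }
rewrite E.
pose proof (mesh_floor N t Ht) as MF. fold h k in MF.
assert (B1 : Cmod (euler (h / 2) (2 * k) s - euler h k s) <= t * exp (L * t) * (L * M) * h).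
{ eapply Rle_trans; [apply (euler_halve eps M L Hest); lra|].
  pose proof (pos_INR k) as Pk.
  apply Rle_trans with ((INR k * h) * exp (L * (INR k * h)) * (L * M) * h); [right; ring|].
  apply Rmult_le_compat_r; [lra|]. apply Rmult_le_compat_r; [now apply Rmult_le_pos|].
  apply Rmult_le_compat; [apply Rmult_le_pos; lra|left; apply exp_pos|lra|].
  apply exp_le. apply Rmult_le_compat_l; lra. }
assert (B2 : Cmod (euler (h / 2) (nat_floor (t * 2 ^ S N)) s - euler (h / 2) (2 * k) s) <= h * M).
{ replace (t * 2 ^ S N) with (t * 2 ^ N + t * 2 ^ N) by (simpl; ring).
  assert (P : 0 <= t * 2 ^ N) by (apply Rmult_le_pos; [exact Ht|apply pow_le; lra]).
  destruct (nat_floor_plus _ _ P P) as [-> | ->]; fold k; replace (k + k)%nat with (2 * k)%nat by lia.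
  - rewrite Cmod_minus_self. apply Rmult_le_pos; lra.
  - eapply Rle_trans; [apply (euler_one_more eps M L Hest); lra|]. apply Rmult_le_compat_r; lra. }
eapply Rle_trans; [apply (Cmod_minus_triangle _ (euler (h / 2) (2 * k) s))|].
unfold rate, Rdiv. fold h. lra.
Qed.

Definition flow (t : R) (s : C) : C :=
  epsilon (inhabits (RtoC 0)) (climit (fun N => approx_flow N t s)).

Lemma flow_limit t s : 0 <= t -> 0 < Re s -> climit (fun N => approx_flow N t s) (flow t s).
Proof.
intros Ht Hs. unfold flow. apply epsilon_spec.
destruct (Hlip (Re s) Hs) as [M [L Hest]].
apply (dyadic_limit _ (rate M L t)). apply (approx_flow_cauchy (Re s)); auto. lra.
Qed.

Lemma flow_rate eps M L t s N : lipschitz_bounded eps M L -> 0 <= t -> eps <= Re s ->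
  Cmod (approx_flow N t s - flow t s) <= 2 * rate M L t / 2 ^ N.
Proof.
intros Hest Ht Hs. destruct (dyadic_limit _ _ (approx_flow_cauchy eps M L t s Hest Ht Hs)) as [_ G].
apply G. apply flow_limit; [exact Ht|]. destruct Hest; lra.
Qed.

Lemma flow_re t s : 0 <= t -> 0 < Re s -> Re s <= Re (flow t s).
Proof.
intros Ht Hs. apply (climit_re_ge _ _ _ (flow_limit t s Ht Hs)).
intros n. apply euler_re; [left; apply mesh_pos|exact Hs].
Qed.

Lemma flow_0 s : 0 < Re s -> flow 0 s = s.
Proof.
intros Hs. apply Ceq_minus, Cmod_eq_0, Rle_antisym; [|apply Cmod_ge_0].
apply (climit_dist_le _ _ _ _ (flow_limit 0 s (Rle_refl 0) Hs)).
intros n. unfold approx_flow. rewrite Rmult_0_l, nat_floor_0. simpl euler.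
rewrite Cmod_minus_self. lra.
Qed.

Lemma flow_dist eps M L t s : lipschitz_bounded eps M L -> 0 <= t -> eps <= Re s ->
  Cmod (flow t s - s) <= t * M.
Proof.
intros Hest Ht Hs. assert (P : 0 < Re s) by (destruct Hest; lra).
apply (climit_dist_le _ _ _ _ (flow_limit t s Ht P)). intros n.
eapply Rle_trans; [apply (euler_dist eps M L Hest); [left; apply mesh_pos|exact Hs]|].
apply Rmult_le_compat_r; [apply Hest|]. now apply mesh_floor.
Qed.

Lemma flow_generator eps M L t s : lipschitz_bounded eps M L -> 0 <= t -> eps <= Re s ->
  Cmod (flow t s - s - RtoC t * H s) <= L * M * (t * t).
Proof.
intros Hest Ht Hs. assert (P : 0 < Re s) by (destruct Hest; lra).
destruct Hest as [He [HM [HL HR]]]. assert (Hest : lipschitz_bounded eps M L) by (repeat split; tauto).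
apply le_epsilon. intros e Hepos.
(* One half of [e] pays for the distance to the limit, the other for rounding [t] down to the
   mesh. *)
destruct (exists_small_power (2 * rate M L t) (e / 2)) as [N1 HN1].
{ unfold rate. assert (0 <= t * exp (L * t) * (L * M)); [|lra].
  repeat apply Rmult_le_pos; auto. left; apply exp_pos. }
{ lra. }
destruct (exists_small_power M (e / 2)) as [N2 HN2]; [lra|lra|].
set (N := max N1 N2).
assert (Hmono : forall r n, 0 <= r -> (n <= N)%nat -> r / 2 ^ N <= r / 2 ^ n).
{ intros r n Hr Hn. apply Rmult_le_compat_l; [exact Hr|].
  apply Rinv_le_contravar; [apply pow_lt; lra|]. apply Rle_pow; [lra|exact Hn]. }
pose proof (flow_rate eps M L t s N Hest Ht Hs) as B1.
assert (Hr : 0 <= 2 * rate M L t).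
{ unfold rate. assert (0 <= t * exp (L * t) * (L * M)); [|lra].
  repeat apply Rmult_le_pos; auto. left; apply exp_pos. }
pose proof (Hmono _ N1 Hr ltac:(unfold N; lia)) as B2.
pose proof (Hmono _ N2 HM ltac:(unfold N; lia)) as B3.
set (h := / 2 ^ N). set (k := nat_floor (t * 2 ^ N)).
pose proof (mesh_floor N t Ht) as MF. fold h k in MF.
assert (Hh : 0 < h) by apply mesh_pos.
pose proof (euler_generator eps M L Hest h k s ltac:(lra) Hs) as B4.
assert (B5 : L * M * (INR k * h * (INR k * h)) <= L * M * (t * t)).
{ apply Rmult_le_compat_l; [now apply Rmult_le_pos|].
  assert (0 <= INR k * h) by (apply Rmult_le_pos; [apply pos_INR|lra]).
  apply Rmult_le_compat; lra. }
assert (B6 : Cmod (RtoC (INR k * h - t) * H s) <= M / 2 ^ N).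
{ rewrite Cmod_mult, Cmod_R, Rmult_comm. unfold Rdiv. fold h.
  apply Rmult_le_compat; [apply Cmod_ge_0|apply Rabs_pos|now apply HR|].
  rewrite Rabs_left1; lra. }
change (approx_flow N t s) with (euler h k s) in B1. rewrite Cmod_minus_sym in B1.
replace (flow t s - s - RtoC t * H s)%C with
  ((flow t s - euler h k s) + (euler h k s - s - RtoC (INR k * h) * H s)
    + RtoC (INR k * h - t) * H s)%C.
2:{ rewrite RtoC_minus. ring. }
eapply Rle_trans; [apply Cmod_triangle|].
eapply Rle_trans; [apply Rplus_le_compat_r, Cmod_triangle|]. lra.
Qed.

(** The approximations obey the semigroup law up to one Euler step, which may be lost by rounding
    [t] and [u] separately. *)
Lemma flow_semigroup t u s : 0 <= t -> 0 <= u -> 0 < Re s ->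
  flow t (flow u s) = flow (t + u) s.
Proof.
intros Ht Hu Hs.
destruct (Hlip (Re s) Hs) as [M [L Hest]].
destruct Hest as [He [HM [HL HR]]].
assert (Hest : lipschitz_bounded (Re s) M L) by (repeat split; tauto).
assert (Hrate : forall x, 0 <= x -> 0 <= rate M L x).
{ intros x Hx. unfold rate. assert (0 <= x * exp (L * x) * (L * M)); [|lra].
  repeat apply Rmult_le_pos; auto. left; apply exp_pos. }
(* In order: the error of the outer flow, that of the inner flow propagated by the Lipschitz
   constant [exp (L * t)], the possible extra step, and the error at time [t + u]. *)
set (K := 2 * rate M L t + exp (L * t) * (2 * rate M L u) + M + 2 * rate M L (t + u)).
assert (HK : 0 <= K).
{ unfold K. pose proof (Hrate t Ht). pose proof (Hrate u Hu). pose proof (Hrate (t + u) ltac:(lra)).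
  assert (0 <= exp (L * t) * (2 * rate M L u)); [|lra].
  apply Rmult_le_pos; [left; apply exp_pos|lra]. }
apply Ceq_minus, Cmod_eq_0, Rle_antisym; [|apply Cmod_ge_0].
apply le_epsilon. intros e Hepos. rewrite Rplus_0_l.
destruct (exists_small_power K e HK Hepos) as [N HN].
eapply Rle_trans; [|left; exact HN].
assert (Hfu : Re s <= Re (flow u s)) by (now apply flow_re).
pose proof (flow_rate _ M L t (flow u s) N Hest Ht Hfu) as B1. rewrite Cmod_minus_sym in B1.
pose proof (flow_rate _ M L u s N Hest Hu (Rle_refl _)) as B2. rewrite Cmod_minus_sym in B2.
pose proof (flow_rate _ M L (t + u) s N Hest ltac:(lra) (Rle_refl _)) as B3.
pose proof (mesh_pos N) as Hh.
assert (Hau : Re s <= Re (approx_flow N u s)) by (apply euler_re; lra).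
assert (B4 : Cmod (approx_flow N t (flow u s) - approx_flow N t (approx_flow N u s))
  <= exp (L * t) * (2 * rate M L u / 2 ^ N)).
{ eapply Rle_trans; [apply (euler_lipschitz _ M L Hest); [lra|exact Hfu|exact Hau]|].
  apply Rmult_le_compat; [left; apply exp_pos|apply Cmod_ge_0| |exact B2].
  apply exp_le. apply Rmult_le_compat_l; [exact HL|]. now apply mesh_floor. }
assert (B5 : Cmod (approx_flow N t (approx_flow N u s) - approx_flow N (t + u) s) <= M / 2 ^ N).
{ unfold approx_flow. rewrite <- euler_add, Rmult_plus_distr_r.
  assert (P : 0 < 2 ^ N) by (apply pow_lt; lra).
  destruct (nat_floor_plus (t * 2 ^ N) (u * 2 ^ N)) as [-> | ->]; try (apply Rmult_le_pos; lra).
  - rewrite Cmod_minus_self. apply Rdiv_le_0_compat; lra.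
  - rewrite Cmod_minus_sym. unfold Rdiv. rewrite (Rmult_comm M).
    apply (euler_one_more _ M L Hest); lra. }
unfold K, Rdiv in *. rewrite !Rmult_plus_distr_r.
eapply Rle_trans; [apply (Cmod_minus_triangle _ (approx_flow N (t + u) s))|].
apply Rplus_le_compat; [|exact B3].
eapply Rle_trans; [apply (Cmod_minus_triangle _ (approx_flow N t (approx_flow N u s)))|].
apply Rplus_le_compat; [|exact B5].
eapply Rle_trans; [apply (Cmod_minus_triangle _ (approx_flow N t (flow u s)))|].
apply Rplus_le_compat; [exact B1|lra].
Qed.

Lemma approx_flow_uniform eps M L t : lipschitz_bounded eps M L -> 0 <= t ->
  forall e, 0 < e -> exists N, forall n s, (N <= n)%nat -> eps <= Re s ->
    Cmod (approx_flow n t s - flow t s) <= e.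
Proof.
intros Hest Ht e He.
assert (Hr : 0 <= 2 * rate M L t).
{ destruct Hest as [_ [HM [HL _]]]. unfold rate. assert (0 <= t * exp (L * t) * (L * M)); [|lra].
  repeat apply Rmult_le_pos; auto. left; apply exp_pos. }
destruct (exists_small_power _ e Hr He) as [N HN]. exists N. intros n s Hn Hs.
eapply Rle_trans; [apply (flow_rate eps M L); auto|].
eapply Rle_trans; [|left; exact HN]. apply Rmult_le_compat_l; [exact Hr|].
apply Rinv_le_contravar; [apply pow_lt; lra|]. apply Rle_pow; [lra|exact Hn].
Qed.

Lemma flow_cdiff t s : 0 <= t -> 0 < Re s -> cdiff (flow t) s.
Proof.
intros Ht Hs. destruct (Hlip (Re s / 2)) as [M [L Hest]]; [lra|].
assert (Hin : forall z, Cmod (z - s) < Re s / 2 -> Re s / 2 <= Re z).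
{ intros z Hz. pose proof (re_le_Cmod (z - s)) as B. rewrite re_minus in B.
  apply Rabs_le_between in B. lra. }
apply (uniform_limit_cdiff (fun n => approx_flow n t) (flow t) s (Re s / 2)).
- lra.
- intros n z Hz. apply euler_cdiff; [left; apply mesh_pos|]. pose proof (Hin z Hz). lra.
- intros e He. destruct (approx_flow_uniform _ M L t Hest Ht e He) as [N HN].
  exists N. intros n z Hn Hz. apply HN; auto.
Qed.

Lemma flow_dclosure theta t : 0 < theta -> 0 <= t -> dclosure theta H ->
  dclosure theta (fun s => flow t s - s)%C.
Proof.
intros Hth Ht HH. destruct (Hlip theta Hth) as [M [L Hest]].
apply dclosure_limit. intros e He.
destruct (approx_flow_uniform _ M L t Hest Ht e He) as [N HN].
exists (fun s => approx_flow N t s - s)%C. split.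
- apply euler_dclosure; [lra|left; apply mesh_pos|exact HH].
- intros s Hs. replace (flow t s - s - (approx_flow N t s - s))%C with (flow t s - approx_flow N t s)%C by ring.
  rewrite Cmod_minus_sym. apply HN; [lia|lra].
Qed.

End Flow.

(** * From Dirichlet series to semigroups *)

Lemma at_right_0_iff (P : R -> Prop) :
  at_right 0 P <-> exists d, 0 < d /\ forall t, 0 < t < d -> P t.
Proof.
split.
- intros [d Hd]. exists d. split; [apply cond_pos|]. intros t Ht. apply Hd; [|lra].
  change (Rabs (t - 0) < d). rewrite Rminus_0_r, Rabs_pos_eq; lra.
- intros [d [Hd H]]. exists (mkposreal d Hd). intros t Hb Ht. apply H. split; [exact Ht|].
  change (Rabs (t - 0) < d) in Hb. rewrite Rminus_0_r, Rabs_pos_eq in Hb; lra.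
Qed.

Lemma is_generator_iff (Phi : R -> C -> C) (H : C -> C) :
  is_generator Phi H <-> forall s, 0 < Re s -> forall e, 0 < e ->
    exists d, 0 < d /\ forall t, 0 < t < d -> Cmod ((Phi t s - s) / RtoC t - H s) < e.
Proof.
split.
- intros G s Hs e He.
  apply at_right_0_iff. apply (G s Hs (fun z => Cmod (z - H s) < e)).
  apply locally_C_iff. exists e. auto.
- intros G s Hs P HP. apply locally_C_iff in HP. destruct HP as [e [He HP]].
  destruct (G s Hs e He) as [d [Hd Ht]]. apply at_right_0_iff. exists d. split; [exact Hd|].
  intros t Htd. apply HP, Ht, Htd.
Qed.

Lemma compact_in_smaller_half_plane (K : C -> Prop) :
  compact_set K -> (forall s, K s -> half_plane 0 s) ->
  exists eps, 0 < eps /\ forall s, K s -> eps <= Re s.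
Proof.
intros HK Hin.
destruct (HK nat (fun n s => / INR (S n) < Re s)) as [l Hl].
- intros n z Hz. apply locally_C_iff. exists (Re z - / INR (S n)). split; [lra|].
  intros w Hw. pose proof (re_le_Cmod (w - z)) as B. rewrite re_minus in B.
  apply Rabs_le_between in B. lra.
- intros z Hz. specialize (Hin z Hz). unfold half_plane in Hin.
  destruct (archimed_cor1 (Re z) Hin) as [N [HN HN0]].
  exists N. eapply Rlt_trans; [|exact HN]. apply Rinv_lt_contravar.
  + apply Rmult_lt_0_compat; apply lt_0_INR; lia.
  + apply lt_INR. lia.
- exists (/ INR (S (list_max l))). split; [apply Rinv_0_lt_compat, lt_0_INR; lia|].
  intros s Hs. destruct (Hl s Hs) as [n [Hn Hlt]].
  left. eapply Rle_lt_trans; [|exact Hlt].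
  apply Rinv_le_contravar; [apply lt_0_INR; lia|]. apply le_INR.
  assert (G := proj1 (list_max_le l (list_max l)) (le_n _)).
  rewrite Forall_forall in G. specialize (G n Hn). lia.
Qed.

Section Generator.

Variable H : C -> C.
Hypothesis Hdiff : forall s, 0 < Re s -> cdiff H s.
Hypothesis Hpos : forall s, 0 < Re s -> 0 <= Re (H s).

Lemma dirichlet_series_lipschitz_bounded : is_dirichlet_series H ->
  forall eps, 0 < eps -> exists M L, lipschitz_bounded H eps M L.
Proof.
intros HD eps He.
destruct (dirichlet_series_bounded_right H HD) as [th [B [_ [_ HB]]]].
destruct (bounded_of_bounded_right H Hdiff Hpos th B eps He HB) as [M [L [HM HL]]].
exists (Rmax M 0), (Rmax L 0). split; [exact He|]. split; [apply Rmax_r|]. split; [apply Rmax_r|]. split.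
- intros s Hs. eapply Rle_trans; [apply HM, Hs|apply Rmax_l].
- intros s s' Hs Hs'. eapply Rle_trans; [apply HL; auto|].
  apply Rmult_le_compat_r; [apply Cmod_ge_0|apply Rmax_l].
Qed.

Lemma Hinfty_of_dirichlet_series : is_dirichlet_series H -> forall eps, 0 < eps -> Hinfty eps H.
Proof.
intros HD eps He. split; [| |exact HD].
- apply analytic_on_cdiff. intros s Hs. apply Hdiff. unfold half_plane in Hs. lra.
- destruct (dirichlet_series_lipschitz_bounded HD eps He) as [M [L Hest]].
  exists M. intros s Hs. apply Hest. left. exact Hs.
Qed.

Lemma semigroup_of_dirichlet_series : is_dirichlet_series H ->
  exists Phi, continuous_semigroup Phi /\ (forall t, 0 <= t -> gordon_hedenmalm (Phi t)) /\
    is_generator Phi H.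
Proof.
intros HD. pose proof (dirichlet_series_lipschitz_bounded HD) as Hlip.
assert (Hself : forall t, 0 <= t -> analytic_self_map (flow H t)).
{ intros t Ht. split.
  - apply analytic_on_cdiff. intros s Hs. apply flow_cdiff; auto.
  - intros s Hs. unfold half_plane in *.
    pose proof (flow_re H Hpos Hlip t s Ht Hs). lra. }
exists (flow H). split; [|split].
- split; auto.
  + intros s Hs. apply flow_0; auto.
  + intros t u Ht Hu s Hs. apply flow_semigroup; auto.
  + intros K HK Hin eps.
    destruct (compact_in_smaller_half_plane K HK Hin) as [e [He HKe]].
    destruct (Hlip e He) as [M [L Hest]].
    assert (HM : 0 <= M) by apply Hest.
    apply at_right_0_iff. exists (eps / (M + 1)). split.
    { apply Rdiv_lt_0_compat; [apply cond_pos|lra]. }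
    intros t Ht s Hs.
    rewrite (flow_0 H Hpos Hlip s) by apply Hin, Hs.
    eapply Rle_lt_trans; [apply (flow_dist H Hpos Hlip e M L); [exact Hest|lra|apply HKe, Hs]|].
    apply Rle_lt_trans with (t * (M + 1)); [apply Rmult_le_compat_l; lra|].
    replace (pos eps) with (eps / (M + 1) * (M + 1)) by (field; lra).
    apply Rmult_lt_compat_r; lra.
- intros t Ht. split; [auto|].
  exists 1%nat, (fun s => flow H t s - s)%C. split; [|split].
  + destruct (dirichlet_series_tail H HD) as [th [K [a [Hth [_ [Hcl _]]]]]].
    (* [flow_dclosure] asks for a positive abscissa, whereas [th] may be 0. *)
    apply (dclosure_is_dirichlet_series (th + 1)).
    apply flow_dclosure; auto; [lra|]. apply (dclosure_mono th); [lra|exact Hcl].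
  + intros s _. simpl. ring.
  + discriminate.
- apply is_generator_iff. intros s Hs e He.
  destruct (Hlip (Re s) Hs) as [M [L Hest]].
  assert (HLM : 0 <= L * M) by (apply Rmult_le_pos; apply Hest).
  exists (e / (L * M + 1)). split; [apply Rdiv_lt_0_compat; lra|].
  intros t Ht.
  assert (Nt : RtoC t <> RtoC 0) by (intros E; apply RtoC_inj in E; lra).
  replace ((flow H t s - s) / RtoC t - H s)%C with ((flow H t s - s - RtoC t * H s) / RtoC t)%C by (field; exact Nt).
  rewrite Cmod_div, Cmod_R, Rabs_pos_eq by (auto; lra).
  pose proof (flow_generator H Hpos Hlip (Re s) M L t s Hest ltac:(lra) (Rle_refl _)) as B.
  apply Rle_lt_trans with (L * M * (t * t) / t).
  { apply Rmult_le_compat_r; [left; apply Rinv_0_lt_compat; lra|exact B]. }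
  replace (L * M * (t * t) / t) with (L * M * t) by (field; lra).
  apply Rle_lt_trans with ((L * M + 1) * t); [apply Rmult_le_compat_r; lra|].
  replace e with ((L * M + 1) * (e / (L * M + 1))) by (field; lra).
  apply Rmult_lt_compat_l; lra.
Qed.

End Generator.

(** * From semigroups to Dirichlet series *)

Lemma linear_bounded_zero (x B X : R) : (forall y, X <= y -> Rabs x * y <= B) -> x = 0.
Proof.
intros HB. apply NNPP. intros Hx. assert (P : 0 < Rabs x) by now apply Rabs_pos_lt.
specialize (HB (Rmax X ((B + 1) / Rabs x)) (Rmax_l _ _)).
assert (H0 : Rabs x * ((B + 1) / Rabs x) <= Rabs x * Rmax X ((B + 1) / Rabs x)).
{ apply Rmult_le_compat_l; [lra|apply Rmax_r]. }
replace (Rabs x * ((B + 1) / Rabs x)) with (B + 1) in H0 by (field; lra). lra.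
Qed.

Lemma exp_linear_decay K e : 0 <= K -> 0 < e ->
  exists X, 0 < X /\ forall x, X <= x -> K * exp (- x * ln 2) * x <= e.
Proof.
(* From [2^{-x} <= e^{-x/2}] and [e^{x/2} >= (x/4)^2] the left-hand side is at most [16 * K / x]. *)
intros HK He. exists (16 * K / e + 1).
assert (0 <= 16 * K / e) by (apply Rdiv_le_0_compat; lra).
split; [lra|]. intros x Hx.
assert (E1 : exp (- x * ln 2) <= exp (- (x / 2))).
{ apply exp_le. pose proof ln_lt_2. nra. }
assert (E2 : x * x / 16 <= exp (x / 2)).
{ replace (x / 2) with (x / 4 + x / 4) by field. rewrite exp_plus.
  pose proof (exp_ineq1_le (x / 4)). nra. }
rewrite exp_Ropp in E1.
assert (E3 : / exp (x / 2) <= / (x * x / 16)) by (apply Rinv_le_contravar; [nra|exact E2]).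
apply Rle_trans with (K * / (x * x / 16) * x).
- apply Rmult_le_compat_r; [lra|]. apply Rmult_le_compat_l; lra.
- replace (K * / (x * x / 16) * x) with (16 * K / x) by (field; lra).
  apply Rmult_le_reg_r with x; [lra|]. replace (16 * K / x * x) with (e * (16 * K / e)) by (field; lra).
  apply Rmult_le_compat_l; lra.
Qed.

Section Semigroup.

Variables (Phi : R -> C -> C) (H : C -> C).
Hypothesis Hsg : continuous_semigroup Phi.
Hypothesis HGH : forall t, 0 <= t -> gordon_hedenmalm (Phi t).
Hypothesis Hgen : forall s, 0 < Re s -> forall e, 0 < e ->
  exists d, 0 < d /\ forall t, 0 < t < d -> Cmod ((Phi t s - s) / RtoC t - H s) < e.

Lemma semigroup_cdiff t s : 0 <= t -> 0 < Re s -> cdiff (Phi t) s.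
Proof.
intros Ht Hs. destruct (semigroup_self_map _ Hsg t Ht) as [A _].
apply (proj1 (analytic_on_cdiff _ _) A). exact Hs.
Qed.

Lemma semigroup_maps t s : 0 <= t -> 0 < Re s -> 0 < Re (Phi t s).
Proof. intros Ht Hs. now apply (self_map_maps _ (semigroup_self_map _ Hsg t Ht)). Qed.

Lemma semigroup_converges s e : 0 < Re s -> 0 < e ->
  exists d, 0 < d /\ forall t, 0 < t < d -> Cmod (Phi t s - s) < e.
Proof.
intros Hs He.
assert (HK : compact_set (fun z => z = s)).
{ intros I U _ HU. destruct (HU s eq_refl) as [i Hi]. exists (i :: nil). intros z ->.
  exists i. split; [now left|exact Hi]. }
assert (HKin : forall z, z = s -> half_plane 0 z) by (intros z ->; exact Hs).
pose proof (semigroup_continuous _ Hsg _ HK HKin (mkposreal e He)) as L.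
apply at_right_0_iff in L. destruct L as [d [Hd L]]. exists d. split; [exact Hd|].
intros t Ht. specialize (L t Ht s eq_refl). simpl in L.
now rewrite (semigroup_0 _ Hsg s Hs) in L.
Qed.

(** What the argument on characteristics retains of the class [G]: linear growth with slope [c] far
    to the right, and the range condition when [c = 0]. *)
Definition characteristic_of (t : R) (c : nat) : Prop :=
  (exists B X, 0 <= B /\ 0 < X /\ forall s, X <= Re s -> Cmod (Phi t s - RtoC (INR c) * s) <= B) /\
  (c = 0%nat -> forall s, 0 < Re s -> 1 / 2 < Re (Phi t s)).

Lemma characteristic_of_form t c phi : is_dirichlet_series phi ->
  (forall s, half_plane 0 s -> Phi t s = (RtoC (INR c) * s + phi s)%C) ->
  (c = 0%nat -> forall s, half_plane 0 s -> half_plane (1 / 2) (Phi t s)) ->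
  characteristic_of t c.
Proof.
intros HD HF Hc. split; [|exact Hc].
destruct (dirichlet_series_bounded_right phi HD) as [th [B [Hth [HB HBb]]]].
exists B, (th + 1). split; [exact HB|]. split; [lra|].
intros s Hs. rewrite HF by (unfold half_plane; lra).
replace (RtoC (INR c) * s + phi s - RtoC (INR c) * s)%C with (phi s) by ring.
apply HBb. lra.
Qed.

Lemma characteristic_exists t : 0 <= t -> exists c, characteristic_of t c.
Proof.
intros Ht. destruct (HGH t Ht) as [_ [c [phi [HD [HF Hc]]]]].
exists c. exact (characteristic_of_form t c phi HD HF Hc).
Qed.

(** Compares slopes along the real axis. As [c >= 1], the point [Phi t y] is again far to the right,
    where the growth estimate applies a second time. *)
Lemma characteristic_square t c c2 : 0 <= t -> (1 <= c)%nat ->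
  characteristic_of t c -> characteristic_of (t + t) c2 -> c2 = (c * c)%nat.
Proof.
intros Ht Hc [[B [X [HB [HX HT]]]] _] [[B2 [X2 [HB2 [HX2 HT2]]]] _].
assert (Hc1 : 1 <= INR c) by (apply (le_INR 1); exact Hc).
apply INR_eq. rewrite mult_INR. apply Rminus_diag_uniq.
(* [y >= X + B] ensures [Re (Phi t y) >= c y - B >= X]. *)
apply (linear_bounded_zero _ (B2 + B + INR c * B) (Rmax X2 (X + B))).
intros y Hy. pose proof (Rmax_l X2 (X + B)). pose proof (Rmax_r X2 (X + B)).
set (s := RtoC y). assert (Es : Re s = y) by reflexivity.
assert (Hs0 : 0 < Re s) by lra.
pose proof (HT s ltac:(lra)) as B1. pose proof (HT2 s ltac:(lra)) as B3.
assert (Hre : X <= Re (Phi t s)).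
{ pose proof (re_le_Cmod (Phi t s - RtoC (INR c) * s)) as R1.
  rewrite re_minus, re_scal_l in R1. apply Rabs_le_between in R1. rewrite Es in R1. nra. }
pose proof (HT _ Hre) as B4. rewrite (semigroup_comp _ Hsg t t Ht Ht s Hs0) in B4.
assert (E : (RtoC (INR c2 - INR c * INR c) * s)%C =
  ((Phi (t + t) s - RtoC (INR c) * Phi t s) + RtoC (INR c) * (Phi t s - RtoC (INR c) * s)
    - (Phi (t + t) s - RtoC (INR c2) * s))%C).
{ rewrite RtoC_minus, RtoC_mult. ring. }
apply (f_equal Cmod) in E. rewrite Cmod_mult, !Cmod_R in E. unfold s in E at 1.
rewrite Cmod_R, (Rabs_pos_eq y) in E by lra. rewrite E.
eapply Rle_trans; [apply Cmod_triangle_minus|].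
eapply Rle_trans; [apply Rplus_le_compat_r, Cmod_triangle|].
rewrite Cmod_mult, Cmod_R, (Rabs_pos_eq (INR c)) by lra.
assert (INR c * Cmod (Phi t s - RtoC (INR c) * s) <= INR c * B) by (apply Rmult_le_compat_l; lra).
lra.
Qed.

(* If the characteristic of [Phi t] vanished, so would that of all [Phi (t / 2^n)],
   which would then map [1/4] into [Re s > 1/2]. *)
Lemma characteristic_pos t c : 0 < t -> characteristic_of t c -> (1 <= c)%nat.
Proof.
intros Ht Hc. destruct c as [|c]; [|lia]. exfalso.
assert (G : forall n, characteristic_of (t / 2 ^ n) 0).
{ induction n as [|n IH].
  - simpl. now rewrite Rdiv_1_r.
  - assert (P : 0 <= t / 2 ^ S n) by (apply Rdiv_le_0_compat; [lra|apply pow_lt; lra]).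
    destruct (characteristic_exists _ P) as [m Hm].
    destruct m as [|m]; [exact Hm|].
    assert (E : t / 2 ^ n = t / 2 ^ S n + t / 2 ^ S n) by (simpl; field; apply pow_nonzero; lra).
    rewrite E in IH.
    pose proof (characteristic_square (t / 2 ^ S n) (S m) 0 P ltac:(lia) Hm IH). lia. }
set (s := RtoC (1 / 4)). assert (Hs : 0 < Re s) by (simpl; lra).
destruct (semigroup_converges s (1 / 4) Hs) as [d [Hd HC]]; [lra|].
destruct (exists_small_power t d) as [n Hn]; [lra|exact Hd|].
assert (P : 0 < t / 2 ^ n) by (apply Rdiv_lt_0_compat; [lra|apply pow_lt; lra]).
specialize (HC _ (conj P Hn)). destruct (G n) as [_ G2]. specialize (G2 eq_refl s Hs).
pose proof (re_le_Cmod (Phi (t / 2 ^ n) s - s)) as R1. rewrite re_minus in R1.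
apply Rabs_le_between in R1. assert (E : Re s = 1 / 4) by reflexivity. lra.
Qed.

(** Descent: the characteristic at [t] is the square of that at [t / 2], which is smaller unless it
    equals 1. *)
Lemma characteristic_one n : forall t, 0 < t -> characteristic_of t n -> n = 1%nat.
Proof.
induction n as [n IH] using lt_wf_ind. intros t Ht Hn.
pose proof (characteristic_pos t n Ht Hn) as Hn1.
destruct (characteristic_exists (t / 2)) as [m Hm]; [lra|].
pose proof (characteristic_pos (t / 2) m ltac:(lra) Hm) as Hm1.
replace t with (t / 2 + t / 2) in Hn by field.
pose proof (characteristic_square (t / 2) m n ltac:(lra) Hm1 Hm Hn) as E.
destruct (Nat.eq_dec n 1) as [|Hne]; [assumption|].
assert (m = 1%nat) by (apply (IH m ltac:(nia) (t / 2)); [lra|exact Hm]).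
lia.
Qed.

Lemma semigroup_displacement t : 0 < t ->
  exists theta K a, 0 < theta /\ 0 <= K /\ dclosure theta (fun s => Phi t s - s)%C /\
    forall s, theta <= Re s -> Cmod (Phi t s - s - a) <= K * exp (- Re s * ln 2).
Proof.
intros Ht. destruct (HGH t ltac:(lra)) as [_ [c [phi [HD [HF Hc]]]]].
destruct (dirichlet_series_tail phi HD) as [th [K [a [Hth [HK [Hcl HT]]]]]].
assert (Ec : c = 1%nat).
{ apply (characteristic_one c t Ht). exact (characteristic_of_form t c phi HD HF Hc). }
subst c.
assert (E : forall s, 0 < Re s -> phi s = (Phi t s - s)%C).
{ intros s Hs. rewrite HF by exact Hs. simpl. ring. }
exists (th + 1), K, a. split; [lra|]. split; [exact HK|]. split.
- apply dclosure_ext with phi; [intros s Hs; apply E; lra|].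
  apply (dclosure_mono th); [lra|exact Hcl].
- intros s Hs. rewrite <- E by lra. apply HT. lra.
Qed.

(* Julia-Wolff at infinity: [Re Phi / Re s] decreases along horizontal lines to its limit [1]. *)
Lemma semigroup_re_le t s : 0 < t -> 0 < Re s -> Re s <= Re (Phi t s).
Proof.
intros Ht Hs. destruct (semigroup_displacement t Ht) as [th [K [a [Hth [HK [_ HT]]]]]].
destruct s as [x y]. simpl Re at 1. simpl in Hs.
set (B := K + Cmod a).
assert (HB : forall x', th <= x' -> x' - B <= Re (Phi t (x', y))).
{ intros x' Hx'. specialize (HT (x', y) Hx').
  assert (E : exp (- Re (x', y) * ln 2) <= 1).
  { rewrite <- exp_0. apply exp_le. simpl. pose proof ln_lt_2. nra. }
  assert (N : Cmod (Phi t (x', y) - (x', y)) <= B).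
  { replace (Phi t (x', y) - (x', y))%C with ((Phi t (x', y) - (x', y) - a) + a)%C by ring.
    eapply Rle_trans; [apply Cmod_triangle|]. unfold B. apply Rplus_le_compat_r. nra. }
  pose proof (re_le_Cmod (Phi t (x', y) - (x', y))) as R1. rewrite re_minus in R1.
  apply Rabs_le_between in R1. simpl Re in R1 at 3. unfold Re in *. simpl in *. lra. }
assert (HB0 : 0 <= B) by (unfold B; pose proof (Cmod_ge_0 a); lra).
apply le_epsilon. intros e He.
(* At [x2] the displacement, at most [B], is a negligible fraction of the abscissa:
   [x * B / x2 <= e]. *)
set (x2 := Rmax (Rmax th x) (x * B / e)).
assert (X1 : th <= x2 /\ x <= x2 /\ x * B / e <= x2).
{ unfold x2. split; [|split].
  - eapply Rle_trans; [apply Rmax_l|apply Rmax_l].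
  - eapply Rle_trans; [apply Rmax_r|apply Rmax_l].
  - apply Rmax_r. }
destruct X1 as [X1 [X2 X3]].
assert (D : Re (Phi t (x2, y)) / x2 <= Re (Phi t (x, y)) / x).
{ apply re_div_abscissa_decreasing; [| |lra].
  - intros s Hs'. apply semigroup_cdiff; lra.
  - intros s Hs'. left. apply semigroup_maps; lra. }
specialize (HB x2 X1).
assert (D2 : (x2 - B) / x2 <= Re (Phi t (x, y)) / x).
{ eapply Rle_trans; [|exact D]. apply Rmult_le_compat_r; [left; apply Rinv_0_lt_compat; lra|exact HB]. }
apply Rmult_le_compat_r with (r := x) in D2; [|lra].
replace (Re (Phi t (x, y)) / x * x) with (Re (Phi t (x, y))) in D2 by (field; lra).
assert (D3 : x * B / x2 <= e).
{ apply Rmult_le_reg_r with x2; [lra|]. replace (x * B / x2 * x2) with (e * (x * B / e)) by (field; lra).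
  apply Rmult_le_compat_l; lra. }
replace ((x2 - B) / x2 * x) with (x - x * B / x2) in D2 by (field; lra). lra.
Qed.

(** [Re (Phi t s - s)] is nonnegative and at most [K 2^{- Re s}] far to the right, so
    [constant_of_decay] applies; the difference quotients at [s] and [s'] then coincide for each
    [t]. *)
Lemma generator_of_constant_displacement :
  (forall t, 0 < t -> exists theta K a, 0 <= K /\ Re a <= 0 /\
     forall s, theta <= Re s -> Cmod (Phi t s - s - a) <= K * exp (- Re s * ln 2)) ->
  forall s s', 0 < Re s -> 0 < Re s' -> H s = H s'.
Proof.
intros Hall s s' Hs Hs'.
assert (Hc : forall t, 0 < t -> (Phi t s - s)%C = (Phi t s' - s')%C).
{ intros t Ht. destruct (Hall t Ht) as [th [K [a [HK [Ha HT]]]]].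
  apply (constant_of_decay (fun z => Phi t z - z)%C); auto.
  - intros z Hz. destruct (semigroup_cdiff t z ltac:(lra) Hz) as [d Hd].
    eexists. apply cderiv_minus; [exact Hd|apply cderiv_id].
  - intros z Hz. rewrite re_minus. pose proof (semigroup_re_le t z Ht Hz). lra.
  - intros y e He. destruct (exp_linear_decay K e HK He) as [X [HX HXe]].
    exists (Rmax X th). intros x Hx. pose proof (Rmax_l X th). pose proof (Rmax_r X th).
    specialize (HT (x, y) ltac:(simpl; lra)). specialize (HXe x ltac:(lra)).
    pose proof (re_le_Cmod (Phi t (x, y) - (x, y) - a)) as R1. rewrite re_minus in R1.
    apply Rabs_le_between in R1. simpl Re in HT at 1.
    change (Re (x, y)) with x in HT.
    assert (Re (Phi t (x, y) - (x, y)) <= K * exp (- x * ln 2)) by lra. nra. }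
apply Ceq_minus, Cmod_eq_0, Rle_antisym; [|apply Cmod_ge_0].
apply le_epsilon. intros e He.
destruct (Hgen s Hs (e / 2)) as [d1 [Hd1 H1]]; [lra|].
destruct (Hgen s' Hs' (e / 2)) as [d2 [Hd2 H2]]; [lra|].
set (t := Rmin d1 d2 / 2).
assert (Ht : 0 < t /\ t < d1 /\ t < d2).
{ unfold t. pose proof (Rmin_l d1 d2). pose proof (Rmin_r d1 d2).
  pose proof (Rmin_glb_lt d1 d2 0 Hd1 Hd2). lra. }
specialize (H1 t ltac:(lra)). specialize (H2 t ltac:(lra)).
rewrite (Hc t) in H1 by lra. rewrite Cmod_minus_sym in H1.
eapply Rle_trans; [apply (Cmod_minus_triangle _ ((Phi t s' - s') / RtoC t))|]. lra.
Qed.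

(** * The Koenigs function of one map of the semigroup *)

Section Koenigs.

Variables (T theta K delta : R) (a : C).
Hypothesis HT : 0 < T.
Hypothesis Htheta : 0 < theta.
Hypothesis HK : 0 <= K.
Hypothesis Hdelta : 0 < delta.
Hypothesis Hcl : dclosure theta (fun s => Phi T s - s)%C.
Hypothesis Htail : forall s, theta < Re s -> Cmod (Phi T s - s - a) <= K * exp (- Re s * ln 2).
Hypothesis Hshift : forall s, theta < Re s -> Re s + delta <= Re (Phi T s).

Let orbit (n : nat) (s : C) : C := Phi (INR n * T) s.

Lemma orbit_time_pos n : 0 <= INR n * T.
Proof. apply Rmult_le_pos; [apply pos_INR|lra]. Qed.

Lemma orbit_S n s : 0 < Re s -> orbit (S n) s = Phi T (orbit n s).
Proof.
intros Hs. unfold orbit. rewrite (semigroup_comp _ Hsg) by (auto using orbit_time_pos; lra).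
f_equal. rewrite S_INR. ring.
Qed.

Lemma orbit_commute n t s : 0 <= t -> 0 < Re s -> orbit n (Phi t s) = Phi t (orbit n s).
Proof.
intros Ht Hs. unfold orbit. rewrite !(semigroup_comp _ Hsg) by auto using orbit_time_pos.
f_equal. ring.
Qed.

Lemma orbit_re n s : theta < Re s -> Re s + INR n * delta <= Re (orbit n s).
Proof.
intros Hs. induction n as [|n IH].
- unfold orbit. simpl INR. rewrite !Rmult_0_l, (semigroup_0 _ Hsg) by (unfold half_plane; lra). lra.
- rewrite orbit_S by lra. rewrite S_INR.
  assert (0 <= INR n * delta) by (apply Rmult_le_pos; [apply pos_INR|lra]).
  pose proof (Hshift (orbit n s) ltac:(lra)). lra.
Qed.

Lemma orbit_dclosure n : dclosure theta (fun s => orbit n s - s)%C.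
Proof.
induction n as [|n IH].
- apply dclosure_ext with (fun _ => RtoC 0); [|apply dclosure_const].
  intros s Hs. unfold orbit. simpl INR. rewrite Rmult_0_l, (semigroup_0 _ Hsg) by (unfold half_plane; lra). ring.
- apply dclosure_ext with (fun s => (orbit n s - s) + (Phi T (s + (orbit n s - s)) - (s + (orbit n s - s))))%C.
  { intros s Hs. rewrite orbit_S by lra.
    replace (s + (orbit n s - s))%C with (orbit n s) by ring. ring. }
  apply dclosure_plus; [exact IH|].
  apply (dclosure_comp theta theta (fun s => Phi T s - s)%C (fun s => orbit n s - s)%C); auto; [lra|].
  intros s Hs. replace (s + (orbit n s - s))%C with (orbit n s) by ring.
  pose proof (orbit_re n s Hs). assert (0 <= INR n * delta) by (apply Rmult_le_pos; [apply pos_INR|lra]). lra.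
Qed.

(** Each application of [Phi T] moves right by at least [delta], which multiplies the factor
    [2^{- Re s}] in the tail bound by at most [q]. *)
Let q : R := exp (- delta * ln 2).

Lemma ratio_lt_1 : 0 <= q < 1.
Proof.
unfold q. split; [left; apply exp_pos|]. rewrite <- exp_0. apply exp_increasing.
pose proof ln_lt_2. nra.
Qed.

(** Approximants of [h s - s]: unlike those of [h], they are bounded and lie in [dclosure]. *)
Let v (n : nat) (s : C) : C := (orbit n s - s - RtoC (INR n) * a)%C.

Lemma koenigs_step n s : theta < Re s ->
  Cmod (v (S n) s - v n s) <= K * exp (- Re s * ln 2) * q ^ n.
Proof.
intros Hs. unfold v. rewrite orbit_S by lra. rewrite S_INR, RtoC_plus.
replace (Phi T (orbit n s) - s - (RtoC (INR n) + RtoC 1) * a - (orbit n s - s - RtoC (INR n) * a))%C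
  with (Phi T (orbit n s) - orbit n s - a)%C by ring.
pose proof (orbit_re n s Hs) as HR.
assert (0 <= INR n * delta) by (apply Rmult_le_pos; [apply pos_INR|lra]).
eapply Rle_trans; [apply Htail; lra|]. rewrite Rmult_assoc. apply Rmult_le_compat_l; [exact HK|].
unfold q. rewrite <- Rpower_pow by apply exp_pos. unfold Rpower. rewrite ln_exp, <- exp_plus.
apply exp_le. pose proof ln_lt_2. nra.
Qed.

Let w (s : C) : C := epsilon (inhabits (RtoC 0)) (climit (fun n => v n s)).

Lemma koenigs_limit s : theta < Re s -> climit (fun n => v n s) (w s).
Proof.
intros Hs. unfold w. apply epsilon_spec.
apply (geometric_limit _ _ _ ratio_lt_1 (fun n => koenigs_step n s Hs)).
Qed.

Lemma koenigs_rate n s : theta < Re s ->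
  Cmod (v n s - w s) <= K * exp (- Re s * ln 2) / (1 - q) * q ^ n.
Proof.
intros Hs. destruct (geometric_limit _ _ _ ratio_lt_1 (fun n => koenigs_step n s Hs)) as [_ G].
apply G, koenigs_limit, Hs.
Qed.

Lemma koenigs_dclosure : dclosure theta w.
Proof.
pose proof ratio_lt_1 as Hq.
apply dclosure_limit. intros e He.
assert (HK' : 0 <= K / (1 - q)) by (apply Rdiv_le_0_compat; lra).
destruct (pow_lt_1_zero q ltac:(rewrite Rabs_pos_eq; lra) (e / (K / (1 - q) + 1))) as [N HN].
{ apply Rdiv_lt_0_compat; lra. }
specialize (HN N (le_n N)). rewrite Rabs_pos_eq in HN by (apply pow_le; lra).
exists (v N). split.
- apply dclosure_ext with (fun s => (orbit N s - s) + - (RtoC (INR N) * a))%C; [intros; unfold v; ring|].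
  apply dclosure_plus; [apply orbit_dclosure|apply dclosure_const].
- intros s Hs. rewrite Cmod_minus_sym. eapply Rle_trans; [apply koenigs_rate, Hs|].
  assert (E : exp (- Re s * ln 2) <= 1).
  { rewrite <- exp_0. apply exp_le. pose proof ln_lt_2. nra. }
  replace (K * exp (- Re s * ln 2) / (1 - q)) with (K / (1 - q) * exp (- Re s * ln 2)) by (field; lra).
  pose proof (exp_pos (- Re s * ln 2)).
  replace e with ((K / (1 - q) + 1) * (e / (K / (1 - q) + 1))) by (field; lra).
  apply Rmult_le_compat; try nra. apply pow_le; lra.
Qed.

Lemma koenigs_bound s : theta < Re s -> Cmod (w s) <= K / (1 - q) * exp (- Re s * ln 2).
Proof.
intros Hs. pose proof ratio_lt_1 as Hq. pose proof (koenigs_rate 0 s Hs) as B.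
assert (E : v 0 s = 0%C).
{ unfold v, orbit. simpl INR. rewrite Rmult_0_l, (semigroup_0 _ Hsg) by (unfold half_plane; lra). ring. }
rewrite E, Cmod_minus_sym in B. replace (w s - 0)%C with (w s) in B by ring.
simpl in B. eapply Rle_trans; [exact B|]. right. field. lra.
Qed.

(* Abel's equation [h (Phi t s) = h s + a_t] for [h s = s + w s]. *)
Lemma koenigs_abel t : 0 < t ->
  exists at_, forall s, theta < Re s -> (Phi t s + w (Phi t s))%C = (s + w s + at_)%C.
Proof.
intros Ht. destruct (semigroup_displacement t Ht) as [th [K' [at_ [Hth [HK' [_ HT']]]]]].
exists at_. intros s Hs.
assert (Hs' : theta < Re (Phi t s)).
{ pose proof (semigroup_re_le t s Ht ltac:(lra)). lra. }
(* As [Phi t] commutes with [Phi T], the defect in Abel's equation at level [n] is the tail of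
   [Phi t] at the point [orbit n s]. The orbit eventually enters the half-plane [Re s >= th] where
   that tail is small, although [s] itself need not lie there. *)
assert (E : forall n, (v n (Phi t s) - v n s - s + Phi t s - at_)%C =
   (Phi t (orbit n s) - orbit n s - at_)%C).
{ intros n. unfold v. rewrite orbit_commute by lra. ring. }
apply Ceq_minus, Cmod_eq_0, Rle_antisym; [|apply Cmod_ge_0].
apply le_epsilon. intros e He. rewrite Rplus_0_l.
destruct (koenigs_limit _ Hs (e / 3)) as [N1 HN1]; [lra|].
destruct (koenigs_limit _ Hs' (e / 3)) as [N2 HN2]; [lra|].
destruct (exp_linear_decay K' (e / 3) HK') as [X [HX HXe]]; [lra|].
(* An abscissa at least 1 lets the linear factor of [exp_linear_decay] be dropped. *)
set (Y := Rmax 1 (Rmax th X)).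
destruct (archimed_cor1 (delta / Y)) as [N3 [HN3 HN30]].
{ apply Rdiv_lt_0_compat; [exact Hdelta|]. pose proof (Rmax_l 1 (Rmax th X)). unfold Y. lra. }
assert (HY : 1 <= Y /\ th <= Y /\ X <= Y).
{ unfold Y. split; [apply Rmax_l|split].
  - eapply Rle_trans; [apply Rmax_l|apply Rmax_r].
  - eapply Rle_trans; [apply Rmax_r|apply Rmax_r]. }
set (n := max (max N1 N2) N3).
specialize (HN1 n ltac:(unfold n; lia)). specialize (HN2 n ltac:(unfold n; lia)).
assert (Hor : Y <= Re (orbit n s)).
{ pose proof (orbit_re n s Hs).
  assert (P3 : 0 < INR N3) by (apply lt_0_INR; lia).
  assert (INR N3 <= INR n) by (apply le_INR; unfold n; lia).
  assert (Y < INR N3 * delta).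
  { apply Rmult_lt_compat_r with (r := INR N3 * Y) in HN3; [|apply Rmult_lt_0_compat; lra].
    replace (/ INR N3 * (INR N3 * Y)) with Y in HN3 by (field; lra).
    replace (delta / Y * (INR N3 * Y)) with (INR N3 * delta) in HN3 by (field; lra). exact HN3. }
  nra. }
specialize (HT' (orbit n s) ltac:(lra)). specialize (HXe (Re (orbit n s)) ltac:(lra)).
rewrite <- E in HT'.
assert (B3 : K' * exp (- Re (orbit n s) * ln 2) <= e / 3).
{ eapply Rle_trans; [|exact HXe]. rewrite <- (Rmult_1_r (K' * _)) at 1.
  apply Rmult_le_compat_l; [|lra]. apply Rmult_le_pos; [exact HK'|left; apply exp_pos]. }
replace (Phi t s + w (Phi t s) - (s + w s + at_))%C with
  ((v n (Phi t s) - v n s - s + Phi t s - at_) + ((v n s - w s) - (v n (Phi t s) - w (Phi t s))))%C by ring.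
eapply Rle_trans; [apply Cmod_triangle|].
pose proof (Cmod_triangle_minus (v n s - w s) (v n (Phi t s) - w (Phi t s))). lra.
Qed.

(** By Abel's equation [at_ / t] is the difference quotient of [h] along the semigroup at every
    point, so for small [t] it is close to [h' H] at [s] and at [s'] simultaneously; the two values
    agree without taking a derivative of [a_t]. *)
Lemma koenigs_generator s s' d d' : theta < Re s -> theta < Re s' ->
  cderiv w s d -> cderiv w s' d' -> ((1 + d) * H s)%C = ((1 + d') * H s')%C.
Proof.
intros Hs Hs' Hd Hd'.
assert (G : forall s d, theta < Re s -> cderiv w s d -> forall e, 0 < e ->
  exists r, 0 < r /\ forall t, 0 < t < r ->
   Cmod ((Phi t s + w (Phi t s) - (s + w s)) / RtoC t - (1 + d) * H s) <= e).
{ clear s s' d d' Hs Hs' Hd Hd'. intros s d Hs Hd e He.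
  assert (Hh : cderiv (fun z => z + w z)%C s (1 + d)%C).
  { apply cderiv_plus; [apply cderiv_id|exact Hd]. }
  pose proof (Cmod_ge_0 (H s)) as PH. pose proof (Cmod_ge_0 (1 + d)%C) as Pd.
  (* [e1] pays for linearizing [h] along a displacement of size at most [(Cmod (H s) + 1) * t], [e2]
     for replacing the difference quotient by [H s]; the cap 1 on [e2] gives that size. *)
  set (e1 := e / (2 * (Cmod (H s) + 1))).
  assert (He1 : 0 < e1) by (apply Rdiv_lt_0_compat; lra).
  set (e2 := Rmin 1 (e / (2 * (Cmod (1 + d) + 1)))).
  assert (He2 : 0 < e2) by (apply Rmin_glb_lt; [lra|apply Rdiv_lt_0_compat; lra]).
  destruct (Hh e1 He1) as [r1 [Hr1 H1]].
  destruct (Hgen s ltac:(lra) e2 He2) as [r2 [Hr2 H2]].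
  destruct (semigroup_converges s r1 ltac:(lra) Hr1) as [r3 [Hr3 H3]].
  exists (Rmin r2 r3). split; [now apply Rmin_glb_lt|]. intros t Ht.
  pose proof (Rmin_l r2 r3). pose proof (Rmin_r r2 r3).
  specialize (H2 t ltac:(lra)). specialize (H3 t ltac:(lra)). specialize (H1 _ H3).
  assert (Nt : RtoC t <> RtoC 0) by (intros E; apply RtoC_inj in E; lra).
  set (D := ((Phi t s - s) / RtoC t)%C) in *.
  set (A := (Phi t s + w (Phi t s) - (s + w s))%C) in *.
  replace (A / RtoC t - (1 + d) * H s)%C with
    ((A - (1 + d) * (Phi t s - s)) / RtoC t + (1 + d) * (D - H s))%C.
  2:{ unfold D. field. exact Nt. }
  eapply Rle_trans; [apply Cmod_triangle|].
  rewrite Cmod_div, Cmod_mult, Cmod_R, (Rabs_pos_eq t) by (auto; lra).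
  assert (HD : Cmod D <= Cmod (H s) + 1).
  { replace D with ((D - H s) + H s)%C by ring. eapply Rle_trans; [apply Cmod_triangle|].
    assert (e2 <= 1) by apply Rmin_l. lra. }
  assert (B1 : Cmod (A - (1 + d) * (Phi t s - s)) / t <= e / 2).
  { apply Rle_trans with (e1 * Cmod D).
    - unfold D. rewrite Cmod_div, Cmod_R, (Rabs_pos_eq t) by (auto; lra).
      unfold Rdiv. rewrite <- Rmult_assoc. apply Rmult_le_compat_r; [left; apply Rinv_0_lt_compat; lra|exact H1].
    - apply Rle_trans with (e1 * (Cmod (H s) + 1)); [apply Rmult_le_compat_l; lra|].
      right. unfold e1. field. lra. }
  assert (B2 : Cmod (1 + d) * Cmod (D - H s) <= e / 2).
  { apply Rle_trans with ((Cmod (1 + d) + 1) * (e / (2 * (Cmod (1 + d) + 1)))).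
    - apply Rmult_le_compat; try lra; [apply Cmod_ge_0|].
      left. eapply Rlt_le_trans; [exact H2|apply Rmin_r].
    - right. field. lra. }
  lra. }
apply Ceq_minus, Cmod_eq_0, Rle_antisym; [|apply Cmod_ge_0].
apply le_epsilon. intros e He.
destruct (G s d Hs Hd (e / 2)) as [r1 [Hr1 H1]]; [lra|].
destruct (G s' d' Hs' Hd' (e / 2)) as [r2 [Hr2 H2]]; [lra|].
set (t := Rmin r1 r2 / 2).
assert (Ht : 0 < t /\ t < r1 /\ t < r2).
{ unfold t. pose proof (Rmin_l r1 r2). pose proof (Rmin_r r1 r2).
  pose proof (Rmin_glb_lt r1 r2 0 Hr1 Hr2). lra. }
specialize (H1 t ltac:(lra)). specialize (H2 t ltac:(lra)).
destruct (koenigs_abel t ltac:(lra)) as [at_ Hat].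
rewrite (Hat s Hs) in H1. rewrite (Hat s' Hs') in H2.
replace (s + w s + at_ - (s + w s))%C with at_ in H1 by ring.
replace (s' + w s' + at_ - (s' + w s'))%C with at_ in H2 by ring.
rewrite Cmod_minus_sym in H1.
eapply Rle_trans; [apply (Cmod_minus_triangle _ (at_ / RtoC t))|]. lra.
Qed.

Lemma generator_dirichlet_koenigs : is_dirichlet_series H.
Proof.
pose proof ratio_lt_1 as Hq.
assert (HK' : 0 <= K / (1 - q)) by (apply Rdiv_le_0_compat; lra).
set (W := fun s => epsilon (inhabits (RtoC 0)) (cderiv w s)).
assert (HW : forall s, theta < Re s -> cderiv w s (W s)).
{ intros s Hs. unfold W. apply epsilon_spec. apply (dclosure_cdiff theta w s koenigs_dclosure Hs). }
(* A bound [1 / 4] on [w], valid one unit further left, gives increments of at most [1 / 2] on unit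
   discs, hence [Cmod (W s) <= 1 / 2] as [dclosure_inv] requires. *)
destruct (exp_linear_decay (K / (1 - q)) (1 / 4) HK') as [X [HX HXe]]; [lra|].
set (th := Rmax theta (Rmax X 1) + 1).
assert (Hth : theta + 1 <= th /\ X + 1 <= th /\ 2 <= th).
{ unfold th. pose proof (Rmax_l theta (Rmax X 1)). pose proof (Rmax_r theta (Rmax X 1)).
  pose proof (Rmax_l X 1). pose proof (Rmax_r X 1). lra. }
assert (Hwb : forall z, th - 1 < Re z -> Cmod (w z) <= 1 / 4).
{ intros z Hz. eapply Rle_trans; [apply koenigs_bound; lra|].
  specialize (HXe (Re z) ltac:(lra)). eapply Rle_trans; [|exact HXe].
  rewrite <- (Rmult_1_r (K / (1 - q) * _)) at 1. apply Rmult_le_compat_l; [|lra].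
  apply Rmult_le_pos; [exact HK'|left; apply exp_pos]. }
assert (HWb : forall s, th < Re s -> Cmod (W s) <= 1 / 2).
{ intros s Hs.
  assert (Hin : forall z, Cmod (z - s) < 1 -> th - 1 < Re z).
  { intros z Hz. pose proof (re_le_Cmod (z - s)) as B. rewrite re_minus in B.
    apply Rabs_le_between in B. lra. }
  replace (1 / 2) with (1 / 2 / 1) by field.
  apply (cauchy_estimate w s _ 1).
  - lra.
  - intros z Hz. exists (W z). apply HW. pose proof (Hin z Hz). lra.
  - intros z Hz. eapply Rle_trans; [apply Cmod_triangle_minus|].
    pose proof (Hwb z (Hin z Hz)). pose proof (Hwb s ltac:(lra)). lra.
  - apply HW. lra. }
(* A reference point at which the constant [c = h' H] is read off. *)
set (s0 := RtoC (th + 1)). assert (Hs0 : theta < Re s0) by (simpl; lra).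
set (c := ((1 + W s0) * H s0)%C).
apply (dclosure_is_dirichlet_series th).
apply dclosure_ext with (fun s => c * / (1 + W s))%C.
- intros s Hs. unfold c.
  rewrite (koenigs_generator s0 s (W s0) (W s)) by (try apply HW; lra).
  assert (N : (1 + W s)%C <> RtoC 0).
  { apply Cmod_gt_0. pose proof (Cmod_triangle_rev 1 (- W s)) as B.
    rewrite Cmod_1, Cmod_opp in B. replace (1 - - W s)%C with (1 + W s)%C in B by ring.
    specialize (HWb s Hs). lra. }
  field. exact N.
- apply dclosure_mult; [lra|apply dclosure_const|]. apply dclosure_inv; [lra| |exact HWb].
  apply (dclosure_mono (theta + 1)); [lra|].
  apply (dclosure_cderiv theta w); [apply koenigs_dclosure|exact HW].
Qed.

End Koenigs.

Lemma generator_is_dirichlet_series : is_dirichlet_series H.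
Proof.
destruct (classic (exists t, 0 < t /\ exists theta K a, 0 < theta /\ 0 <= K /\ 0 < Re a /\
  dclosure theta (fun s => Phi t s - s)%C /\
  forall s, theta <= Re s -> Cmod (Phi t s - s - a) <= K * exp (- Re s * ln 2))) as [Hex|Hno].
- destruct Hex as [t [Ht [th [K [a [Hth [HK [Ha [Hcl HTl]]]]]]]]].
  (* Beyond this abscissa the tail is at most [Re a / 2], so [Phi t] moves every point right by at
     least [Re a / 2], the [delta] of the Koenigs construction. *)
  destruct (exp_linear_decay K (Re a / 2) HK) as [X [HX HXe]]; [lra|].
  set (th1 := Rmax th (Rmax X 1)).
  assert (Hth1 : th <= th1 /\ X <= th1 /\ 1 <= th1).
  { unfold th1. pose proof (Rmax_l th (Rmax X 1)). pose proof (Rmax_r th (Rmax X 1)).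
    pose proof (Rmax_l X 1). pose proof (Rmax_r X 1). lra. }
  apply (generator_dirichlet_koenigs t th1 K (Re a / 2) a); auto; try lra.
  + apply (dclosure_mono th); [lra|exact Hcl].
  + intros s Hs. apply HTl. lra.
  + intros s Hs. specialize (HTl s ltac:(lra)). specialize (HXe (Re s) ltac:(lra)).
    assert (B : K * exp (- Re s * ln 2) <= Re a / 2).
    { eapply Rle_trans; [|exact HXe]. rewrite <- (Rmult_1_r (K * _)) at 1.
      apply Rmult_le_compat_l; [|lra]. apply Rmult_le_pos; [exact HK|left; apply exp_pos]. }
    pose proof (re_le_Cmod (Phi t s - s - a)) as R1. rewrite !re_minus in R1.
    apply Rabs_le_between in R1. lra.
(* No displacement has a constant coefficient with positive real part, so [H] is constant, with
   value [H 1]. *)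
- apply (dclosure_is_dirichlet_series 0).
  apply dclosure_ext with (fun _ => H 1); [|apply dclosure_const].
  intros s Hs. apply generator_of_constant_displacement; [|simpl; lra|exact Hs].
  intros t Ht. destruct (semigroup_displacement t Ht) as [th [K [a [Hth [HK [Hcl HTl]]]]]].
  exists th, K, a. split; [exact HK|]. split; [|exact HTl].
  apply Rnot_lt_le. intros Ha. apply Hno. exists t. split; [exact Ht|].
  exists th, K, a. auto 10.
Qed.

End Semigroup.

Theorem theorem1p3 :
  forall H : C -> C,
    analytic_on (half_plane 0) H ->
    (forall s : C, half_plane 0 s -> 0 <= Re (H s)) ->
    ((exists Phi : R -> C -> C,
        continuous_semigroup Phi /\
        (forall t : R, 0 <= t -> gordon_hedenmalm (Phi t)) /\
        is_generator Phi H)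
     <-> (forall eps : R, 0 < eps -> Hinfty eps H))
    /\
    ((forall eps : R, 0 < eps -> Hinfty eps H)
     <-> is_dirichlet_series H).
Proof.
intros H HA Hpos.
assert (Hdiff : forall s, 0 < Re s -> cdiff H s) by now apply analytic_on_cdiff.
assert (bc : (forall eps : R, 0 < eps -> Hinfty eps H) -> is_dirichlet_series H).
{ intros Hb. apply (Hinfty_dirichlet _ _ (Hb 1 Rlt_0_1)). }
assert (cb : is_dirichlet_series H -> forall eps : R, 0 < eps -> Hinfty eps H).
{ now apply Hinfty_of_dirichlet_series. }
split; split; auto.
- intros [Phi [Hsg [HGH Hgen]]]. apply cb.
  apply (generator_is_dirichlet_series Phi H Hsg HGH). now apply is_generator_iff.
- intros Hb. apply semigroup_of_dirichlet_series; auto.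
Qed.
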